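(* Let $\boldsymbol\sigma,\boldsymbol\tau\in\boldsymbol S_n$, $\nu_c=\sigma_c\tau_c^{-1}$ for $c=1,\dots,D$, and let $p_C[\boldsymbol\sigma,\boldsymbol\tau;l]$ be defined by $W_C^{(N)}[\boldsymbol\sigma,\boldsymbol\tau]=N^{-nD}\sum_{l\ge0}(-1)^lp_C[\boldsymbol\sigma,\boldsymbol\tau;l]N^{-l}$ ($N\ge n$). Then: (i) for every $l\ge0$, \[ (-1)^lp_C[\boldsymbol\sigma,\boldsymbol\tau;l]=\sum_{\substack{\pi_1\ge\Pi(\nu_1),\dots,\pi_D\ge\Pi(\nu_D)\\ \Pi(\boldsymbol\sigma,\boldsymbol\tau)\vee\pi_1\vee\cdots\vee\pi_D=1_n}}\ \sum_{\substack{l_1,\dots,l_D\ge0\\ \sum_cl_c=l}}\ \prod_{c=1}^D\Big[\sum_{\substack{\{l_{B_c}\}_{B_c\in\pi_c}\ge0\\ \sum_{B_c}l_{B_c}=l_c}}\ \prod_{B_c\in\pi_c}\gamma_{l_{B_c}}(\nu_{c|B_c})\Big]; \] (ii) the smallest $l$ such that $p_C[\boldsymbol\sigma,\boldsymbol\tau;l]$ does not vanish is $\ell=\ell(\boldsymbol\sigma,\boldsymbol\tau)=\sum_{c=1}^D\lVert\sigma_c\tau_c^{-1}\rVert+2(|\Pi(\boldsymbol\sigma,\boldsymbol\tau)|-1)$; (iii) $W_C^{(N)}[\boldsymbol\sigma,\boldsymbol\tau]=N^{-nD-\ell}(-1)^\ell p_C[\boldsymbol\sigma,\boldsymbol\tau;\ell](1+O(N^{-2}))$;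 (iv) the leading coefficient is \[ (-1)^\ell p_C[\boldsymbol\sigma,\boldsymbol\tau;\ell]=\sum_{\substack{\pi_1\ge\Pi(\nu_1),\dots,\pi_D\ge\Pi(\nu_D)\\ \Pi(\boldsymbol\sigma,\boldsymbol\tau)\vee\pi_1\vee\cdots\vee\pi_D=1_n\\ \sum_c(|\Pi(\nu_c)|-|\pi_c|)=|\Pi(\boldsymbol\sigma,\boldsymbol\tau)|-1}}\ \prod_{c=1}^D\prod_{B_c\in\pi_c}\gamma(\nu_{c|B_c}), \] where, for $\nu\in S_m$, $\gamma(\nu)=\mathsf M(\nu)\,\frac{(3m-\lVert\nu\rVert-3)!}{(2m)!}\prod_{p\ge1}[2p(2p-1)]^{d_p(\nu)}$; (v) for $l>\ell$, \[ (-1)^lp_C[\boldsymbol\sigma,\boldsymbol\tau;l]=\sum_{L=0}^{\frac{l-\ell}{2}}\ \sum_{\substack{\pi_1\ge\Pi(\nu_1),\dots,\pi_D\ge\Pi(\nu_D)\\ \Pi(\boldsymbol\sigma,\boldsymbol\tau)\vee\pi_1\vee\cdots\vee\pi_D=1_n\\ \sum_c(|\Pi(\nu_c)|-|\pi_c|)=|\Pi(\boldsymbol\sigma,\boldsymbol\tau)|+L-1}}\ \sum_{\substack{g_1,\dots,g_D\ge0\\ \sum_cg_c=\frac{l-\ell}{2}-L}}\ \prod_{c=1}^D\Big[\sum_{\substack{\{g_{B_c}\}_{B_c\in\pi_c}\ge0\\ \sum_{B_c}g_{B_c}=g_c}}\ \prod_{B_c\in\pi_c}\gamma_{l(g_{B_c})}(\nu_{c|B_c})\Big],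 \] with $l(g_{B_c})=|B_c|+\#(\nu_{c|B_c})+2g_{B_c}-2$.
   Context: For $\nu\in S_m$: $\#(\nu)$ is the number of cycles, $\lVert\nu\rVert=m-\#(\nu)$, $d_p(\nu)$ the number of cycles of length $p$, $\mathsf M(\nu)=\prod_{p\ge1}\big[\frac{(-1)^{p-1}}{p}\binom{2p-2}{p-1}\big]^{d_p(\nu)}$. Set partitions of $\{1,\dots,n\}$ are ordered by refinement $\le$; $\vee$ is the join; $1_n$ the one-block partition; $|\pi|$ the number of blocks. $\Pi(\nu)$ is the partition into cycles of $\nu$, and $\Pi(\boldsymbol\sigma,\boldsymbol\tau)$ the orbit partition of the group generated by all $\sigma_c,\tau_c$. When $\pi_c\ge\Pi(\nu_c)$, $\nu_c$ stabilizes each block $B_c$ and $\nu_{c|B_c}$ is its restriction, regarded as a permutation of a $|B_c|$-element set. For $\nu\in S_m$ and $l,k\ge0$, $\gamma_l(\nu;k)$ is the number of $k$-tuples $(\rho_1,\dots,\rho_k)$ of non-identity elements of $S_m$ with $\rho_1\cdots\rho_k=\nu$, $\sum_i\lVert\rho_i\rVert=l$, and the group generated by $\rho_1,\dots,\rho_k$ transitive on $\{1,\dots,m\}$; $\gamma_l(\nu)=\sum_{k\ge0}(-1)^k\gamma_l(\nu;k)$. Weingarten function $W^{(N)}:S_m\to\mathbb R$ ($m\le N$): the unique function with $\int dU\,U_{i_1a_1}\cdots U_{i_ma_m}\overline{U_{j_1b_1}\cdots U_{j_mb_m}}=\sum_{\sigma,\tau\in S_m}\prod_s\delta_{i_s,j_{\sigma(s)}}\prod_s\delta_{a_s,b_{\tau(s)}}W^{(N)}(\sigma\tau^{-1})$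 (Haar measure on $U(N)$). $W^{(N)}_\pi[\boldsymbol\sigma,\boldsymbol\tau]=\chi(\Pi(\boldsymbol\sigma,\boldsymbol\tau)\le\pi)\prod_{B\in\pi}\prod_{c=1}^DW^{(N)}(\sigma_{c|B}\tau_{c|B}^{-1})$ and $W_C^{(N)}[\boldsymbol\sigma,\boldsymbol\tau]=\sum_\pi(-1)^{|\pi|-1}(|\pi|-1)!\,W_\pi^{(N)}[\boldsymbol\sigma,\boldsymbol\tau]$ (sum over set partitions of $\{1,\dots,n\}$). *)

(* Defs.v *)
From HB Require Import structures.
From mathcomp Require Import all_boot all_order all_fingroup all_algebra.

Set Implicit Arguments.
Unset Strict Implicit.
Unset Printing Implicit Defensive.

Import Order.TTheory GRing.Theory Num.Theory.

Section SetPartitions.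
Variable T : finType.
Implicit Types P Q S : {set {set T}}.

Definition set_partition P : bool := partition P [set: T].

Definition refines P Q : bool := [forall A in P, [exists B in Q, A \subset B]].

Definition bottom_partition : {set {set T}} := [set [set x] | x : T].

Definition one_block : {set {set T}} := [set [set: T]].

Definition same_block P Q : rel T :=
  [rel x y | (y \in pblock P x) || (y \in pblock Q x)].

Definition partition_join P Q : {set {set T}} :=
  equivalence_partition (connect (same_block P Q)) [set: T].

Lemma same_block_sym P Q : set_partition P -> set_partition Q ->
  symmetric (same_block P Q).
Proof.
have sym S : set_partition S -> forall x y, (y \in pblock S x) -> (x \in pblock S y).
  case/and3P=> /eqP covS tiS _ x y yx.
  by rewrite (same_pblock tiS yx) mem_pblock covS.
move=> pP pQ x y; rewrite /= /same_block /=; apply/idP/idP.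
- by case/orP=> /sym -> //; rewrite ?orbT.
- by case/orP=> /sym -> //; rewrite ?orbT.
Qed.

Lemma same_block_equiv P Q : set_partition P -> set_partition Q ->
  {in [set: T] & &, equivalence_rel (connect (same_block P Q))}.
Proof.
move=> pP pQ x y z _ _ _; split=> [|xy]; first exact: connect0.
exact: (same_connect (sym_connect_sym (same_block_sym pP pQ)) xy).
Qed.

Lemma refinesP P Q : set_partition P -> set_partition Q ->
  reflect (forall x y, y \in pblock P x -> y \in pblock Q x) (refines P Q).
Proof.
case/and3P=> /eqP covP tiP P0 /and3P[/eqP covQ tiQ Q0].
apply: (iffP forall_inP) => [PQ x y yx | PQ A AP].
  have /PQ/exists_inP[B BQ AB] : pblock P x \in P by rewrite pblock_mem // covP.
  have xB : x \in B by apply: (subsetP AB); rewrite mem_pblock covP.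
  by rewrite (def_pblock tiQ BQ xB) (subsetP AB).
have [x xA] : exists x, x \in A.
  by apply/set0Pn; apply: contraNneq P0 => <-.
apply/exists_inP; exists (pblock Q x); first by rewrite pblock_mem // covQ.
by apply/subsetP=> y yA; apply: PQ; rewrite (def_pblock tiP AP xA).
Qed.

Lemma partition_joinP P Q : set_partition P -> set_partition Q ->
  [/\ set_partition (partition_join P Q),
      refines P (partition_join P Q), refines Q (partition_join P Q) &
      forall S, set_partition S -> refines P S -> refines Q S ->
        refines (partition_join P Q) S].
Proof.
move=> pP pQ; have eqv := same_block_equiv pP pQ.
have pJ : set_partition (partition_join P Q) by exact: equivalence_partitionP.
have JE x y : (y \in pblock (partition_join P Q) x) = connect (same_block P Q) x y.
  by rewrite pblock_equivalence_partition ?inE.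
split=> //.
- by apply/refinesP=> // x y yx; rewrite JE connect1 // /same_block /= yx.
- by apply/refinesP=> // x y yx; rewrite JE connect1 // /same_block /= yx orbT.
move=> S pS /refinesP PS /refinesP QS; apply/refinesP=> // x y.
rewrite JE => /connectP[p]; case/and3P: (pS) => /eqP covS tiS _.
elim: p x => /= [x _ ->|z p IHp x /andP[xz zp] ylast].
  by rewrite mem_pblock covS inE.
have zx : z \in pblock S x by case/orP: xz => [/PS|/QS]; apply.
by rewrite -(same_pblock tiS zx); apply: IHp.
Qed.

End SetPartitions.

Section Permutations.
Local Open Scope nat_scope.

Section Cycles.
Variable m : nat.
Implicit Type nu : 'S_m.

Definition ncycles nu : nat := #|porbits nu|.
Definition perm_norm nu : nat := m - ncycles nu.
Definition ncycles_of_length (p : nat) nu : nat :=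
  #|[set C in porbits nu | #|C| == p]|.

(* MathComp composes permutations from left to right, so the reversed product
   is the composite rho_1 \o ... \o rho_k. *)
Definition gamma_count (l k : nat) nu : nat :=
  #|[set rho : {ffun 'I_k -> 'S_m} |
      [&& [forall i, rho i != 1%g],
          (\prod_(i < k) rho (rev_ord i))%g == nu,
          \sum_(i < k) perm_norm (rho i) == l
        & [transitive <<[set rho i | i : 'I_k]>>, on [set: 'I_m] | 'P]]]|.

(* A non-identity permutation has norm at least 1, hence gamma_count l k nu = 0
   for k > l and the sum over all k >= 0 stops at l. *)
Definition gamma_l (l : nat) nu : int :=
  (\sum_(k < l.+1) (-1) ^+ k * (gamma_count l k nu)%:Z)%R.

Local Open Scope ring_scope.

(* Cycle lengths lie in 1, ..., m, so both products over p >= 1 stop at m. *)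
Definition Moebius_perm (R : fieldType) nu : R :=
  \prod_(1 <= p < m.+1)
    ((-1) ^+ (p - 1)%N / p%:R * ('C(2 * p - 2, p - 1)%N)%:R) ^+ ncycles_of_length p nu.

Definition gamma_lead (R : fieldType) nu : R :=
  Moebius_perm R nu
    * ((3 * m - perm_norm nu - 3)`!%N%:R / (2 * m)`!%N%:R)
    * \prod_(1 <= p < m.+1)
        ((2 * p * (2 * p - 1))%N)%:R ^+ ncycles_of_length p nu.

End Cycles.

(* The restriction of s to B, read on 'I_#|B| through the enumeration of B.
   restr_perm B s agrees with s on B as soon as s stabilizes B. *)
Section Restriction.
Variables (n : nat) (B : {set 'I_n}) (s : 'S_n).

Definition block_fun (i : 'I_#|B|) : 'I_#|B| :=
  enum_rank_in (enum_valP i) (restr_perm B s (enum_val i)).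

Lemma block_funE i : enum_val (block_fun i) = restr_perm B s (enum_val i).
Proof.
by rewrite enum_rankK_in // (perm_closed _ (restr_perm_on B s)) enum_valP.
Qed.

Lemma block_fun_inj : injective block_fun.
Proof.
move=> i j /(congr1 enum_val); rewrite !block_funE.
by move/perm_inj/enum_val_inj.
Qed.

Definition block_perm : 'S_#|B| := perm block_fun_inj.

Lemma block_permE i : s \in 'N(B | 'P)%g ->
  enum_val (block_perm i) = s (enum_val i).
Proof.
move=> sB; rewrite permE block_funE restr_permE //.
exact: enum_valP.
Qed.

End Restriction.

Section Tuples.
Variables (n D : nat).
Implicit Types (sigma tau : 'I_D -> 'S_n) (pi : {ffun 'I_D -> {set {set 'I_n}}}).

(* The composite sigma_c \o tau_c^-1. *)
Definition quotient_perm sigma tau (c : 'I_D) : 'S_n :=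
  ((tau c)^-1 * sigma c)%g.

Definition joint_orbits sigma tau : {set {set 'I_n}} :=
  orbit 'P <<[set sigma c | c : 'I_D] :|: [set tau c | c : 'I_D]>>
    @: [set: 'I_n].

Definition ell sigma tau : nat :=
  \sum_(c < D) perm_norm (quotient_perm sigma tau c)
    + 2 * (#|joint_orbits sigma tau| - 1).

(* pi_c >= Pi(nu_c) for all c, and Pi(sigma,tau) \/ pi_1 \/ ... \/ pi_D = 1_n. *)
Definition admissible sigma tau pi : bool :=
  [forall c, set_partition (pi c)
               && refines (porbits (quotient_perm sigma tau c)) (pi c)]
  && (partition_join (joint_orbits sigma tau)
        (\big[@partition_join _/@bottom_partition _]_(c < D) pi c)
      == @one_block _).

Definition merge_count sigma tau pi : nat :=
  \sum_(c < D) (#|porbits (quotient_perm sigma tau c)| - #|pi c|).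

End Tuples.
End Permutations.

(* Families (k_i)_{i : I} of naturals with sum k; each k_i is then at most k. *)
Definition weak_compositions (I : finType) (k : nat) : {set {ffun I -> 'I_k.+1}} :=
  [set f : {ffun I -> 'I_k.+1} | (\sum_i f i)%N == k].

From mathcomp Require Import complex.
From mathcomp Require Import all_classical all_reals all_analysis.
Import numFieldNormedType.Exports.

Local Open Scope ring_scope.

Section Unitary.
Variables (R : realType) (N : nat).

Definition unitary : Type := {U : 'M[R[i]]_N | U \is unitarymx}.

Lemma unitary1 : (1%:M : 'M[R[i]]_N) \is unitarymx.
Proof. by apply/unitarymxP; rewrite trmx1 map_mx1 mulmx1. Qed.

HB.instance Definition _ := Choice.on unitary.
HB.instance Definition _ := isPointed.Build unitary 
  (exist (fun U : 'M[R[i]]_N => is_true (U \is unitarymx)) 1%:M unitary1).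

Definition unitary_mul (V U : unitary) : unitary :=
  exist _ (sval V *m sval U) (mul_unitarymx (svalP V) (svalP U)).

Local Open Scope classical_set_scope.

(* Relative open sets of U(N); the topology of 'M[R[i]^o]_N is the usual one. *)
Definition unitary_open : set (set unitary) :=
  [set (fun U : unitary => sval U : 'M[R[i]^o]_N) @^-1` O
     | O in @open 'M[R[i]^o]_N].

Definition unitary_borel := g_sigma_algebraType unitary_open.

Definition is_haar (mu : probability unitary_borel R) : Prop :=
  forall (V : unitary) (A : set unitary_borel), measurable A ->
    mu (unitary_mul V @^-1` A) = mu A.

Definition unitary_integral (mu : probability unitary_borel R)
    (f : unitary -> R[i]) : R[i] :=
  Complex (\int[mu]_U complex.Re (f U)) (\int[mu]_U complex.Im (f U)).

Definition is_weingarten (mu : probability unitary_borel R) (m : nat)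
    (W : 'S_m -> R) : Prop :=
  forall i a j b : 'I_m -> 'I_N,
    unitary_integral mu (fun U : unitary =>
      (\prod_s sval U (i s) (a s)) * (\prod_s sval U (j s) (b s))^*)
    = (\sum_(sigma : 'S_m) \sum_(tau : 'S_m)
         (\prod_s (i s == j (sigma s))%:R) * (\prod_s (a s == b (tau s))%:R)
           * W (tau^-1 * sigma)%g)%:C%C.

End Unitary.

Section Cumulant.
Variables (R : realType) (W : forall m : nat, 'S_m -> R) (n D : nat).
Implicit Types (sigma tau : 'I_D -> 'S_n) (P : {set {set 'I_n}}).

Definition W_part P sigma tau : R :=
  (refines (joint_orbits sigma tau) P)%:R *
  \prod_(B in P) \prod_(c < D)
    W ((block_perm B (tau c))^-1 * block_perm B (sigma c))%g.

Definition W_C sigma tau : R :=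
  \sum_(P : {set {set 'I_n}} | set_partition P)
    (-1) ^+ (#|P| - 1) * ((#|P| - 1)`!)%:R * W_part P sigma tau.

End Cumulant.

(* sum over {k_B}_{B in P} with sum k of prod_{B in P} gamma_(k_B)(nu|_B). *)
Definition block_gamma (R : realType) (n : nat) (P : {set {set 'I_n}})
    (nu : 'S_n) (k : nat) : R :=
  \sum_(lB in weak_compositions {B : {set 'I_n} | B \in P} k)
    \prod_(B : {B : {set 'I_n} | B \in P})
      (gamma_l (lB B) (block_perm (sval B) nu))%:~R.

(* The same sum with gamma_(l(g_B)), l(g) = |B| + #(nu|_B) + 2 g - 2. *)
Definition block_gamma_genus (R : realType) (n : nat) (P : {set {set 'I_n}})
    (nu : 'S_n) (g : nat) : R :=
  \sum_(gB in weak_compositions {B : {set 'I_n} | B \in P} g)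
    \prod_(B : {B : {set 'I_n} | B \in P})
      (gamma_l (#|sval B| + ncycles (block_perm (sval B) nu) + 2 * gB B - 2)%N
         (block_perm (sval B) nu))%:~R.

(* Main.v *)
(** Unitarity of the matrix entries alone shows that N^m W^(N), as an element of the
    group algebra of S_m, is inverse to the sum of N^(-|r|) r over all permutations r.
    Hence it has an asymptotic expansion in x = 1/N whose coefficients are signed counts
    of factorisations into non-identity permutations, and a convergent expansion such as
    the one defining p_C must have the same coefficients. The count of factorisations of
    length k is a polynomial in k, the signed count is its value at k = -1; evaluating at
    k = -1 the decomposition of a factorisation along its orbits gives
    W(nu) = sum over partitions pi of products of connected series over the blocks.
    Inserting this in the cumulant and summing the Moebius function over the partitions
    above a given join leaves the terms whose join is the one-block partition: this is (i).

    Writing the sum of x^|r| r over S_m as the corresponding sum over S_(m-1) times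
    1 + x (sum of the transpositions moving a given point z) yields a cut-and-join recursion
    for the connected series. It shows that the coefficient of x^l vanishes unless
    l = m + #(nu) - 2 + 2g with g >= 0, which gives (ii), (iii) and (v), and that the
    coefficients with g = 0 satisfy a quadratic recursion in the cycle lengths. The explicit
    product formula solves this recursion; after differentiating in the weight of one cycle
    the verification reduces to the convolution identity for the powers of the series
    r = 1 + sum_l eps_l r^(2 a_l + 1) and to one sum of central binomial coefficients. *)

Require Import Defs.
From HB Require Import structures.
From mathcomp Require Import all_boot all_order all_fingroup all_algebra.
From mathcomp Require boolp.
From mathcomp Require Import zify ring lra.

Set Implicit Arguments.
Unset Strict Implicit.
Unset Printing Implicit Defensive.

Import Order.TTheory GRing.Theory Num.Theory.
Local Open Scope ring_scope.

(** * Formal power series *)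

(** The obstacle in the orbit decomposition is that the restriction of a non-identity permutation to
    an invariant set may be the identity: lengths of factorisations do not add over the orbits, and
    signs $(-1)^k$ do not multiply. If the identity is allowed as a letter, words of a fixed length
    k split letter by letter, and counts are multiplicative for each k. Inserting the identity
    changes neither product, norm nor orbits, so these counts are combinations of the binomials C(k,
    j), with the number of words of j non-identity letters as coefficients; C(-1, j) = (-1)^j is why
    k = -1 gives the signed count. All series belong to subsets B of one fixed type and are 0 on
    permutations that do not stabilise B. The recursions thus stay inside one symmetric group, and
    the passage to permutations of #|B| points is made once. Nonvanishing in (ii) rests on signs:
    gamma(nu) has the sign $(-1)^{m+\#(\nu)}$ for nu in $S_m$, so the terms of the leading
    coefficient cannot cancel, and one admissible family with the least number of merges is
    constructed. *)

Record fps (K : Type) := Fps { fcoef : nat -> K }.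

Lemma fps_ext (K : Type) (f g : fps K) : fcoef f =1 fcoef g -> f = g.
Proof. by case: f g => f [g] /= /boolp.funext ->. Qed.

HB.instance Definition _ (K : Type) := boolp.gen_eqMixin (fps K).
HB.instance Definition _ (K : Type) := boolp.gen_choiceMixin (fps K).

Section FpsZmod.
Variable K : zmodType.
Implicit Types f g h : fps K.

Definition fps_zero : fps K := Fps (fun=> 0).
Definition fps_opp f := Fps (fun l => - fcoef f l).
Definition fps_add f g := Fps (fun l => fcoef f l + fcoef g l).

Lemma fps_addA : associative fps_add.
Proof. by move=> f g h; apply: fps_ext => l /=; rewrite addrA. Qed.
Lemma fps_addC : commutative fps_add.
Proof. by move=> f g; apply: fps_ext => l /=; rewrite addrC. Qed.
Lemma fps_add0 : left_id fps_zero fps_add.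
Proof. by move=> f; apply: fps_ext => l /=; rewrite add0r. Qed.
Lemma fps_addN : left_inverse fps_zero fps_opp fps_add.
Proof. by move=> f; apply: fps_ext => l /=; rewrite addNr. Qed.

HB.instance Definition _ :=
  GRing.isZmodule.Build (fps K) fps_addA fps_addC fps_add0 fps_addN.

End FpsZmod.

Section FpsRing.
Variable K : comNzRingType.
Implicit Types f g h : fps K.

Definition fps_one : fps K := Fps (fun l => (l == 0%N)%:R).
Definition fps_mul f g :=
  Fps (fun l => \sum_(i < l.+1) fcoef f i * fcoef g (l - i)%N).

Definition fps_trunc L f : {poly K} := \poly_(i < L.+1) fcoef f i.

Lemma coef_fps_trunc L f i : (i <= L)%N -> (fps_trunc L f)`_i = fcoef f i.
Proof. by move=> iL; rewrite coef_poly ltnS iL. Qed.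

(** The coefficient of x^l sees only truncations at any L >= l. The ring laws of the Cauchy product
    are inherited from polynomials in this way. *)
Lemma fcoef_mul_trunc L f g l : (l <= L)%N ->
  fcoef (fps_mul f g) l = (fps_trunc L f * fps_trunc L g)`_l.
Proof.
move=> lL; rewrite coefM /=; apply: eq_bigr => i _.
by rewrite !coef_fps_trunc //; move: (ltn_ord i); lia.
Qed.

Lemma fps_mulC : commutative fps_mul.
Proof.
by move=> f g; apply: fps_ext => l; rewrite !(@fcoef_mul_trunc l) // mulrC.
Qed.

Lemma coefM_eq (p q r s : {poly K}) l :
  (forall i, (i <= l)%N -> p`_i = q`_i) -> (forall i, (i <= l)%N -> r`_i = s`_i) ->
  (p * r)`_l = (q * s)`_l.
Proof.
move=> pq rs; rewrite !coefM; apply: eq_bigr => i _.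
by rewrite pq ?rs //; move: (ltn_ord i); lia.
Qed.

Lemma fps_mulA : associative fps_mul.
Proof.
move=> f g h; apply: fps_ext => l; rewrite !(@fcoef_mul_trunc l) //.
have E u v i : (i <= l)%N ->
    (fps_trunc l (fps_mul u v))`_i = (fps_trunc l u * fps_trunc l v)`_i.
  by move=> il; rewrite coef_fps_trunc // (@fcoef_mul_trunc l).
rewrite (coefM_eq (q := fps_trunc l f) (s := fps_trunc l g * fps_trunc l h)) //;
  last exact: E.
rewrite [RHS](coefM_eq (q := fps_trunc l f * fps_trunc l g) (s := fps_trunc l h)) //;
  last exact: E.
by rewrite mulrA.
Qed.

Lemma fps_mul1 : left_id fps_one fps_mul.
Proof.
move=> f; apply: fps_ext => l /=; rewrite big_ord_recl subn0 /= mul1r.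
by rewrite big1 ?addr0 // => i _; rewrite mul0r.
Qed.

Lemma fps_mulDl : left_distributive fps_mul +%R.
Proof.
move=> f g h; apply: fps_ext => l /=; rewrite -big_split /=.
by apply: eq_bigr => i _; rewrite mulrDl.
Qed.

Lemma fps_one_neq0 : fps_one != 0.
Proof.
by apply/eqP => /(congr1 (fun f => fcoef f 0)) /= /eqP; rewrite oner_eq0.
Qed.

HB.instance Definition _ := GRing.Zmodule_isComNzRing.Build (fps K)
  fps_mulA fps_mulC fps_mul1 fps_mulDl fps_one_neq0.

Lemma fcoefD f g l : fcoef (f + g) l = fcoef f l + fcoef g l. Proof. by []. Qed.
Lemma fcoefN f l : fcoef (- f) l = - fcoef f l. Proof. by []. Qed.
Lemma fcoefB f g l : fcoef (f - g) l = fcoef f l - fcoef g l. Proof. by []. Qed.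
Lemma fcoef0 l : fcoef (0 : fps K) l = 0. Proof. by []. Qed.
Lemma fcoef1 l : fcoef (1 : fps K) l = (l == 0%N)%:R. Proof. by []. Qed.
Lemma fcoefM f g l :
  fcoef (f * g) l = \sum_(i < l.+1) fcoef f i * fcoef g (l - i)%N.
Proof. by []. Qed.

Lemma fcoef_sum (I : Type) (r : seq I) (P : pred I) (F : I -> fps K) l :
  fcoef (\sum_(i <- r | P i) F i) l = \sum_(i <- r | P i) fcoef (F i) l.
Proof. exact: (big_morph (fun f => fcoef f l)). Qed.

Lemma fcoefMn f n l : fcoef (f *+ n) l = fcoef f l *+ n.
Proof. by elim: n => // n IHn; rewrite !mulrS fcoefD IHn. Qed.

Lemma fcoef_nat n l : fcoef (n%:R : fps K) l = n%:R * (l == 0%N)%:R.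
Proof. by rewrite fcoefMn fcoef1 mulr_natl. Qed.

Lemma fcoef_natM n f l : fcoef (n%:R * f) l = n%:R * fcoef f l.
Proof. by rewrite !mulr_natl fcoefMn. Qed.

Definition fpsX : fps K := Fps (fun l => (l == 1%N)%:R).

Lemma fcoefXM f l : fcoef (fpsX * f) l = if l is l'.+1 then fcoef f l' else 0.
Proof.
rewrite fcoefM; case: l => [|l]; first by rewrite big_ord1 /= mul0r.
rewrite !big_ord_recl /= mul0r add0r mul1r subSS subn0.
by rewrite big1 ?addr0 // => i _; rewrite mul0r.
Qed.

Lemma fcoefXnM n f l :
  fcoef (fpsX ^+ n * f) l = if (n <= l)%N then fcoef f (l - n)%N else 0.
Proof.
elim: n l => [|n IHn] l; first by rewrite expr0 mul1r subn0.
by rewrite exprS -mulrA fcoefXM; case: l => [|l] //; rewrite IHn subSS ltnS.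
Qed.

Lemma fcoefXn n l : fcoef (fpsX ^+ n) l = (l == n)%:R.
Proof.
rewrite -[fpsX ^+ n]mulr1 fcoefXnM fcoef1; case: leqP => // nl.
  by congr (_%:R); lia.
by case: eqP => // e; lia.
Qed.

Lemma fcoef_prod_trunc (I : Type) (r : seq I) (F : I -> fps K) L l :
  (l <= L)%N ->
  fcoef (\prod_(i <- r) F i) l = (\prod_(i <- r) fps_trunc L (F i))`_l.
Proof.
elim: r l => [|i r IHr] l lL; first by rewrite !big_nil coef1.
rewrite !big_cons (@fcoef_mul_trunc L) //; apply: coefM_eq => // j jl.
by rewrite coef_fps_trunc ?IHr //; lia.
Qed.

(** The exponents are bounded by a free M >= l, so that the index type of the families can be
    prescribed by the application. *)
Lemma fcoef_prod (I : finType) (F : I -> fps K) M l : (l <= M)%N ->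
  fcoef (\prod_i F i) l =
  \sum_(h : {ffun I -> 'I_M.+1} | (\sum_i h i)%N == l)
     \prod_i fcoef (F i) (h i).
Proof.
move=> lM; rewrite (@fcoef_prod_trunc _ _ _ M) //.
under eq_bigr do rewrite /fps_trunc poly_def.
rewrite bigA_distr_bigA coef_sum [RHS]big_mkcond /=; apply: eq_bigr => h _.
under eq_bigr do rewrite -mul_polyC.
rewrite big_split /= -(big_morph (fun n => 'X^n : {poly K}) (exprD _) (expr0 _)).
rewrite -rmorph_prod /= coefCM coefXn eq_sym.
by case: eqP; rewrite ?mulr1 ?mulr0.
Qed.

(* [fps_dil e h] is x^e h(x^2). *)
Definition fps_dil e h : fps K :=
  Fps (fun l => if (e <= l)%N && ~~ odd (l - e) then fcoef h (l - e)./2 else 0).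

(** After the powers of x are factored out, only even indices contribute to the product of two even
    series. *)
Lemma fps_dil_mul e e' h h' :
  fps_dil e h * fps_dil e' h' = fps_dil (e + e') (h * h').
Proof.
have D0 u : fps_dil 0 u =
    Fps (fun l => if odd l then 0 else fcoef u l./2).
  by apply: fps_ext => l /=; rewrite subn0; case: odd.
have DX e0 u : fps_dil e0 u = fpsX ^+ e0 * fps_dil 0 u.
  apply: fps_ext => l; rewrite fcoefXnM D0 /=.
  by case: leqP => //= _; case: odd.
rewrite DX (DX e') (DX (e + e')%N) exprD !mulrA -(mulrA (fpsX ^+ e)).
rewrite (mulrC (fps_dil 0 h)) !mulrA -!mulrA; congr (_ * (_ * _)).
apply: fps_ext => l; rewrite !D0 fcoefM /=.
have [lo|le] := boolP (odd l).
  apply: big1 => i _; case: (boolP (odd i)) => io; rewrite ?mul0r //.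
  by rewrite oddB ?lo ?(negbTE io) ?mulr0 // -ltnS.
have [k ->] : exists k, l = k.*2 by exists l./2; rewrite -[LHS]odd_double_half (negbTE le).
rewrite doubleK -(big_mkord xpredT (fun i => (if odd i then 0 else fcoef h i./2) *
   (if odd (k.*2 - i) then 0 else fcoef h' (k.*2 - i)./2))).
have E n (G : nat -> K) : \sum_(0 <= i < n.*2.+1) (if odd i then 0 else G i) =
    \sum_(0 <= i < n.+1) G i.*2.
  elim: n => [|n IHn]; first by rewrite !big_nat1.
  by rewrite doubleS big_nat_recr //= big_nat_recr //= IHn [RHS]big_nat_recr //=
     odd_double /= addr0 doubleS.
rewrite (eq_bigr (fun i => if odd i then 0 else
   fcoef h i./2 * (if odd (k.*2 - i) then 0 else fcoef h' (k.*2 - i)./2))); last first.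
  by move=> i _; case: odd; rewrite ?mul0r.
rewrite E big_mkord; apply: eq_bigr => i _.
by rewrite -doubleB odd_double !doubleK.
Qed.

Lemma fps_dil_prod (I : finType) (P : pred I) (e : I -> nat) (h : I -> fps K) :
  \prod_(i | P i) fps_dil (e i) (h i) =
  fps_dil (\sum_(i | P i) e i) (\prod_(i | P i) h i).
Proof.
apply: (big_rec3 (fun y x e => x = fps_dil e y)) => [|i x y f _ ->]; last first.
  exact: fps_dil_mul.
apply: fps_ext => l; rewrite fcoef1 /= subn0.
by case: l => [|[|l]] //=; case: odd.
Qed.

End FpsRing.
Arguments fpsX {K}.

(** * Convolutions of central binomial coefficients *)

Section CentralBinomial.
Variable K : numFieldType.

Definition cbin (n : nat) : K := ('C(n.*2, n))%:R.
Definition wcbin (n : nat) : K := n%:R * cbin n.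

Lemma cbin_neq0 n : cbin n != 0.
Proof. by rewrite pnatr_eq0 -lt0n bin_gt0 -addnn leq_addr. Qed.

Lemma wcbinE n : wcbin n = n%:R * cbin n. Proof. by []. Qed.

Lemma wcbin1 : wcbin 1 = 2.
Proof. by rewrite /wcbin /cbin mul1r; congr _%:R. Qed.

Lemma cbinS n : n.+1%:R * cbin n.+1 = (4 * n + 2)%:R * cbin n.
Proof.
rewrite -!natrM; congr _%:R; rewrite doubleS.
have E1 := mul_bin_diag n.*2.+1 n; have E2 := mul_bin_left n.*2.+1 n.
have E3 := mul_bin_diag n.*2 n; have E4 := mul_bin_left n.*2 n.
rewrite !mulSn in E1 E2 E3 E4.
have -> : ('C(n.*2.+2, n.+1) = 'C(n.*2.+1, n.+1) + 'C(n.*2.+1, n))%N by rewrite binS.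
have F : 'C(n.*2.+1, n.+1) = 'C(n.*2.+1, n).
  by rewrite -[LHS]bin_sub; [congr 'C(_, _)|]; lia.
have G : (n.+1 * 'C(n.*2.+1, n.+1) = n.*2.+1 * 'C(n.*2, n))%N.
  by rewrite -mul_bin_diag.
nia.
Qed.

Let nz (n : nat) : n.+1%:R != 0 :> K. Proof. by rewrite pnatr_eq0. Qed.

Definition cbin_conv n := \sum_(i < n.+1) cbin i * cbin (n - i).

(** The weight n+1-i is what [cbinS] needs to lower the index by one, and it kills the term i =
    n+1. *)
Lemma sumS_cbin n (G : nat -> K) :
  \sum_(i < n.+2) (n.+1 - i)%:R * cbin (n.+1 - i) * G i =
  \sum_(i < n.+1) (4 * (n - i) + 2)%:R * cbin (n - i) * G i.
Proof.
rewrite big_ord_recr /= subnn !mul0r addr0; apply: eq_bigr => i _.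
by rewrite subSn ?cbinS // -ltnS.
Qed.

Lemma cbin_conv_rev n (G : nat -> K) :
  \sum_(i < n.+1) cbin i * cbin (n - i) * G (n - i)%N =
  \sum_(i < n.+1) cbin i * cbin (n - i) * G i.
Proof.
rewrite (reindex_inj rev_ord_inj) /=; apply: eq_bigr => i _.
by rewrite subSS subKn -1?ltnS // [cbin _ * _]mulrC.
Qed.

(** Symmetry under i -> n-i turns n times the convolution into twice the sum with weight n-i, to
    which [sumS_cbin] applies. The convolution is therefore 4^n. *)
Lemma cbin_convS n : cbin_conv n.+1 = 4 * cbin_conv n.
Proof.
apply: (mulfI (nz n)).
have E m : m%:R * cbin_conv m = 2 * \sum_(i < m.+1) cbin i * cbin (m - i) * (m - i)%:R.
  have -> : m%:R * cbin_conv m = \sum_(i < m.+1) cbin i * cbin (m - i) * i%:R +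
     \sum_(i < m.+1) cbin i * cbin (m - i) * (m - i)%:R.
    rewrite mulr_sumr -big_split /=; apply: eq_bigr => i _.
    by rewrite -mulrDr -natrD subnKC 1?mulrC // -ltnS.
  by rewrite -(cbin_conv_rev m (fun i => i%:R)) -mulr2n mulr_natl.
rewrite E.
have -> : \sum_(i < n.+2) cbin i * cbin (n.+1 - i) * (n.+1 - i)%:R =
    \sum_(i < n.+2) (n.+1 - i)%:R * cbin (n.+1 - i) * cbin i.
  by apply: eq_bigr => i _; ring.
rewrite (sumS_cbin n cbin).
have -> : n.+1%:R * (4 * cbin_conv n) = 4 * (n%:R * cbin_conv n) + 4 * cbin_conv n :> K.
  by rewrite -natr1; ring.
rewrite E !mulrA !mulr_sumr -big_split /=; apply: eq_bigr => i _.
by rewrite natrD natrM; ring.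
Qed.

(** Induction on n. Multiplied by n+k+2 = (i+k+1) + (n+1-i), the sum for n+1 splits into the plain
    convolution and a sum whose index [sumS_cbin] lowers. *)
Lemma sum_cbin_frac n k :
  \sum_(i < n.+1) cbin i * cbin (n - i) / (i + k.+1)%:R =
  cbin (n + k.+1) / wcbin k.+1.
Proof.
elim: n => [|n IHn].
  rewrite big_ord1 !add0n subn0 /wcbin.
  rewrite (_ : cbin 0 = 1) ?bin0 //; field.
  by rewrite addrC natr1 nz /= cbin_neq0.
apply: (mulfI (nz (n + k.+1)%N)).
rewrite mulrA addSn cbinS -mulrA -{}IHn.
have -> : (n + k.+1).+1%:R * (\sum_(i < n.+2) cbin i * cbin (n.+1 - i) / (i + k.+1)%:R)
  = cbin_conv n.+1 + \sum_(i < n.+2) (n.+1 - i)%:R * cbin (n.+1 - i) * (cbin i / (i + k.+1)%:R).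
  rewrite mulr_sumr -big_split /=; apply: eq_bigr => i _.
  have -> : (n + k.+1).+1%:R = (i + k.+1)%:R + (n.+1 - i)%:R :> K.
    by rewrite -natrD; congr _%:R; move: (ltn_ord i); lia.
  have : (i + k.+1)%:R != 0 :> K by rewrite addnS.
  move: (_ + _)%:R => u nzu; field => //.
rewrite (sumS_cbin n (fun i => cbin i / (i + k.+1)%:R)) cbin_convS.
rewrite !mulr_sumr -big_split /=; apply: eq_bigr => i _.
have -> : (4 * (n + k.+1) + 2)%:R = 4 * (i + k.+1)%:R + (4 * (n - i) + 2)%:R :> K.
  by rewrite -natrM -natrD; congr _%:R; move: (ltn_ord i); lia.
have : (i + k.+1)%:R != 0 :> K by rewrite addnS.
move: (_ + k.+1)%:R => u nzu; field => //.
Qed.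

(** Partial fractions: for u = j+1+l and v = n-j+k+1 the sum u+v does not depend on j, and (n-j)(1/u
    + 1/v) = (n+1+l)/u - (k+1)/v. This leaves two sums as in [sum_cbin_frac], to which the term j =
    n can be added because its weight n-j is 0. *)
Lemma sum_cbin_two_frac n k l :
  \sum_(j < n) cbin j * wcbin (n - j) / ((j.+1 + l)%:R * (n - j + k.+1)%:R) =
  (wcbin (n.+1 + l) / wcbin l.+1 - cbin (n + k.+1) / cbin k.+1) / (n.+1 + k.+1 + l)%:R.
Proof.
have nzs : (n.+1 + k.+1 + l)%:R != 0 :> K by rewrite !addSn.
apply: (mulIf nzs); rewrite mulfVK //.
have -> : \sum_(j < n) cbin j * wcbin (n - j) / ((j.+1 + l)%:R * (n - j + k.+1)%:R) =
          \sum_(j < n.+1) cbin j * wcbin (n - j) / ((j.+1 + l)%:R * (n - j + k.+1)%:R).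
  by rewrite [RHS]big_ord_recr /= subnn /wcbin !mul0r mulr0 mul0r addr0.
have E1 : wcbin (n.+1 + l) / wcbin l.+1 =
    \sum_(j < n.+1) (n.+1 + l)%:R * (cbin j * cbin (n - j) / (j + l.+1)%:R).
  rewrite -mulr_sumr sum_cbin_frac mulrA -addSnnS //.
have E2 : cbin (n + k.+1) / cbin k.+1 =
    \sum_(j < n.+1) k.+1%:R * (cbin j * cbin (n - j) / (n - j + k.+1)%:R).
  rewrite -mulr_sumr (cbin_conv_rev n (fun i => (i + k.+1)%:R^-1)) sum_cbin_frac /wcbin.
  by field; rewrite cbin_neq0 addrC natr1 nz.
rewrite {}E1 {}E2 mulr_suml -sumrB; apply: eq_bigr => j _.
have -> : (n.+1 + k.+1 + l)%:R = (j.+1 + l)%:R + (n - j + k.+1)%:R :> K.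
  by rewrite -natrD; congr _%:R; move: (ltn_ord j); lia.
have -> : (n.+1 + l)%:R = (j.+1 + l)%:R + (n - j)%:R :> K.
  by rewrite -natrD; congr _%:R; move: (ltn_ord j); lia.
have -> : (j + l.+1 = j.+1 + l)%N by lia.
rewrite /wcbin (natrD _ (n - j)).
have n1 : (j.+1 + l)%:R != 0 :> K by rewrite addSn.
have n2 : (n - j)%:R + k.+1%:R != 0 :> K by rewrite -natrD addnS.
move: n1 n2; move: (_ + l)%:R (n - j)%:R k.+1%:R => u v w nu nv; field.
by rewrite nu nv.
Qed.

(** The recursion of the Catalan numbers. It is the case of [planar_rec] in which the distinguished
    cycle is the only one. *)
Lemma catalan_rec n :
  cbin n / n.+1%:R = (n == 0%N)%:R +
  \sum_(j < n) cbin j / j.+1%:R * (cbin (n.-1 - j) / (n - j)%:R).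
Proof.
case: n => [|n]; first by rewrite big_ord0 /cbin bin0 divr1 addr0.
rewrite add0r /=.
have -> : \sum_(j < n.+1) cbin j / j.+1%:R * (cbin (n - j) / (n.+1 - j)%:R) =
  (\sum_(j < n.+1) cbin j * cbin (n - j) / (j + 1)%:R +
   \sum_(j < n.+1) cbin j * cbin (n - j) / (n - j + 1)%:R) / n.+2%:R.
  rewrite -big_split mulr_suml /=; apply: eq_bigr => j _.
  rewrite !addn1 subSn -1?ltnS //.
  have -> : n.+2%:R = j.+1%:R + (n - j).+1%:R :> K.
    by rewrite -natrD; congr _%:R; move: (ltn_ord j); lia.
  have n3 : j.+1%:R + (n - j).+1%:R != 0 :> K by rewrite -natrD addSn.
  have := nz j; have := nz (n - j); move: n3.
  by move: (n - j).+1%:R j.+1%:R => u v n3 nu nv; field; rewrite ?nu ?nv ?n3.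
rewrite (cbin_conv_rev n (fun i => (i + 1)%:R^-1)) sum_cbin_frac addn1.
rewrite wcbin1.
by have := nz n.+1; move: n.+2%:R => u nu; field.
Qed.

End CentralBinomial.

(** * Sums over subsets with a marked element *)

Section SubsetSums.
Variables (I : finType) (V : nmodType).
Implicit Types S T : {set I}.

Lemma sum_subset_pick S (F : I -> {set I} -> {set I} -> V) :
  \sum_(T : {set I} | T \subset S) \sum_(l in T) F l (T :\ l) (S :\: T) =
  \sum_(l in S) \sum_(T : {set I} | T \subset S :\ l) F l T ((S :\ l) :\: T).
Proof.
rewrite (exchange_big_dep (mem S)) /=; last by move=> T l /subsetP TS /TS.
apply: eq_bigr => l lS.
rewrite (reindex_onto (fun T => l |: T) (fun T => T :\ l)) /=; last first.
  by move=> T /andP[_ lT]; rewrite setD1K.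
apply: eq_big => [T|T].
  rewrite setU11 andbT subUset sub1set lS /= subsetD1.
  congr (_ && _); apply/eqP/idP => [<-|lT]; first by rewrite !inE eqxx.
  by rewrite setU1K.
by move=> /andP[_ /eqP e]; rewrite e setDDl.
Qed.

Lemma sum_subset_setU1 k S (F : {set I} -> {set I} -> V) : k \notin S ->
  \sum_(T : {set I} | T \subset k |: S) F T ((k |: S) :\: T) =
  \sum_(T : {set I} | T \subset S) F (k |: T) (S :\: T) +
  \sum_(T : {set I} | T \subset S) F T (k |: (S :\: T)).
Proof.
move=> kS; rewrite (bigID (fun T : {set I} => k \in T)) /=; congr (_ + _).
  rewrite (reindex_onto (fun T => k |: T) (fun T => T :\ k)) /=; last first.
    by move=> T /andP[_ lT]; rewrite setD1K.
  apply: eq_big => [T|T].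
    rewrite setU11 andbT; apply/andP/idP => [[TS /eqP e]|TS].
      by rewrite -e subDset.
    have kT : k \notin T by apply: contra kS; apply/subsetP.
    by rewrite setU1K // setUS.
  move=> _; congr F.
  apply/setP=> x; rewrite !inE; case: (altP (x =P k)) => //= ->.
  by rewrite (negbTE kS) andbF.
apply: eq_big => [T|T].
  apply/andP/idP => [[/subsetP TS kT]|TS].
    apply/subsetP=> x xT; have := TS x xT; rewrite !inE => /orP[/eqP e|//].
    by rewrite -e xT in kT.
  split; first exact: subset_trans TS (subsetUr _ _).
  by apply: contra kS; apply/subsetP.
move=> /andP[_ kT]; congr F; apply/setP=> x; rewrite !inE.
by case: (altP (x =P k)) => //= ->; rewrite kT.
Qed.

Lemma sum_subset_compl S (F : {set I} -> {set I} -> V) :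
  \sum_(T : {set I} | T \subset S) F T (S :\: T) =
  \sum_(T : {set I} | T \subset S) F (S :\: T) T.
Proof.
rewrite (reindex_onto (fun T => S :\: T) (fun T => S :\: T)) /=; last first.
  by move=> T TS; rewrite setDDr setDv set0U; apply/setIidPr.
apply: eq_big => [T|T /andP[_ /eqP ->] //].
rewrite subsetDl setDDr setDv set0U /=.
by apply/eqP/idP => [<-|/setIidPr //]; rewrite subsetIl.
Qed.

End SubsetSums.

(** * The product formula and its quadratic recursion *)

Section PlanarNumbers.
Variables (K : numFieldType) (I : finType) (al : I -> nat).
Hypothesis al_gt0 : forall i, (0 < al i)%N.
Implicit Types S T : {set I}.

Local Notation cbin := (@cbin K).
Local Notation wcbin := (@wcbin K).

Definition swt S := (\sum_(i in S) al i)%N.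
Definition cwt S := \prod_(i in S) wcbin (al i).

Lemma swtD1 l S : l \in S -> swt S = (al l + swt (S :\ l))%N.
Proof. by move=> lS; rewrite /swt (big_setD1 l). Qed.

Lemma cwtD1 l S : l \in S -> cwt S = wcbin (al l) * cwt (S :\ l).
Proof. by move=> lS; rewrite /cwt (big_setD1 l). Qed.

Lemma cardD1E l S : l \in S -> #|S| = (#|S :\ l|).+1.
Proof. by move=> lS; rewrite (cardsD1 l) lS. Qed.

(* The coefficients of r^x, where r = 1 + sum_l eps_l r^(2 al_l + 1). *)
Definition tree_pow (x : nat) S : K :=
  if S == set0 then 1 else
  x%:R * ((x + 2 * swt S + #|S|).-1)`!%:R / ((x + 2 * swt S)`!)%:R.

Let nzf (n : nat) : n`!%:R != 0 :> K. Proof. by rewrite pnatr_eq0 -lt0n fact_gt0. Qed.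
Let nz (n : nat) : n.+1%:R != 0 :> K. Proof. by rewrite pnatr_eq0. Qed.

Lemma tree_pow_gt0 x S :
  tree_pow x.+1 S = x.+1%:R * ((x + 2 * swt S + #|S|))`!%:R / ((x.+1 + 2 * swt S)`!)%:R.
Proof.
rewrite /tree_pow; case: eqP => [->|_] //.
by rewrite /swt big_set0 cards0 muln0 !addn0 factS natrM divff // mulf_neq0.
Qed.

(** This is r = 1 + sum_l eps_l r^(2 al_l + 1), multiplied by r^x and read at the monomial of the
    eps_l with l in S. *)
Lemma tree_powS x S : S != set0 ->
  tree_pow x.+1 S = tree_pow x S + \sum_(l in S) tree_pow (x.+1 + 2 * al l) (S :\ l).
Proof.
move=> S0; rewrite tree_pow_gt0 {1}/tree_pow (negbTE S0).
have [s Es] : exists s, #|S| = s.+1.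
  by exists #|S|.-1; rewrite prednK // card_gt0.
pose q := (x + 2 * swt S)%N.
have -> : \sum_(l in S) tree_pow (x.+1 + 2 * al l) (S :\ l) =
  \sum_(l in S) (x.+1 + 2 * al l)%:R * ((q + s)`!%:R / (q.+1)`!%:R).
  apply: eq_bigr => l lS; rewrite addSn tree_pow_gt0 -mulrA.
  have := cardD1E lS; have := swtD1 lS; rewrite Es => e1 [e2].
  have -> : (x + 2 * al l + 2 * swt (S :\ l) + #|S :\ l| = q + s)%N by lia.
  by have -> : ((x + 2 * al l).+1 + 2 * swt (S :\ l) = q.+1)%N by lia.
rewrite -mulr_suml -natr_sum big_split /= sum_nat_const -big_distrr /= -/(swt S) Es.
have -> : (x + 2 * swt S + s.+1 = (q + s).+1)%N by rewrite /q; lia.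
have -> : (x.+1 + 2 * swt S = q.+1)%N by rewrite /q; lia.
rewrite -/q !factS !natrM.
have E : x.+1%:R * (q + s).+1%:R = x%:R * q.+1%:R + (s.+1 * x.+1 + 2 * swt S)%:R :> K.
  by rewrite -!natrM -natrD; congr _%:R; rewrite /q; nia.
have := nzf q; have := nz q; move: (q`!%:R) (q.+1%:R) E => u w E nu nw.
by rewrite mulrA E; field; rewrite ?nu ?nw.
Qed.

Lemma tree_pow0 S : tree_pow 0 S = (S == set0)%:R.
Proof. by rewrite /tree_pow; case: eqP => // _; rewrite !mul0r. Qed.

(** The law r^x r^y = r^(x+y). Induction on the size of S and, inside it, on x: the functional
    equation [tree_powS] either lowers x or removes an element of S. *)
Lemma tree_powD x y S :
  \sum_(T : {set I} | T \subset S) tree_pow x T * tree_pow y (S :\: T) =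
  tree_pow (x + y) S.
Proof.
have [n] := ubnP #|S|; elim: n S x => // n IHn S x Sn.
elim: x => [|x IHx].
  rewrite (bigD1 set0) ?sub0set //= tree_pow0 eqxx mul1r setD0 big1 ?addr0 //.
  by move=> T /andP[_ /negbTE T0]; rewrite tree_pow0 T0 mul0r.
have [->|S0] := eqVneq S set0.
  rewrite (big_pred1 set0) => [|T]; last by rewrite subset0.
  by rewrite set0D /tree_pow eqxx mulr1.
rewrite addSn tree_powS // -IHx.
have E T : tree_pow x.+1 T = tree_pow x T +
    \sum_(l in T) tree_pow (x.+1 + 2 * al l) (T :\ l).
  have [->|] := eqVneq T set0; last exact: tree_powS.
  by rewrite big_set0 addr0 /tree_pow eqxx.
under eq_bigr => T _ do rewrite E mulrDl mulr_suml.
rewrite big_split /=; congr (_ + _).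
rewrite (sum_subset_pick S (fun l T T' => tree_pow (x.+1 + 2 * al l) T * tree_pow y T')).
apply: eq_bigr => l lS; rewrite IHn.
  by congr tree_pow; lia.
by rewrite (cardD1E lS) in Sn.
Qed.

(** The coefficients of r^(2x) after each eps_l has been given the weight [wcbin (al l)]. *)
Definition ypow x S := cwt S * tree_pow (2 * x) S.

Lemma cwt_split T S : T \subset S -> cwt T * cwt (S :\: T) = cwt S.
Proof. by move=> TS; rewrite /cwt [RHS](big_setID T) /= (setIidPr TS). Qed.

Lemma ypowD x y S :
  \sum_(T : {set I} | T \subset S) ypow x T * ypow y (S :\: T) = ypow (x + y) S.
Proof.
rewrite /ypow mulnDr -tree_powD mulr_sumr; apply: eq_bigr => T TS.
by rewrite -(cwt_split TS); ring.
Qed.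

(** Up to sign, the genus-zero coefficient for a distinguished cycle of length a and further cycles
    of lengths [al l], l in S; see [planar_leadE] and [conn_fact_lead]. *)
Definition planar a S : K :=
  wcbin a * cwt S * ((2 * (a + swt S) + #|S| - 2)`!%:R / (2 * (a + swt S))`!%:R).

Lemma ypowE x S : ypow x.+1 S = cwt S * ((2 * x.+1)%:R *
   ((2 * (x.+1 + swt S) + #|S|).-1)`!%:R / (2 * (x.+1 + swt S))`!%:R).
Proof.
rewrite /ypow mulnS tree_pow_gt0.
by congr (_ * (_ * _`!%:R / _`!%:R)); lia.
Qed.

(** With a second cycle k singled out, the factorial quotient is a coefficient of an even power of
    r, which makes the convolution law [ypowD] available. *)
Lemma planarU1 k S a : k \notin S ->
  planar a.+1 (k |: S) =
  wcbin a.+1 * wcbin (al k) * ypow (a.+1 + al k) S / (2 * (a.+1 + al k))%:R.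
Proof.
move=> kS; rewrite /planar (@swtD1 k) ?setU11 // (@cwtD1 k) ?setU11 // setU1K //.
rewrite (@cardD1E k) ?setU11 // setU1K // (addSn a (al k)) ypowE.
set M := (2 * (a.+1 + (al k + swt S)))%N.
have -> : (2 * ((a + al k).+1 + swt S) = M)%N by rewrite /M; lia.
have -> : ((M + #|S|).-1 = M + #|S|.+1 - 2)%N by rewrite /M; lia.
have := nzf M.
have : (2 * (a + al k).+1)%:R != 0 :> K by rewrite pnatr_eq0 muln_eq0.
by move: (2 * _)%:R M`!%:R => u w nu nw; field; rewrite ?nu ?nw.
Qed.

(** All terms of the sum over l contain the same factorial quotient. Only the total of 1 + 2 al_l,
    which is |T| + 2 swt T, enters, and [cbinS] supplies the matching factor 4j+2. *)
Lemma planarE j T :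
  planar j.+1 T = cbin j * (ypow j.+1 T / j.+1%:R -
    \sum_(l in T) wcbin (al l) * (1 + 2 * al l)%:R * ypow (j.+1 + al l) (T :\ l)
        / (j.+1 + al l)%:R).
Proof.
set M := (2 * (j.+1 + swt T))%N.
have -> : \sum_(l in T) wcbin (al l) * (1 + 2 * al l)%:R * ypow (j.+1 + al l) (T :\ l)
        / (j.+1 + al l)%:R =
   \sum_(l in T) (1 + 2 * al l)%:R * (cwt T * 2 * ((M + #|T| - 2)`!%:R / M`!%:R)).
  apply: eq_bigr => l lT; rewrite addSn ypowE (cwtD1 lT) (cardD1E lT).
  have -> : (2 * ((j + al l).+1 + swt (T :\ l)) = M)%N.
    by rewrite /M (swtD1 lT); lia.
  have -> : ((M + #|T :\ l|).-1 = M + #|T :\ l|.+1 - 2)%N by lia.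
  rewrite natrM.
  have := nzf M; have := nz (j + al l)%N.
  move: M`!%:R (j + al l).+1%:R => u w nu nw; field.
  by rewrite ?nu ?nw.
rewrite -mulr_suml -natr_sum big_split /= sum1_card -big_distrr /= -/(swt T).
rewrite ypowE -/M /planar -/M /wcbin cbinS.
have [m Em] : exists m, (M + #|T|)%N = m.+2.
  by exists (M + #|T| - 2)%N; rewrite /M; lia.
have Fm : (4 * j + 2)%:R = 2 * m.+1%:R - 2 * (#|T| + 2 * swt T)%:R :> K.
  rewrite -mulrBr -natrB; last by move: Em; rewrite /M; lia.
  by rewrite -natrM; congr _%:R; move: Em; rewrite /M; lia.
move: (M) Em => {}M Em; rewrite Em /= subSS subSS subn0 factS Fm !natrM.
have := nzf M; have := nz j.
by move: M`!%:R j.+1%:R => u w nu nw; field; rewrite ?nu ?nw.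
Qed.

(** By [planarE] the first factor is a combination of powers of r, so [ypowD] performs the
    convolution, for each removed l separately. *)
Lemma planar_ypow j x S :
  \sum_(T : {set I} | T \subset S) planar j.+1 T * ypow x (S :\: T) =
  cbin j * (ypow (j.+1 + x) S / j.+1%:R -
    \sum_(l in S) wcbin (al l) * (1 + 2 * al l)%:R * ypow (j.+1 + x + al l) (S :\ l)
        / (j.+1 + al l)%:R).
Proof.
under eq_bigr => T _ do rewrite planarE -mulrA mulrBl.
rewrite -mulr_sumr sumrB; congr (_ * (_ - _)).
  by rewrite -ypowD mulr_suml; apply: eq_bigr => T _; rewrite mulrAC.
under eq_bigr => T _ do rewrite mulr_suml.
rewrite (sum_subset_pick S (fun l T T' => wcbin (al l) * (1 + 2 * al l)%:R *
  ypow (j.+1 + al l) T / (j.+1 + al l)%:R * ypow x T')).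
apply: eq_bigr => l lS.
rewrite addnAC -ypowD mulr_sumr mulr_suml; apply: eq_bigr => T _.
by ring.
Qed.

(** The cut-and-join recursion for the product formula: the middle sum joins the distinguished cycle
    of length n+1 to another one, the last sum cuts it into lengths j+1 and n-j. For A nonempty a
    cycle k of A is marked; in each product one factor contains k and is treated by [planarU1], the
    other by [planar_ypow]. *)
Lemma planar_rec n A :
  planar n.+1 A = ((n == 0%N) && (A == set0))%:R +
  \sum_(k in A) (al k)%:R * planar (n.+1 + al k) (A :\ k) +
  \sum_(j < n) \sum_(T : {set I} | T \subset A) planar j.+1 T * planar (n - j) (A :\: T).
Proof.
have [->|/set0Pn[k kA]] := eqVneq A set0.
  have P0 j : planar j.+1 set0 = cbin j / j.+1%:R.
    by rewrite planarE big_set0 subr0 /ypow /tree_pow eqxx /cwt big_set0 !mul1r.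
  rewrite big_set0 addr0 andbT P0 catalan_rec; congr (_ + _).
  apply: eq_bigr => j _; rewrite (big_pred1 set0) => [|T]; last by rewrite subset0.
  rewrite set0D P0; have [m Em] : exists m, (n - j = m.+1)%N.
    by exists (n - j).-1; move: (ltn_ord j); lia.
  by rewrite Em P0; congr (_ * (_ / _)); congr cbin; lia.
have [S kS AE] : exists2 S : {set I}, k \notin S & A = k |: S.
  by exists (A :\ k); rewrite ?setD1K // !inE eqxx.
rewrite andbF add0r AE.
(* The reflection j -> n-1-j exchanges the two pieces of the cut, so k may be placed in the second
   one at the price of a factor 2. *)
have -> : \sum_(j < n) \sum_(T : {set I} | T \subset k |: S)
       planar j.+1 T * planar (n - j) ((k |: S) :\: T) =
   2 * \sum_(j < n) \sum_(T : {set I} | T \subset S)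
       planar j.+1 T * planar (n - j) (k |: (S :\: T)).
  under eq_bigr => j _ do
    rewrite (sum_subset_setU1 (fun T T' => planar j.+1 T * planar (n - j) T')) //.
  rewrite big_split /= mulr_natl mulr2n; congr (_ + _).
  rewrite (reindex_inj rev_ord_inj) /=; apply: eq_bigr => j _.
  rewrite (sum_subset_compl S (fun T T' => planar (n - j.+1).+1 (k |: T) *
     planar (n - (n - j.+1)) T')).
  apply: eq_bigr => T _; rewrite mulrC; congr (planar _ _ * planar _ _);
  by move: (ltn_ord j); lia.
have -> : 2 * \sum_(j < n) \sum_(T : {set I} | T \subset S)
       planar j.+1 T * planar (n - j) (k |: (S :\: T)) =
  \sum_(j < n) wcbin (al k) * (cbin j * wcbin (n - j) / (n - j + al k)%:R) *
   (ypow (n.+1 + al k) S / j.+1%:R -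
    \sum_(l in S) wcbin (al l) * (1 + 2 * al l)%:R * ypow (n.+1 + al k + al l) (S :\ l)
        / (j.+1 + al l)%:R).
  rewrite mulr_sumr; apply: eq_bigr => j _.
  have [m Em] : exists m, (n - j = m.+1)%N.
    by exists (n - j).-1; move: (ltn_ord j); lia.
  rewrite Em.
  have E T : T \subset S -> planar j.+1 T * planar m.+1 (k |: (S :\: T)) =
     wcbin m.+1 * wcbin (al k) / (2 * (m.+1 + al k))%:R *
       (planar j.+1 T * ypow (m.+1 + al k) (S :\: T)).
    move=> TS; rewrite planarU1; first by ring.
    by rewrite !inE (negbTE kS) andbF.
  rewrite (eq_bigr _ E) -mulr_sumr planar_ypow.
  have -> : (j.+1 + (m.+1 + al k) = n.+1 + al k)%N by move: (ltn_ord j); lia.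
  have : (m.+1 + al k)%:R != 0 :> K by rewrite addSn.
  by rewrite natrM; move: (m.+1 + al k)%:R => u nu; field; rewrite nu addrC natr1 nz.
have -> : \sum_(j < n) wcbin (al k) * (cbin j * wcbin (n - j) / (n - j + al k)%:R) *
   (ypow (n.+1 + al k) S / j.+1%:R -
    \sum_(l in S) wcbin (al l) * (1 + 2 * al l)%:R * ypow (n.+1 + al k + al l) (S :\ l)
        / (j.+1 + al l)%:R) =
   wcbin (al k) * (ypow (n.+1 + al k) S *
     (\sum_(j < n) cbin j * wcbin (n - j) / ((j.+1 + 0)%:R * (n - j + al k)%:R)) -
     \sum_(l in S) wcbin (al l) * (1 + 2 * al l)%:R * ypow (n.+1 + al k + al l) (S :\ l) *
     (\sum_(j < n) cbin j * wcbin (n - j) / ((j.+1 + al l)%:R * (n - j + al k)%:R))).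
  rewrite mulrBr mulrA [X in _ = X - _]mulr_sumr mulr_sumr.
  under [X in _ = _ - X]eq_bigr => l _ do rewrite mulr_sumr mulr_sumr.
  rewrite exchange_big -sumrB /=; apply: eq_bigr => j _.
  rewrite mulrBr mulr_sumr addn0 !invfM; congr (_ - _); first by ring.
  by apply: eq_bigr => l _; rewrite invfM; ring.
rewrite (bigD1 k) ?setU11 //= setU1K //.
have -> : \sum_(i in k |: S | i != k) (al i)%:R * planar (n.+1 + al i) ((k |: S) :\ i) =
  \sum_(l in S) (al l)%:R * (wcbin (n.+1 + al l) * wcbin (al k) *
      ypow (n.+1 + al k + al l) (S :\ l) / (2 * (n.+1 + al k + al l))%:R).
  apply: eq_big => [l|l].
    by rewrite !inE; case: eqP => [->|_] /=; rewrite ?(negbTE kS) ?andbT.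
  rewrite !inE; case: (altP (l =P k)) => //= lk /andP[lS _].
  have -> : (k |: S) :\ l = k |: (S :\ l).
    apply/setP => x; rewrite !inE; case: (altP (x =P l)) => //= ->.
    by rewrite (negbTE lk).
  rewrite addSn planarU1 ?inE ?negb_and ?kS ?orbT // -!addSn.
  by rewrite (addnAC n.+1 (al l)).
rewrite planarU1 // addSn planarE.
have [k' Ek] : exists k', al k = k'.+1 by exists (al k).-1; rewrite prednK.
rewrite -[(n + al k).+1]addSn Ek sum_cbin_two_frac !addn0.
under [X in _ = _ + _ * (_ - X)]eq_bigr => l _ do rewrite sum_cbin_two_frac.
rewrite !mulrBr !mulr_sumr.
set N := (n.+1 + k'.+1)%N.
have nzN m : (N + m)%:R != 0 :> K by rewrite /N !addSn.
(* [s1] and [s2] are the parts without l of the join term i = k and of the cut sum. They already add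
   up to the left-hand side; the remaining sums over l then cancel for each l. *)
pose s1 := k'.+1%:R * (cbin (n + k'.+1) * (ypow N S / N%:R)).
pose s2 := wcbin k'.+1 * (ypow N S * ((wcbin n.+1 / wcbin 1 - cbin (n + k'.+1) / cbin k'.+1) / N%:R)).
have -> : wcbin n.+1 * wcbin k'.+1 * ypow N S / (2 * N)%:R = s1 + s2.
  rewrite /s1 /s2 wcbin1 natrM [wcbin k'.+1]wcbinE.
  have := nzN 0%N; rewrite addn0; have := cbin_neq0 K k'.+1.
  by move: (cbin k'.+1) N%:R k'.+1%:R => u v w nu nv; field; rewrite nu nv.
rewrite -/s1 -/s2.
suff E : \sum_(l in S) (al l)%:R * (wcbin (n.+1 + al l) * wcbin k'.+1 *
      ypow (N + al l) (S :\ l) / (2 * (N + al l))%:R) =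
   (\sum_(l in S) k'.+1%:R * (cbin (n + k'.+1) *
        (wcbin (al l) * (1 + 2 * al l)%:R * ypow (N + al l) (S :\ l) / (N + al l)%:R))) +
   (\sum_(l in S) wcbin k'.+1 *
        (wcbin (al l) * (1 + 2 * al l)%:R * ypow (N + al l) (S :\ l) *
         ((wcbin (n.+1 + al l) / wcbin (al l).+1 - cbin (n + k'.+1) / cbin k'.+1) /
          (N + al l)%:R))).
  by rewrite E; ring.
rewrite -big_split /=; apply: eq_bigr => l _.
have wS : wcbin (al l).+1 = 2 * (1 + 2 * al l)%:R * cbin (al l).
  by rewrite wcbinE cbinS -natrM; congr (_%:R * _); lia.
have := nzN (al l); have := cbin_neq0 K k'.+1; have := cbin_neq0 K (al l).
have : (1 + 2 * al l)%:R != 0 :> K by [].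
rewrite wS natrM [wcbin k'.+1]wcbinE [wcbin (al l)]wcbinE.
move: (cbin k'.+1) (N + al l)%:R k'.+1%:R (cbin (al l)) (1 + 2 * al l)%:R (al l)%:R.
by move=> u v w c d e nd nc nu nv; field; rewrite nd nc nu nv.
Qed.

End PlanarNumbers.

(** * Signed sums over words *)

Section WordSums.
Variables (P : finType) (V : nmodType).
Implicit Types (Q : pred P) (F G : seq P -> V).

Fixpoint wsum Q k F : V :=
  if k is k'.+1 then \sum_(r | Q r) wsum Q k' (fun s => F (r :: s)) else F [::].

Lemma eq_wsum Q k F G : (forall s, all Q s -> size s = k -> F s = G s) ->
  wsum Q k F = wsum Q k G.
Proof.
elim: k F G => [|k IHk] F G FG /=; first exact: FG.
apply: eq_bigr => r Qr; apply: IHk => s Qs sk; apply: FG => /=; first by rewrite Qr.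
by rewrite sk.
Qed.

Lemma wsum0 Q k : wsum Q k (fun=> 0) = 0.
Proof. by elim: k => //= k IHk; apply: big1. Qed.

Lemma wsum_sum Q k (J : finType) (R : pred J) (F : J -> seq P -> V) :
  wsum Q k (fun s => \sum_(j | R j) F j s) = \sum_(j | R j) wsum Q k (F j).
Proof.
elim: k F => //= k IHk F; rewrite exchange_big /=; apply: eq_bigr => r _.
by rewrite IHk.
Qed.

Lemma wsum_sub Q Q' k F : subpred Q' Q ->
  (forall s, all Q s -> ~~ all Q' s -> F s = 0) -> wsum Q k F = wsum Q' k F.
Proof.
move=> Q'Q; elim: k F => //= k IHk F F0.
rewrite (bigID Q') /= [X in _ + X]big1 ?addr0 => [|r /andP[Qr nQr]].
  apply: eq_big => [r|r /andP[Qr Q'r]]; first by case: (boolP (Q' r)) => [/Q'Q ->|]; rewrite ?andbF.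
  by apply: IHk => s Qs Q's; apply: F0; rewrite /= ?Qr ?Q'r.
rewrite -(wsum0 Q k); apply: eq_wsum => s Qs _.
by apply: F0; rewrite /= ?Qr // (negbTE nQr).
Qed.

(** A word is given by the positions of the letter e and by the word of its other letters, and F
    depends on the latter only. *)
Lemma wsum_binom (e : P) Q k F : Q e ->
  (forall s1 s2, F (s1 ++ e :: s2) = F (s1 ++ s2)) ->
  wsum Q k F = \sum_(j < k.+1) wsum [pred r | Q r & r != e] j F *+ 'C(k, j).
Proof.
move=> Qe; elim: k F => [|k IHk] F FE; first by rewrite big_ord1 bin0 mulr1n.
rewrite [LHS]/= (bigD1 e) //=.
rewrite (@eq_wsum Q k _ F); last by move=> s _ _; apply: (FE [::]).
rewrite IHk //.
have E r := IHk (fun s => F (r :: s)) (fun s1 s2 => FE (r :: s1) s2).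
under eq_bigr => r _ do rewrite E.
rewrite exchange_big /=.
rewrite [RHS]big_ord_recl /= bin0 mulr1n.
under [in RHS]eq_bigr => j _ do rewrite /bump /= add1n binS mulrnDr.
rewrite big_split /= addrA; congr (_ + _); last first.
  by apply: eq_bigr => j _; rewrite -sumrMnl.
rewrite [in RHS]big_ord_recr /= [in 'C(k, k.+1)]bin_small // mulr0n addr0.
by rewrite big_ord_recl /= bin0 mulr1n.
Qed.

End WordSums.

Lemma wsum_reindex (P P' : finType) (V : nmodType) (Q : pred P) (Q' : pred P')
    (h : P' -> P) (h' : P -> P') k (F : seq P -> V) :
  (forall r, Q' r -> Q (h r)) -> (forall r, Q r -> Q' (h' r)) ->
  (forall r, Q r -> h (h' r) = r) -> (forall r, Q' r -> h' (h r) = r) ->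
  wsum Q k F = wsum Q' k (fun s => F (map h s)).
Proof.
move=> hQ h'Q hK h'K; elim: k F => //= k IHk F.
rewrite (reindex_onto h h') //=; apply: eq_big => [r|r /andP[Qr _]]; last by rewrite IHk.
by apply/andP/idP => [[Qr /eqP <-]|Qr]; rewrite ?h'Q // hQ // h'K.
Qed.

Lemma wsum_pair (P P' : finType) (V : comNzRingType) (Q : pred P) (Q' : pred P') k
    (F : seq P -> V) (G : seq P' -> V) :
  wsum [pred r : P * P' | Q r.1 & Q' r.2] k (fun s => F (map fst s) * G (map snd s)) =
  wsum Q k F * wsum Q' k G.
Proof.
elim: k F G => //= k IHk F G.
rewrite -(pair_big Q Q' (fun r r' => wsum [pred r : P * P' | Q r.1 & Q' r.2] k
   (fun s => F (r :: map fst s) * G (r' :: map snd s)))) /= big_distrlr /=.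
by apply: eq_bigr => r _; apply: eq_bigr => r' _;
  rewrite (IHk (fun s => F (r :: s)) (fun s => G (r' :: s))).
Qed.

Lemma poly_eq_nat (K : numFieldType) (p q : {poly K}) :
  (forall k : nat, p.[k%:R] = q.[k%:R]) -> p = q.
Proof.
move=> pq; apply/eqP; rewrite -subr_eq0; apply/negPn/negP => nz.
pose rs := [seq (k%:R : K) | k <- iota 0 (size (p - q))].
have /(_ rs) := max_poly_roots nz; rewrite size_map size_iota ltnn => H.
suff : false by []; apply: H.
  by apply/allP => _ /mapP[k _ ->]; rewrite /root hornerD hornerN pq subrr.
by rewrite map_inj_uniq ?iota_uniq // => a b /eqP; rewrite eqr_nat => /eqP.
Qed.

(* [interp u v]: v is the value at k = -1 of a family u that is polynomial in k. *)
Section Interpolation.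
Variable K : numFieldType.
Implicit Types (u : nat -> fps K) (v : fps K).

Definition interp u v := forall l, exists q : {poly K},
  (forall k, fcoef (u k) l = q.[k%:R]) /\ fcoef v l = q.[-1].

Lemma interp_uniq u v v' : interp u v -> interp u v' -> v = v'.
Proof.
move=> uv uv'; apply: fps_ext => l.
have [q [qE ->]] := uv l; have [q' [q'E ->]] := uv' l.
by rewrite (poly_eq_nat (p := q) (q := q')) // => k; rewrite -qE -q'E.
Qed.

(** The reason for interpolating: a product of counts at each fixed length k becomes a product of
    signed counts, since evaluation at -1 is multiplicative. *)
Lemma interpM u v u' v' : interp u v -> interp u' v' ->
  interp (fun k => u k * u' k) (v * v').
Proof.
move=> uv uv' l.
have [q qP] := boolp.choice uv; have [q' q'P] := boolp.choice uv'.
exists (\sum_(i < l.+1) q i * q' (l - i)%N); split=> [k|].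
  rewrite fcoefM horner_sum; apply: eq_bigr => i _; rewrite hornerM.
  by rewrite (qP i).1 (q'P (l - i)%N).1.
rewrite fcoefM horner_sum; apply: eq_bigr => i _; rewrite hornerM.
by rewrite (qP i).2 (q'P (l - i)%N).2.
Qed.

Lemma interp0 : interp (fun=> 0) 0.
Proof. by move=> l; exists 0; split=> [k|]; rewrite horner0 fcoef0. Qed.

Lemma interpD u v u' v' : interp u v -> interp u' v' ->
  interp (fun k => u k + u' k) (v + v').
Proof.
move=> uv uv' l; have [q [qE qv]] := uv l; have [q' [q'E q'v]] := uv' l.
exists (q + q'); split=> [k|]; rewrite fcoefD hornerD.
  by rewrite qE q'E.
by rewrite qv q'v.
Qed.

Lemma interp_sum (J : finType) (R : pred J) (u : J -> nat -> fps K) (v : J -> fps K) :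
  (forall j, R j -> interp (u j) (v j)) ->
  interp (fun k => \sum_(j | R j) u j k) (\sum_(j | R j) v j).
Proof.
move=> uv.
rewrite -big_filter; have -> : (fun k => \sum_(j | R j) u j k) =
  (fun k => \sum_(j <- [seq j <- index_enum J | R j]) u j k).
  by apply: boolp.funext => k; rewrite big_filter.
have : all R [seq j <- index_enum J | R j] by apply: filter_all.
elim: [seq _ <- _ | _] => [|j r IHr] /=.
  move=> _; rewrite big_nil; have -> : (fun k => \sum_(j <- [::]) u j k) = fun=> 0.
    by apply: boolp.funext => k; rewrite big_nil.
  exact: interp0.
case/andP=> Rj /IHr Ir; rewrite big_cons.
have -> : (fun k => \sum_(j <- j :: r) u j k) = (fun k => u j k + \sum_(j <- r) u j k).
  by apply: boolp.funext => k; rewrite big_cons.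
exact/interpD/Ir/uv.
Qed.

Fixpoint binom_poly j : {poly K} :=
  if j is j'.+1 then binom_poly j' * ('X - j'%:R%:P) * (j%:R^-1)%:P else 1.

Lemma binom_polyE j k : (binom_poly j).[k%:R] = 'C(k, j)%:R.
Proof.
elim: j => [|j IHj]; first by rewrite /= hornerC bin0.
rewrite /= !hornerE IHj.
have nz : j.+1%:R != 0 :> K by rewrite pnatr_eq0.
apply: (mulIf nz); rewrite mulfVK // -natrM mulnC mul_bin_left natrM mulrC.
have [kj|jk] := ltnP k j; first by rewrite bin_small ?mulr0.
by rewrite natrB.
Qed.

Lemma binom_polyN1 j : (binom_poly j).[-1] = (-1) ^+ j.
Proof.
elim: j => [|j IHj]; first by rewrite /= hornerC.
rewrite /= !hornerE IHj exprS.
have nz : j.+1%:R != 0 :> K by rewrite pnatr_eq0.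
have -> : -1 - j%:R = - j.+1%:R :> K by rewrite -natr1 opprD addrC.
by rewrite mulN1r mulrN mulNr mulfK.
Qed.

Section SignedSum.
Variable P : finType.
Implicit Types (Q : pred P) (F : seq P -> fps K).

(** Under [word_order] a word longer than l does not reach degree l, so the alternating sum over all
    lengths stops at l. *)
Definition signed_sum Q F : fps K :=
  Fps (fun l => \sum_(j < l.+1) (-1) ^+ j * fcoef (wsum Q j F) l).

Definition word_order Q F :=
  forall s l, all Q s -> (l < size s)%N -> fcoef (F s) l = 0.

Lemma fcoef_wsum Q k F l :
  fcoef (wsum Q k F) l = wsum Q k (fun s => fcoef (F s) l).
Proof.
by elim: k F => //= k IHk F; rewrite fcoef_sum; apply: eq_bigr => r _; rewrite IHk.
Qed.

Lemma word_order_wsum Q F k l : word_order Q F -> (l < k)%N ->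
  fcoef (wsum Q k F) l = 0.
Proof.
move=> oF lk; rewrite fcoef_wsum -(wsum0 _ Q k); apply: eq_wsum => s Qs sk.
by rewrite oF // sk.
Qed.

(** The interpolating polynomial is read off from [wsum_binom]; its value at -1 is given by
    [binom_polyN1]. *)
Lemma interp_wsum (e : P) Q F : Q e ->
  (forall s1 s2, F (s1 ++ e :: s2) = F (s1 ++ s2)) ->
  word_order [pred r | Q r & r != e] F ->
  interp (fun k => wsum Q k F) (signed_sum [pred r | Q r & r != e] F).
Proof.
move=> Qe FE oF l; set Q' := [pred r | _ & _].
exists (\sum_(j < l.+1) (fcoef (wsum Q' j F) l) *: binom_poly j).
split=> [k|]; last first.
  rewrite horner_sum /=; apply: eq_bigr => j _.
  by rewrite hornerZ binom_polyN1 mulrC.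
rewrite horner_sum (wsum_binom k Qe FE) fcoef_sum -/Q'.
have -> : \sum_(i < l.+1) (fcoef (wsum Q' i F) l *: binom_poly i).[k%:R] =
   \sum_(i < l.+1) fcoef (wsum Q' i F) l *+ 'C(k, i).
  by apply: eq_bigr => i _; rewrite hornerZ binom_polyE mulr_natr.
under eq_bigr => i _ do rewrite fcoefMn.
have E m (H : nat -> K) : (forall i, (m <= i)%N -> H i = 0) ->
    forall n, (m <= n)%N -> \sum_(i < n) H i = \sum_(i < m) H i.
  move=> H0 n mn; rewrite -(subnKC mn) big_split_ord /= [X in _ + X]big1 ?addr0 // => i _.
  by rewrite H0 // leq_addr.
(* The ranges j <= k and j <= l may be exchanged: beyond k the binomial vanishes, beyond l the
   coefficient does. *)
have H0 i : (minn k.+1 l.+1 <= i)%N -> fcoef (wsum Q' i F) l *+ 'C(k, i) = 0.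
  rewrite geq_min => /orP[ki|li]; first by rewrite bin_small // mulr0n.
  by rewrite word_order_wsum // mul0rn.
by rewrite (E _ _ H0) ?geq_minl // [RHS](E _ _ H0) ?geq_minr.
Qed.

End SignedSum.
End Interpolation.

Lemma fcoefE (K : Type) (F : nat -> K) l : fcoef (Fps F) l = F l.
Proof. by []. Qed.
Arguments fcoef : simpl never.
#[global] Opaque fps_zero fps_one fps_add fps_opp fps_mul.

(** * Permutations stabilising a set *)

Section StablePermutations.
Variable T : finType.
Implicit Types (A B S : {set T}) (r s t u : {perm T}) (x y z : T).

Definition stable A r : bool := r \in 'N(A | 'P)%g.

Lemma stableP A r : reflect (forall x, (r x \in A) = (x \in A)) (stable A r).
Proof.
apply: (iffP idP) => [rA x | rA]; first exact: (astabs_act x rA).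
by apply/astabsP => x; apply: rA.
Qed.

Lemma stable_sub A r : (forall x, x \in A -> r x \in A) -> stable A r.
Proof.
move=> rA; rewrite /stable !inE /=; apply/subsetP => x xA; rewrite inE; exact: rA.
Qed.

Lemma stable1 A : stable A 1%g. Proof. by apply/stableP => x; rewrite perm1. Qed.
Lemma stable0 r : stable set0 r. Proof. by apply/stableP => x; rewrite !inE. Qed.
Lemma stableT r : stable [set: T] r. Proof. by apply/stableP => x; rewrite !inE. Qed.
Lemma stableM A r s : stable A r -> stable A s -> stable A (r * s)%g.
Proof. exact: groupM. Qed.
Lemma stableV A r : stable A r -> stable A r^-1%g. Proof. by rewrite /stable groupV. Qed.
Lemma stableMr A r s : stable A s -> stable A (r * s)%g = stable A r.
Proof. exact: groupMr. Qed.
Lemma stableI A B r : stable A r -> stable B r -> stable (A :&: B) r.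
Proof. by move=> /stableP hA /stableP hB; apply/stableP => x; rewrite !inE hA hB. Qed.
Lemma stableD A B r : stable A r -> stable B r -> stable (A :\: B) r.
Proof. by move=> /stableP hA /stableP hB; apply/stableP => x; rewrite !inE hA hB. Qed.
Lemma stableU A B r : stable A r -> stable B r -> stable (A :|: B) r.
Proof. by move=> /stableP hA /stableP hB; apply/stableP => x; rewrite !inE hA hB. Qed.
Lemma stableC A r : stable A r -> stable (~: A) r.
Proof. by move=> /stableP hA; apply/stableP => x; rewrite !inE hA. Qed.

Lemma perm_on_stable A B r : perm_on A r -> A \subset B -> stable B r.
Proof.
move=> rA AB; apply/stableP => x; have [xA|xA] := boolP (x \in A).
  by rewrite !(subsetP AB) // perm_closed.
by rewrite (out_perm rA).
Qed.

Lemma perm_on_stable_disj A B r : perm_on A r -> [disjoint A & B] -> stable B r.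
Proof.
move=> rA AB; apply/stable_sub => x xB; rewrite (out_perm rA) //.
by rewrite (disjointFl AB).
Qed.

Lemma stable_tperm A x y : x \in A -> y \in A -> stable A (tperm x y).
Proof. by move=> xA yA; apply/stable_sub => w wA; case: tpermP. Qed.

Lemma stable_tperm_out A x y : x \notin A -> y \notin A -> stable A (tperm x y).
Proof.
move=> xA yA; apply/stable_sub => w wA; rewrite tpermD //.
  by apply: contraNneq xA => ->.
by apply: contraNneq yA => ->.
Qed.

Lemma restrE A r x : stable A r -> restr_perm A r x = if x \in A then r x else x.
Proof.
move=> rA; case: ifP => xA; first exact: restr_permE.
by rewrite (out_perm (restr_perm_on A r)) ?xA.
Qed.

Lemma restr_id A r : perm_on A r -> restr_perm A r = r.
Proof.
move=> rA; apply/permP => x; rewrite restrE; last exact: perm_on_stable rA _.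
by case: ifP => // xA; rewrite (out_perm rA) ?xA.
Qed.

Lemma restrM A r s : stable A r -> stable A s ->
  restr_perm A (r * s)%g = (restr_perm A r * restr_perm A s)%g.
Proof. by move=> rA sA; rewrite morphM. Qed.

Lemma restr_restr A B r : A \subset B -> stable A r -> stable B r ->
  restr_perm A (restr_perm B r) = restr_perm A r.
Proof.
move=> AB rA rB; apply/permP => x.
have rBA : stable A (restr_perm B r).
  apply/stable_sub => y yA; rewrite restrE // (subsetP AB) //.
  by have /stableP -> := rA.
by rewrite !restrE //; case: ifP => // /(subsetP AB) ->.
Qed.

Lemma restr_stable A B r : A \subset B -> stable B r ->
  stable A (restr_perm B r) = stable A r.
Proof.
move=> AB rB; apply/idP/idP => /stableP h; apply/stable_sub => x xA.
  by move: (h x); rewrite restrE // (subsetP AB) // xA.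
by rewrite restrE // (subsetP AB) // h.
Qed.

(** The norm is taken in the whole type T. Fixed points do not change it, so it agrees with the norm
    in every B that contains the support of r; see [pnorm_block]. *)
Definition pnorm r : nat := (#|T| - #|porbits r|)%N.

Lemma card_porbits_le r : (#|porbits r| <= #|T|)%N.
Proof. exact: leq_imset_card. Qed.

Lemma pnorm1 : pnorm 1%g = 0%N.
Proof.
rewrite /pnorm /porbits card_imset ?subnn // => x y /setP/(_ x).
rewrite porbit_id => /esym/porbitP[i ->].
by rewrite expg1n perm1.
Qed.

Lemma pnorm_gt0 r : r != 1%g -> (0 < pnorm r)%N.
Proof.
apply: contraR; rewrite -eqn0Ngt subn_eq0 => h; apply/eqP/permP => x; rewrite perm1.
have /imset_injP inj : #|[set porbit r x | x in T]| == #|T|.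
  by rewrite eqn_leq card_porbits_le h.
apply: inj => //; apply/eqP; rewrite eq_porbit_mem -{1}[r x]/(_ x).
by apply/porbitP; exists 1%N; rewrite expg1.
Qed.

Definition cycles_in r S := porbit r @: S.

Lemma porbitsE r : porbits r = cycles_in r [set: T].
Proof. by apply/setP => C; apply/imsetP/imsetP => -[x _ ->]; exists x; rewrite ?inE. Qed.

Lemma porbit_sub r S x : stable S r -> x \in S -> porbit r x \subset S.
Proof.
move=> /stableP rS xS; apply/subsetP => _ /porbitP[i ->].
elim: i => [|i IHi]; first by rewrite expg0 perm1.
by rewrite expgSr permM rS.
Qed.

Lemma card_cycles_split r S A : stable S r -> S \subset A ->
  #|cycles_in r A| = (#|cycles_in r S| + #|cycles_in r (A :\: S)|)%N.
Proof.
move=> rS SA; have e : S :|: A :\: S = A by rewrite -{1}(setIidPr SA) setID.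
rewrite -cardsUI -imsetU e -[LHS]addn0; congr (_ + _)%N.
apply/esym/eqP; rewrite cards_eq0; apply/eqP/setP => C; rewrite !inE; apply/negbTE/negP => /andP[/imsetP[x xS ->]].
case/imsetP => y; rewrite inE => /andP[yS _] exy; case/negP: yS.
by apply: (subsetP (porbit_sub rS xS)); rewrite exy porbit_id.
Qed.

Lemma porbit_restr r S x : stable S r -> x \in S ->
  porbit (restr_perm S r) x = porbit r x.
Proof.
move=> rS xS; have /stableP h := rS.
have E i : (restr_perm S r ^+ i)%g x = (r ^+ i)%g x /\ (r ^+ i)%g x \in S.
  elim: i => [|i [IHi iS]]; first by rewrite !expg0 perm1.
  by rewrite !expgSr !permM IHi restrE // iS h.
apply/setP => y; apply/porbitP/porbitP => [[i ->]|[i ->]]; exists i; first by have [] := E i.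
by have [] := E i.
Qed.

Lemma porbit_out r S x : perm_on S r -> x \notin S -> porbit r x = [set x].
Proof.
move=> rS xS; apply/setP => y; rewrite inE; apply/porbitP/eqP => [[i ->]|->]; last first.
  by exists 0%N; rewrite expg0 perm1.
elim: i => [|i IHi]; first by rewrite expg0 perm1.
by rewrite expgSr permM IHi (out_perm rS).
Qed.

Lemma card_porbits_restr r S : stable S r ->
  #|porbits (restr_perm S r)| = (#|cycles_in r S| + #|~: S|)%N.
Proof.
move=> rS; have pS := restr_perm_on S r.
rewrite porbitsE (@card_cycles_split _ S) ?subsetT //; last exact: perm_on_stable pS _.
congr (_ + _)%N.
  by congr #|pred_of_set _|; apply: eq_in_imset => x xS; rewrite porbit_restr.
rewrite setTD -[RHS](card_imset _ set1_inj); congr #|pred_of_set _|.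
by apply: eq_in_imset => x; rewrite inE => xS; apply: porbit_out pS _.
Qed.

Lemma card_cycles_le r S : (#|cycles_in r S| <= #|S|)%N.
Proof. exact: leq_imset_card. Qed.

Lemma pnorm_split r S : stable S r ->
  pnorm r = (pnorm (restr_perm S r) + pnorm (restr_perm (~: S) r))%N.
Proof.
move=> rS; rewrite /pnorm !card_porbits_restr ?stableC // setCK porbitsE.
rewrite (@card_cycles_split _ S) ?subsetT // setTD -(cardsC S).
have := card_cycles_le r S; have := card_cycles_le r (~: S).
by lia.
Qed.

(** * Products of a permutation of S and a permutation of its complement in B *)

Section Split.
Variables (B S : {set T}).
Hypothesis SB : S \subset B.

Lemma split_mulE r s x : perm_on S r -> perm_on (B :\: S) s ->
  (r * s)%g x = if x \in S then r x else s x.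
Proof.
move=> rS sS; rewrite permM; case: ifP => xS.
  by rewrite (out_perm sS) // inE perm_closed // xS.
by rewrite (out_perm rS) ?xS.
Qed.

Lemma split_perm_on r s : perm_on S r -> perm_on (B :\: S) s -> perm_on B (r * s)%g.
Proof.
move=> rS sS; apply/subsetP => x; rewrite inE split_mulE //; case: ifP => xS.
  by rewrite (subsetP SB).
apply: contraR => xB; rewrite (out_perm sS) // inE (negbTE xB) andbF //.
Qed.

Lemma split_stable r s A : A \subset S -> perm_on S r -> perm_on (B :\: S) s ->
  stable A (r * s)%g = stable A r.
Proof.
move=> AS rS sS; rewrite stableMr //; apply: perm_on_stable_disj sS _.
rewrite disjoint_sym; apply: disjointWl AS _.
by rewrite -setI_eq0 setIDA setD_eq0 subsetIl.
Qed.

Lemma split_restrl r s : perm_on S r -> perm_on (B :\: S) s ->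
  restr_perm S (r * s)%g = r.
Proof.
move=> rS sS; apply/permP => x; rewrite restrE; last first.
  by rewrite split_stable //; apply: perm_on_stable rS _.
rewrite split_mulE //; case: (boolP (x \in S)) => // xS.
by rewrite (out_perm rS xS).
Qed.

Lemma split_restrr r s : perm_on S r -> perm_on (B :\: S) s ->
  restr_perm (B :\: S) (r * s)%g = s.
Proof.
move=> rS sS; apply/permP => x; rewrite restrE.
  rewrite split_mulE // inE; case: ifP => [/andP[/negbTE -> _] //|h].
  by rewrite (out_perm sS) // inE h.
apply: stableD; first exact: perm_on_stable (split_perm_on rS sS) _.
by rewrite split_stable //; apply: perm_on_stable rS _.
Qed.

Lemma split_restrC r s : perm_on S r -> perm_on (B :\: S) s ->
  restr_perm (~: S) (r * s)%g = s.
Proof.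
move=> rS sS; apply/permP => x; rewrite restrE.
  rewrite split_mulE // inE; case: ifP => [/negbTE -> //|/negbFE h].
  by rewrite (out_perm sS) // inE h.
by apply: stableC; rewrite split_stable //; apply: perm_on_stable rS _.
Qed.

Lemma split_pnorm r s : perm_on S r -> perm_on (B :\: S) s ->
  pnorm (r * s)%g = (pnorm r + pnorm s)%N.
Proof.
move=> rS sS; rewrite (@pnorm_split _ S); last first.
  by rewrite split_stable //; apply: perm_on_stable rS _.
by rewrite split_restrl // split_restrC.
Qed.

Lemma split_restrK u : perm_on B u -> stable S u ->
  (restr_perm S u * restr_perm (B :\: S) u)%g = u.
Proof.
move=> uB uS; apply/permP => x; rewrite split_mulE ?restr_perm_on // !restrE //; last first.
  by apply: stableD => //; apply: perm_on_stable uB _.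
rewrite inE; case: (boolP (x \in S)) => //= xS; case: (boolP (x \in B)) => // xB.
by rewrite (out_perm uB xB).
Qed.

Lemma split_comm r s : perm_on S r -> perm_on (B :\: S) s -> (r * s = s * r)%g.
Proof.
move=> rS sS; apply/permP => x; rewrite split_mulE // permM; case: ifP => xS.
  by rewrite (out_perm sS) // inE xS.
rewrite (out_perm rS) //; have [xB|xB] := boolP (x \in B :\: S).
  by have := perm_closed x sS; rewrite xB inE => /andP[].
by rewrite (out_perm sS) ?xS.
Qed.

End Split.

(** The first letter is the rightmost factor, which matches the reversed product in
    [gamma_count]. *)
Definition wprod (w : seq {perm T}) := foldr (fun r acc => acc * r)%g 1%g w.
Definition wnorm (w : seq {perm T}) := (\sum_(r <- w) pnorm r)%N.

Lemma wprod_perm_on B w : all (perm_on B) w -> perm_on B (wprod w).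
Proof.
elim: w => [|r w IHw] /=; first by rewrite perm_on1.
by case/andP => rB /IHw wB; apply: perm_onM.
Qed.

Lemma wprod_split (B S : {set T}) (w : seq ({perm T} * {perm T})) : S \subset B ->
  all (fun r : {perm T} * {perm T} => perm_on S r.1 && perm_on (B :\: S) r.2) w ->
  wprod (map (fun r : {perm T} * {perm T} => r.1 * r.2)%g w) = (wprod (map fst w) * wprod (map snd w))%g.
Proof.
move=> SB; elim: w => [|[r s] w IHw] /=; first by rewrite mulg1.
case/andP => /andP[rS sS] wS; rewrite IHw // -!mulgA; congr (_ * _)%g.
have w2S : perm_on (B :\: S) (wprod (map snd w)).
  apply: wprod_perm_on; rewrite all_map; apply: sub_all wS => p /andP[]//.
by rewrite !mulgA (split_comm rS w2S) -!mulgA.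
Qed.

Lemma wnorm_split (B S : {set T}) (w : seq ({perm T} * {perm T})) : S \subset B ->
  all (fun r : {perm T} * {perm T} => perm_on S r.1 && perm_on (B :\: S) r.2) w ->
  wnorm (map (fun r : {perm T} * {perm T} => r.1 * r.2)%g w) = (wnorm (map fst w) + wnorm (map snd w))%N.
Proof.
move=> SB; rewrite /wnorm !big_map -big_split /=.
elim: w => [|[r s] w IHw] /=; first by rewrite !big_nil.
case/andP => /andP[rS sS] wS; by rewrite !big_cons IHw //= (split_pnorm rS sS).
Qed.

(** Transitivity on B of the group generated by the letters, phrased with invariant sets so that it
    can be checked letter by letter; see [irred_fword]. *)
Definition irred B (w : seq {perm T}) : bool :=
  [&& B != set0, all (stable B) w &
    [forall A : {set T}, [&& A \subset B, A != set0 & all (stable A) w] ==> (A == B)]].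

Lemma irredP B w : reflect [/\ B != set0, all (stable B) w &
    forall A, A \subset B -> A != set0 -> all (stable A) w -> A = B] (irred B w).
Proof.
apply: (iffP and3P) => -[B0 Bw h]; split=> //.
  by move=> A AB A0 Aw; apply/eqP; move/forallP: h => /(_ A); rewrite AB A0 Aw.
by apply/forallP => A; apply/implyP => /and3P[AB A0 Aw]; rewrite (h A).
Qed.

(** S is the orbit of z, obtained as a smallest invariant set containing z. A nonempty invariant
    subset of S that misses z is excluded, since its complement in S would be a smaller invariant
    set containing z. *)
Lemma irred_exists_unique B w z : z \in B -> all (stable B) w ->
  exists S, [/\ z \in S, S \subset B, irred S w &
    forall S', z \in S' -> irred S' w -> S' = S].
Proof.
move=> zB Bw; pose p (S : {set T}) := (z \in S) && all (stable S) w.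
have pT : p [set: T] by rewrite /p inE; apply/allP => r _; apply: stableT.
case: (arg_minnP (fun S : {set T} => #|S|) pT) => S /andP[zS Sw] Smin.
have aI (A A' : {set T}) : all (stable A) w -> all (stable A') w -> all (stable (A :&: A')) w.
  by move=> /allP hA /allP hA'; apply/allP => r rw; apply: stableI; [apply: hA|apply: hA'].
have minE A : A \subset S -> p A -> A = S.
  by move=> AS pA; apply/eqP; rewrite eqEcard AS Smin.
have Sirr : irred S w.
  apply/irredP; split=> //; first by apply/set0Pn; exists z.
  move=> A AS A0 Aw; have [zA|zA] := boolP (z \in A).
    by apply: minE; rewrite /p ?zA.
  have : S :\: A = S.
    apply: minE; rewrite ?subsetDl // /p inE zA zS /=.
    apply/allP => r rw; apply: stableD; first exact: (allP Sw).
    exact: (allP Aw).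
  move/setDidPl; rewrite disjoint_sym; move/disjoint_setI0; rewrite (setIidPl AS) => A00.
  by rewrite A00 eqxx in A0.
exists S; split=> //.
  apply/setIidPl; apply: minE; rewrite ?subsetIl // /p inE zS zB /=.
  exact: aI.
move=> S' zS' /irredP[_ S'w irr']; apply/esym/irr' => //; last by apply/set0Pn; exists z.
have : S :&: S' = S by apply: minE; rewrite ?subsetIl // /p inE zS zS' /=; apply: aI.
by move/setIidPl.
Qed.

Lemma irred_split (B S : {set T}) (w : seq ({perm T} * {perm T})) : S \subset B ->
  all (fun r : {perm T} * {perm T} => perm_on S r.1 && perm_on (B :\: S) r.2) w ->
  irred S (map (fun r : {perm T} * {perm T} => r.1 * r.2)%g w) = irred S (map fst w).
Proof.
move=> SB wS.
have E A : A \subset S -> all (stable A) (map (fun r : {perm T} * {perm T} => r.1 * r.2)%g w) =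
    all (stable A) (map fst w).
  move=> AS; rewrite !all_map; apply: eq_in_all => -[r s] /(allP wS) /andP[/= rS sS].
  exact: split_stable AS rS sS.
rewrite /irred E //; congr [&& _, _ & _]; apply: eq_forallb => A.
by case: (boolP (A \subset S)) => //= AS; rewrite E.
Qed.

Lemma irred_cat1 B w1 w2 : irred B (w1 ++ 1%g :: w2) = irred B (w1 ++ w2).
Proof.
have E A : all (stable A) (w1 ++ 1%g :: w2) = all (stable A) (w1 ++ w2).
  by rewrite !all_cat /= stable1.
rewrite /irred E; congr [&& _, _ & _]; apply: eq_forallb => A.
by rewrite E.
Qed.

Lemma wprod_cat1 w1 w2 : wprod (w1 ++ 1%g :: w2) = wprod (w1 ++ w2).
Proof. by elim: w1 => [|r w1 /= ->] //=; rewrite mulg1. Qed.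

Lemma wnorm_cat1 w1 w2 : wnorm (w1 ++ 1%g :: w2) = wnorm (w1 ++ w2).
Proof. by rewrite /wnorm !big_cat big_cons pnorm1. Qed.

Lemma wnorm_size B w : all [pred r | perm_on B r & r != 1%g] w -> (size w <= wnorm w)%N.
Proof.
rewrite /wnorm; elim: w => [|r w IHw] //= /andP[/andP[_ r1] /IHw h].
by rewrite big_cons -add1n leq_add // pnorm_gt0.
Qed.

End StablePermutations.

Lemma fcoef_signed_sum (K : numFieldType) (P : finType) (Q : pred P)
    (F : seq P -> fps K) l M : word_order Q F -> (l < M)%N ->
  fcoef (signed_sum Q F) l = \sum_(j < M) (-1) ^+ j * fcoef (wsum Q j F) l.
Proof.
move=> oF lM; rewrite -(subnKC lM) big_split_ord [X in _ = _ + X]big1 ?addr0 // => i _.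
by rewrite (word_order_wsum oF) ?mulr0 // leq_addr.
Qed.

(** Words are sorted by their first letter r, which contributes x^(d r) and one sign. Because d r is
    positive, the lengths below l suffice for the remaining degree l - d r. *)
Lemma signed_sum_rec (K : numFieldType) (P : finType) (Q : pred P)
    (F : seq P -> fps K) (d : P -> nat) (Fr : P -> seq P -> fps K) :
  (forall r, Q r -> (0 < d r)%N) -> (forall r s, F (r :: s) = fpsX ^+ d r * Fr r s) ->
  (forall r, word_order Q (Fr r)) ->
  signed_sum Q F = F [::] - \sum_(r | Q r) fpsX ^+ d r * signed_sum Q (Fr r).
Proof.
move=> d0 FE oFr; apply: fps_ext => l; rewrite fcoefB fcoef_sum.
rewrite /signed_sum fcoefE big_ord_recl expr0 mul1r /=; congr (_ + _).
rewrite -sumrN.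
have -> : \sum_(i < l) (-1) ^+ bump 0 i *
     fcoef (\sum_(r | Q r) wsum Q i (fun s => F (r :: s))) l =
   \sum_(r | Q r) \sum_(i < l) - ((-1) ^+ i * fcoef (wsum Q i (fun s => F (r :: s))) l).
  rewrite exchange_big /=; apply: eq_bigr => i _; rewrite fcoef_sum mulr_sumr.
  by apply: eq_bigr => r _; rewrite /bump /= add1n exprS mulN1r mulNr.
apply: eq_bigr => r Qr; rewrite sumrN; congr (- _); rewrite fcoefXnM.
have E i : fcoef (wsum Q i (fun s => F (r :: s))) l =
    if (d r <= l)%N then fcoef (wsum Q i (Fr r)) (l - d r)%N else 0.
  rewrite !fcoef_wsum (@eq_wsum _ _ Q i _ (fun s => if (d r <= l)%N then
     fcoef (Fr r s) (l - d r)%N else 0)).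
    by case: ifP => // _; rewrite ?fcoef_wsum ?wsum0.
  by move=> s _ _; rewrite FE fcoefXnM.
under eq_bigr => i _ do rewrite E.
case: ifP => dl; last by rewrite big1 // => i _; rewrite mulr0.
by rewrite (@fcoef_signed_sum _ _ _ _ _ l) //; move: (d0 r Qr) dl; lia.
Qed.

(** * Factorisation series: orbit decomposition and cut-and-join recursion *)

Section Connected.
Variables (K : numFieldType) (T : finType).
Implicit Types (A B S : {set T}) (r s t u : {perm T}) (x y z i : T).
Local Notation X := (@fpsX K).

Definition fact_word u w : fps K := (wprod w == u)%:R * X ^+ wnorm w.
Definition trans_word B u w : fps K := (irred B w)%:R * fact_word u w.

Definition nontriv B : pred {perm T} := [pred r | perm_on B r & r != 1%g].

(* The series of signed factorisations of u in Sym(B), all of them or only those that are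
   transitive on B, are extended by 0 to permutations u that do not stabilise B. *)
Definition all_fact0 B u : fps K := signed_sum (nontriv B) (fact_word u).
Definition conn_fact0 B u : fps K := signed_sum (nontriv B) (trans_word B u).
Definition all_fact B u : fps K :=
  if stable B u then all_fact0 B (restr_perm B u) else 0.
Definition conn_fact B u : fps K :=
  if stable B u then conn_fact0 B (restr_perm B u) else 0.

Lemma order_fact_word B u : word_order (nontriv B) (fact_word u).
Proof.
move=> w l wB lw; rewrite fcoef_natM fcoefXn; case: (l =P wnorm w) => [e|_]; last by rewrite mulr0.
by have := wnorm_size wB; rewrite -e leqNgt lw.
Qed.

Lemma order_trans_word B S u : word_order (nontriv B) (trans_word S u).
Proof.
by move=> w l wB lw; rewrite fcoef_natM (order_fact_word _ wB lw) mulr0.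
Qed.

Lemma interp_fact B u : interp (fun k => wsum (perm_on B) k (fact_word u)) (all_fact0 B u).
Proof.
apply: interp_wsum; first exact: perm_on1.
  by move=> w1 w2; rewrite /fact_word wprod_cat1 wnorm_cat1.
exact: order_fact_word.
Qed.

Lemma interp_trans B u :
  interp (fun k => wsum (perm_on B) k (trans_word B u)) (conn_fact0 B u).
Proof.
apply: interp_wsum; first exact: perm_on1.
  by move=> w1 w2; rewrite /trans_word /fact_word wprod_cat1 wnorm_cat1 irred_cat1.
exact: order_trans_word.
Qed.

(** By [interp_uniq] it suffices to compare, for each k, words of length k with the identity
    allowed. Such a word has exactly one orbit S of z, and each of its letters is a pair of
    independent permutations of S and of B minus S. *)
Lemma all_fact0_split B z u : z \in B -> perm_on B u ->
  all_fact0 B u = \sum_(S : {set T} | [&& z \in S, S \subset B & stable S u])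
     conn_fact0 S (restr_perm S u) * all_fact0 (B :\: S) (restr_perm (B :\: S) u).
Proof.
move=> zB uB; apply: interp_uniq (interp_fact B u) _.
set I2 := fun k : nat => _; have -> : I2 = fun k =>
  \sum_(S : {set T} | [&& z \in S, S \subset B & stable S u])
     wsum (perm_on S) k (trans_word S (restr_perm S u)) *
     wsum (perm_on (B :\: S)) k (fact_word (restr_perm (B :\: S) u)); last first.
  by apply: interp_sum => S _; apply: interpM; [apply: interp_trans|apply: interp_fact].
rewrite {}/I2; apply: boolp.funext => k.
have -> : wsum (perm_on B) k (fact_word u) = wsum (perm_on B) k (fun w =>
   \sum_(S : {set T} | (z \in S) && (S \subset B)) trans_word S u w).
  apply: eq_wsum => w wB _.
  have wB' : all (stable B) w.
    by apply: sub_all wB => r rB; apply: perm_on_stable rB _.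
  have [S [zS SB Sw Su]] := irred_exists_unique zB wB'.
  rewrite (bigD1 S) ?zS //= /trans_word Sw mul1r big1 ?addr0 // => S' /andP[/andP[zS' _]].
  move=> S'S; case: (boolP (irred S' w)) => [/(Su _ zS') e|_]; last by rewrite mul0r.
  by rewrite e eqxx in S'S.
rewrite wsum_sum.
rewrite [RHS](eq_bigl (fun S => [&& z \in S & S \subset B] && stable S u)); last first.
  by move=> S; rewrite andbA.
rewrite [RHS]big_mkcondr /=; apply: eq_bigr => S /andP[zS SB].
pose Q' : pred {perm T} := [pred r | perm_on B r & stable S r].
(* Only words whose letters all stabilise S contribute; on such letters the restriction to the two
   parts is a bijection onto pairs. *)
rewrite (@wsum_sub _ _ _ Q'); last 2 first.
- by move=> r /andP[].
- move=> w wB; rewrite all_predI wB /= => nS; rewrite /trans_word /irred.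
  by rewrite (negbTE nS) andbF mul0r.
rewrite (@wsum_reindex _ _ _ Q' [pred r : {perm T} * {perm T} | perm_on S r.1 & perm_on (B :\: S) r.2]
   (fun r : {perm T} * {perm T} => r.1 * r.2)%g (fun r : {perm T} => (restr_perm S r, restr_perm (B :\: S) r))); last 4 first.
- move=> [r s] /= /andP[rS sS]; rewrite /Q' /= (split_perm_on SB rS sS).
  by rewrite (split_stable _ rS sS) // (perm_on_stable rS).
- by move=> r _ /=; rewrite !restr_perm_on.
- by move=> r /andP[rB rS]; apply: split_restrK.
- by move=> [r s] /= /andP[rS sS]; rewrite (split_restrl rS sS) (split_restrr SB rS sS).
have E w : all [pred r : {perm T} * {perm T} | perm_on S r.1 & perm_on (B :\: S) r.2] w ->
    trans_word S u [seq (r.1 * r.2)%g | r : {perm T} * {perm T} <- w] = if stable S u then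
     trans_word S (restr_perm S u) (map fst w) *
     fact_word (restr_perm (B :\: S) u) (map snd w) else 0.
  move=> wS; rewrite /trans_word /fact_word (irred_split SB wS) (wprod_split SB wS).
  rewrite (wnorm_split SB wS) exprD.
  have w1 : perm_on S (wprod (map fst w)).
    by apply: wprod_perm_on; rewrite all_map; apply: sub_all wS => p /andP[].
  have w2 : perm_on (B :\: S) (wprod (map snd w)).
    by apply: wprod_perm_on; rewrite all_map; apply: sub_all wS => p /andP[].
  have -> : ((wprod (map fst w) * wprod (map snd w))%g == u) =
     [&& stable S u, wprod (map fst w) == restr_perm S u &
         wprod (map snd w) == restr_perm (B :\: S) u].
    apply/eqP/and3P => [<-|[Su /eqP -> /eqP ->]]; last exact: split_restrK.
    rewrite (split_stable _ w1 w2) // (perm_on_stable w1) //.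
    by rewrite (split_restrl w1 w2) (split_restrr SB w1 w2) !eqxx.
  case: ifP => _ /=; last by rewrite mul0r mulr0.
  by rewrite -mulnb natrM mulrACA [LHS]mulrA.
rewrite (eq_wsum (G := fun w => if stable S u then
     trans_word S (restr_perm S u) (map fst w) *
     fact_word (restr_perm (B :\: S) u) (map snd w) else 0)); last by move=> w /E.
by case: ifP => _; [rewrite wsum_pair | rewrite wsum0].
Qed.

Lemma all_fact_split B z u : z \in B ->
  all_fact B u = \sum_(S : {set T} | (z \in S) && (S \subset B))
     conn_fact S u * all_fact (B :\: S) u.
Proof.
move=> zB; rewrite {1}/all_fact; case: ifP => uB; last first.
  rewrite big1 // => S /andP[_ SB]; rewrite /conn_fact /all_fact.
  case: ifP => uS; last by rewrite mul0r.
  case: ifP => uD; last by rewrite mulr0.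
  suff : stable B u by rewrite uB.
  by rewrite -(setID B S) (setIidPr SB); apply: stableU.
rewrite (all_fact0_split zB (restr_perm_on B u)).
rewrite (eq_bigl (fun S => [&& z \in S & S \subset B] && stable S (restr_perm B u))); last first.
  by move=> S; rewrite andbA.
rewrite big_mkcondr; apply: eq_bigr => S /andP[_ SB].
rewrite (restr_stable SB uB) /conn_fact; case: ifP => uS; last by rewrite mul0r.
have uD : stable (B :\: S) u by apply: stableD.
by rewrite /all_fact uD !restr_restr ?subsetDl.
Qed.

Lemma conn_fact_unstable B u : ~~ stable B u -> conn_fact B u = 0.
Proof. by rewrite /conn_fact => /negbTE ->. Qed.

Lemma all_fact_local S u x y : x \notin S -> y \notin S ->
  all_fact S (u * tperm x y)%g = all_fact S u.
Proof.
move=> xS yS; have tS := stable_tperm_out xS yS.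
rewrite /all_fact stableMr //; case: ifP => // uS.
rewrite restrM // (_ : restr_perm S (tperm x y) = 1%g) ?mulg1 //.
apply/permP => w; rewrite restrE // perm1; case: ifP => // wS; rewrite tpermD //.
  by apply: contraNneq xS => ->.
by apply: contraNneq yS => ->.
Qed.

(** Obtained by peeling off the first letter. In the group algebra of Sym(B) it says that
    [all_fact0 B] is inverse to the sum of x^|r| r. *)
Lemma all_fact0_rec B u :
  \sum_(r | perm_on B r) X ^+ pnorm r * all_fact0 B (u * r^-1)%g = (u == 1%g)%:R.
Proof.
rewrite (bigD1 1%g) ?perm_on1 //= pnorm1 expr0 mul1r invg1 mulg1.
rewrite {1}/all_fact0 (@signed_sum_rec _ _ _ _ (@pnorm T)
   (fun r => fact_word (u * r^-1)%g)).
- rewrite /fact_word /= /wnorm big_nil expr0 mulr1 eq_sym.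
  by rewrite [X in _ - X](eq_bigl (fun r => perm_on B r && (r != 1%g))) // subrK.
- by move=> r /andP[_ /pnorm_gt0].
- move=> r w; rewrite /fact_word /= /wnorm big_cons exprD -(can2_eq (mulgK r) (mulgKV r)).
  by rewrite mulrCA.
- by move=> r; apply: order_fact_word.
Qed.

(** The sum of x^|r| r is 1 modulo x, so convolution with it is injective: the term r = 1 isolates a
    coefficient of [d u], and the other terms involve lower coefficients only. *)
Lemma fact_inverse_uniq B B' (d : {perm T} -> fps K) : B' \subset B ->
  (forall u, perm_on B u -> \sum_(r | perm_on B' r) X ^+ pnorm r * d (u * r^-1)%g = 0) ->
  forall u, perm_on B u -> d u = 0.
Proof.
move=> B'B dE u uB; apply: fps_ext => l; elim/ltn_ind: l u uB => l IHl u uB.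
have := congr1 (fun f => fcoef f l) (dE u uB).
rewrite (bigD1 1%g) ?perm_on1 //= pnorm1 expr0 mul1r invg1 mulg1 fcoefD fcoef_sum.
rewrite big1 ?addr0 // => r /andP[rB' /pnorm_gt0 r0]; rewrite fcoefXnM.
case: ifP => // dl; rewrite IHl //; first by lia.
by apply: perm_onM => //; apply: perm_onV; apply: subset_trans rB' B'B.
Qed.

Lemma pnorm_mul_tperm z i s : s z = z -> i != z ->
  pnorm (tperm i z * s)%g = (pnorm s).+1.
Proof.
move=> sz iz; have := porbits_mul_tperm s i z.
have -> : i \notin porbit s z.
  by rewrite (@porbit_out _ s (~: [set z])) ?inE // ?eqxx //;
     apply/subsetP => x; rewrite !inE; apply: contraNneq => ->; rewrite sz.
rewrite iz /pnorm; have := card_porbits_le s.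
have : (0 < #|porbits (tperm i z * s)%g|)%N.
  by rewrite card_gt0; apply/set0Pn; exists (porbit (tperm i z * s)%g z); apply: imset_f.
by rewrite /=; lia.
Qed.

(** Coset decomposition of Sym(B) modulo the stabiliser of z; i is the preimage of z under the
    permutation. *)
Lemma sum_perm_on_tperm B z (F : {perm T} -> fps K) : z \in B ->
  \sum_(r | perm_on B r) F r =
  \sum_(i in B) \sum_(r | perm_on (B :\ z) r) F (tperm i z * r)%g.
Proof.
move=> zB; rewrite (partition_big (fun r : {perm T} => r^-1%g z) (mem B)) /=; last first.
  by move=> r rB; rewrite (perm_closed _ (perm_onV rB)).
apply: eq_bigr => i iB.
rewrite (reindex_onto (fun r => tperm i z * r)%g (fun r => tperm i z * r)%g) /=; last first.
  by move=> r _; rewrite tpermKg.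
apply: eq_bigl => r; rewrite tpermKg eqxx andbT.
have tB : perm_on B (tperm i z).
  by apply: subset_trans (tperm_on i z) _; rewrite subUset !sub1set iB.
apply/andP/idP => [[rB /eqP e]|rB].
  have rB' : perm_on B r by rewrite -(tpermKg i z r); apply: perm_onM.
  apply/subsetP => x; rewrite !inE => rx; apply/andP; split; last exact: (subsetP rB').
  apply: contraNneq rx => ->.
  by move: (congr1 (tperm i z * r)%g e); rewrite permKV permM tpermL => <-.
have rz : r z = z by rewrite (out_perm rB) // !inE eqxx.
split; last by apply/eqP/(@perm_inj _ (tperm i z * r)%g); rewrite permKV permM tpermL.
by apply: perm_onM => //; apply: subset_trans rB (subsetDl _ _).
Qed.

(** The coset decomposition factors the sum of x^|r| r over Sym(B) as 1 + x J times the same sum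
    over the stabiliser of z, where J is the Jucys-Murphy element of z. Hence both sides agree after
    convolution with the second factor, and [fact_inverse_uniq] cancels it. *)
Lemma all_fact0_tperm B z u : z \in B -> perm_on B u ->
  all_fact0 B u + X * \sum_(i in B :\ z) all_fact0 B (u * tperm i z)%g =
  if u z == z then all_fact0 (B :\ z) u else 0.
Proof.
move=> zB uB; apply/eqP; rewrite -subr_eq0; apply/eqP.
pose d u := all_fact0 B u + X * \sum_(i in B :\ z) all_fact0 B (u * tperm i z)%g -
  if u z == z then all_fact0 (B :\ z) u else 0.
apply: (@fact_inverse_uniq B (B :\ z) d) => //; first exact: subsetDl.
move=> {uB}u uB; rewrite /d; under eq_bigr => r _ do rewrite mulrBr.
rewrite sumrB; apply/eqP; rewrite subr_eq0; apply/eqP.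
have -> : \sum_(r | perm_on (B :\ z) r) X ^+ pnorm r *
   (all_fact0 B (u * r^-1)%g + X * \sum_(i in B :\ z) all_fact0 B (u * r^-1 * tperm i z)%g) =
   \sum_(r | perm_on B r) X ^+ pnorm r * all_fact0 B (u * r^-1)%g.
  rewrite (sum_perm_on_tperm _ zB) (big_setD1 z) //= tperm1.
  under eq_bigr => r _ do rewrite mulrDr.
  rewrite big_split /=; congr (_ + _); first by apply: eq_bigr => r _; rewrite mul1g.
  under eq_bigr => r _ do rewrite mulrA mulr_sumr.
  rewrite exchange_big /=; apply: eq_bigr => i; rewrite !inE => /andP[iz iB].
  apply: eq_bigr => r rB; rewrite pnorm_mul_tperm // ?exprSr ?invMg ?tpermV ?mulgA //.
  by rewrite (out_perm rB) // !inE eqxx.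
rewrite all_fact0_rec; have [uz|uz] := eqVneq (u z) z; last first.
  rewrite big1 => [|r rB].
    by case: eqP => // u1; rewrite u1 perm1 eqxx in uz.
  rewrite permM; case: eqP => [e|_]; last by rewrite mulr0.
  have rz : r z = z by rewrite (out_perm rB) // !inE eqxx.
  by move: (congr1 r e); rewrite permKV rz => /eqP; rewrite (negbTE uz).
rewrite -(all_fact0_rec (B :\ z)); apply: eq_bigr => r rB.
by rewrite permM uz (out_perm (perm_onV rB)) ?eqxx // !inE eqxx.
Qed.

Lemma all_fact_tperm B z u : z \in B ->
  all_fact B u = (if u z == z then all_fact (B :\ z) u else 0) -
    X * \sum_(i in B :\ z) all_fact B (u * tperm i z)%g.
Proof.
move=> zB; have sz A : z \in A -> u z = z -> stable (A :\ z) u = stable A u.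
  move=> zA uz; apply/idP/idP => [uD|uA].
    rewrite -(setD1K zA); apply: stableU => //; apply: stable_sub => x.
    by rewrite !inE => /eqP ->; rewrite uz.
  by apply: stableD => //; apply: stable_sub => x; rewrite !inE => /eqP ->; rewrite uz.
have tB i : i \in B :\ z -> stable B (tperm i z).
  by rewrite inE => /andP[_ iB]; apply: stable_tperm.
rewrite /all_fact; have [uB|uB] := boolP (stable B u); last first.
  rewrite [X in X - _](_ : _ = 0).
    by rewrite big1 ?mulr0 ?subr0 // => i iB; rewrite stableMr ?tB // (negbTE uB).
  by case: eqP => // uz; rewrite sz // (negbTE uB).
apply: (@addIr _ (X * \sum_(i in B :\ z) all_fact0 B (restr_perm B u * tperm i z)%g)).
rewrite all_fact0_tperm ?restr_perm_on // restrE // zB.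
rewrite -addrA [X in _ + X](_ : _ = 0) ?addr0.
  case: eqP => // uz; rewrite sz // uB; congr all_fact0.
  apply/permP => x; rewrite !restrE ?sz // !inE.
  by case: (altP (x =P z)) => [->|] //=; rewrite zB uz.
rewrite addrC -mulrBr -sumrB big1 ?mulr0 // => i iB.
rewrite stableMr ?tB // uB restrM ?tB // [restr_perm B (tperm i z)]restr_id ?subrr //.
apply: subset_trans (tperm_on i z) _; move: iB; rewrite inE => /andP[_ iB].
by rewrite subUset !sub1set iB.
Qed.

Lemma all_fact_set0 u : all_fact set0 u = 1.
Proof.
rewrite /all_fact stable0.
have r1 r : perm_on set0 r -> r = 1%g.
  by move=> r0; apply/permP => x; rewrite perm1 (out_perm r0) // inE.
have -> : restr_perm set0 u = 1%g by apply/r1/restr_perm_on.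
have := all_fact0_rec set0 1%g; rewrite eqxx (big_pred1 1%g) => [|r].
  by rewrite pnorm1 expr0 mul1r invg1 mulg1.
by apply/idP/eqP => [/r1|->] //; apply: perm_on1.
Qed.

(** The right-hand side is shown to satisfy the relation of [all_fact_split], which determines the
    connected series by induction on B: the term S = B has the coefficient [all_fact set0 u], which
    is 1. After multiplication by the transposition, either the part of z contains i, or the part of
    i is split off from the rest as well. *)
Lemma conn_fact_rec B z u : z \in B ->
  conn_fact B u = ((B == [set z]) && (u z == z))%:R -
    X * \sum_(i in B :\ z) (conn_fact B (u * tperm i z)%g +
      \sum_(S : {set T} | [&& z \in S, S \subset B & i \notin S])
        conn_fact S (u * tperm i z)%g * conn_fact (B :\: S) (u * tperm i z)%g).
Proof.
pose rg B u : fps K := ((B == [set z]) && (u z == z))%:R -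
    X * \sum_(i in B :\ z) (conn_fact B (u * tperm i z)%g +
      \sum_(S : {set T} | [&& z \in S, S \subset B & i \notin S])
        conn_fact S (u * tperm i z)%g * conn_fact (B :\: S) (u * tperm i z)%g).
move: u; have [n] := ubnP #|B|; elim: n B => // n IHn B Bn u zB; rewrite -/(rg B u).
suff E : all_fact B u = \sum_(S : {set T} | (z \in S) && (S \subset B))
     rg S u * all_fact (B :\: S) u.
  move: E; rewrite (all_fact_split u zB) (bigD1 B) ?zB //= [RHS](bigD1 B) ?zB //=.
  rewrite setDv all_fact_set0 [_ * 1]mulr1 [X in _ = X + _]mulr1.
  have -> : \sum_(S : {set T} | (z \in S) && (S \subset B) && (S != B))
      conn_fact S u * all_fact (B :\: S) u =
    \sum_(S : {set T} | (z \in S) && (S \subset B) && (S != B))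
      rg S u * all_fact (B :\: S) u.
    apply: eq_bigr => S /andP[/andP[zS SB] SnB].
    rewrite IHn //; apply: (@leq_trans #|B|); last by rewrite -ltnS.
    by apply: proper_card; rewrite properEneq SnB.
  by move/addIr.
rewrite (all_fact_tperm u zB) {1}/rg.
under [RHS]eq_bigr => S _ do rewrite mulrBl -mulrA mulr_suml.
rewrite sumrB -mulr_sumr; congr (_ - X * _).
  rewrite (bigD1 [set z]) ?set11 ?sub1set //= eqxx [X in _ = _ + X]big1.
    by rewrite addr0 /=; case: eqP; rewrite ?mul1r ?mul0r.
  by move=> S /andP[_ /negbTE ->]; rewrite mul0r.
rewrite (exchange_big_dep (mem (B :\ z))) /=; last first.
  by move=> S i /andP[_ SB]; rewrite !inE => /andP[-> /(subsetP SB)].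
apply: eq_bigr => i; rewrite !inE => /andP[iz iB].
set v := (u * tperm i z)%g.
have loc S : z \in S -> i \in S -> all_fact (B :\: S) u = all_fact (B :\: S) v.
  by move=> zS iS; rewrite all_fact_local // !inE ?zS ?iS.
rewrite (all_fact_split v zB) (bigID (fun S : {set T} => i \in S)) /=.
rewrite [RHS](eq_bigl (fun S : {set T} => [&& z \in S & S \subset B] && (i \in S))); last first.
  by move=> S; rewrite !inE iz /=.
under [RHS]eq_bigr => S /andP[/andP[zS SB] iS] do rewrite (loc S) // mulrDl mulr_suml.
rewrite big_split /=; congr (_ + _).
(* S' is the part of z, and S is the union of the parts of z and i. For fixed S' the sum over S
   becomes a sum over the part of i. *)
rewrite (exchange_big_dep (fun S' : {set T} => [&& z \in S' & S' \subset B] && (i \notin S'))) /=;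
  last first.
  move=> S S' /andP[/andP[zS SB] iS] /and3P[zS' S'S iS'].
  by rewrite zS' iS' (subset_trans S'S SB).
apply: eq_bigr => S' /andP[/andP[zS' S'B] iS'].
have iD : i \in B :\: S' by rewrite inE iS' iB.
rewrite (all_fact_split v iD) mulr_sumr.
rewrite [RHS](reindex_onto (fun S => S' :|: S) (fun S => S :\: S')) /=; last first.
  move=> S /andP[/andP[/andP[zS SB] iS] /and3P[_ S'S _]].
  by rewrite setDE setUIr setUCr setIT; apply/setUidPr.
apply: eq_big => [S|S /andP[iS SD]].
  rewrite !inE zS' (negbTE iS') /= subUset S'B subsetUl /= andbT.
  rewrite subsetD.
  have [iS|] := boolP (i \in S); last by rewrite /= ?andbF.
  rewrite /= andbT; congr (_ && _).
  rewrite setDUl setDv set0U; apply/idP/eqP => [d|<-]; first by apply/setDidPl.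
  by rewrite -setI_eq0 setDE -setIA [~: _ :&: _]setIC setICr setI0.
have e : (S' :|: S) :\: S' = S.
  by move: SD; rewrite subsetD => /andP[_ d]; rewrite setDUl setDv set0U; apply/setDidPl.
by rewrite e mulrA setDDl.
Qed.

End Connected.

(** * Effect of a transposition on the cycles of a permutation *)

Section Cycles.
Variable T : finType.
Implicit Types (A B E S : {set T}) (C : {set T}) (u v : {perm T}) (x y z i : T).

Lemma stable_porbit u x : stable (porbit u x) u.
Proof.
by apply: stable_sub => _ /porbitP[k ->]; apply/porbitP; exists k.+1; rewrite expgSr permM.
Qed.

Lemma porbit_mul_tperm_out S u i z x : stable S u -> i \notin S -> z \notin S ->
  x \in S -> porbit (u * tperm i z)%g x = porbit u x.
Proof.
move=> uS iS zS xS; have tS := stable_tperm_out iS zS.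
rewrite -(porbit_restr uS xS) -(@porbit_restr _ (u * tperm i z)%g S) ?stableM //.
congr (porbit _ _); apply/permP => w; rewrite !restrE ?stableM //; case: ifP => // wS.
have uwS : u w \in S by have /stableP -> := uS.
rewrite permM tpermD //.
  by apply: contraNneq iS => ->.
by apply: contraNneq zS => ->.
Qed.

Lemma cycles_in_mul_tperm_out S u i z : stable S u -> i \notin S -> z \notin S ->
  cycles_in (u * tperm i z)%g S = cycles_in u S.
Proof. by move=> uS iS zS; apply: eq_in_imset => x; apply: porbit_mul_tperm_out. Qed.

Lemma cycles_in_setD u S E : stable S u -> S \subset E ->
  cycles_in u (E :\: S) = cycles_in u E :\: cycles_in u S.
Proof.
move=> uS SE; apply/setP => C; rewrite inE; apply/imsetP/andP.
  case=> x; rewrite inE => /andP[xS xE] ->; split; last exact: imset_f.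
  apply: contra xS => /imsetP[y yS e].
  by apply: (subsetP (porbit_sub uS yS)); rewrite -e porbit_id.
case=> CS /imsetP[x xE e]; exists x => //; rewrite inE xE andbT.
by apply: contra CS => xS; rewrite e; apply: imset_f.
Qed.

Lemma cycles_in_porbit u z : cycles_in u (porbit u z) = [set porbit u z].
Proof.
apply/setP => C; rewrite inE; apply/imsetP/eqP => [[x xz ->]|->].
  by apply/eqP; rewrite eq_porbit_mem.
by exists z; rewrite ?porbit_id.
Qed.

Lemma cycles_inD1 u E z : stable E u -> z \in E ->
  cycles_in u (E :\: porbit u z) = cycles_in u E :\ porbit u z.
Proof.
move=> uE zE; rewrite cycles_in_setD ?cycles_in_porbit ?porbit_sub //.
exact: stable_porbit.
Qed.

Lemma card_cycles_inD1 u E z : stable E u -> z \in E ->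
  #|cycles_in u E| = (#|cycles_in u (E :\: porbit u z)|).+1.
Proof. by move=> uE zE; rewrite cycles_inD1 // (cardsD1 (porbit u z)) imset_f. Qed.

Lemma sum_cycles_in (V : nmodType) u S (f : {set T} -> V) : stable S u ->
  \sum_(x in S) f (porbit u x) = \sum_(C in cycles_in u S) f C *+ #|C|.
Proof.
move=> uS; rewrite (partition_big (porbit u) (mem (cycles_in u S))) /=; last first.
  by move=> x xS; apply: imset_f.
apply: eq_bigr => C /imsetP[y yS ->].
rewrite (eq_bigr (fun=> f (porbit u y))); last by move=> x /andP[_ /eqP ->].
rewrite sumr_const; congr (_ *+ _); apply: eq_card => x; rewrite unfold_in /= eq_porbit_mem; apply/andP/idP => [[] //|xy]; split=> //.
exact: (subsetP (porbit_sub uS yS)).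
Qed.

Lemma card_cycles_in u S : stable S u -> (\sum_(C in cycles_in u S) #|C|)%N = #|S|.
Proof.
move=> uS; have := sum_cycles_in (V := nat) (fun=> 1%N) uS; rewrite sum1_card => ->.
by apply: eq_bigr => C _; rewrite -[LHS]natn.
Qed.

Lemma cover_cycles_in u S : stable S u -> cover (cycles_in u S) = S.
Proof.
move=> uS; apply/setP => x; apply/bigcupP/idP => [[C /imsetP[y yS ->] xC]|xS].
  exact: (subsetP (porbit_sub uS yS)).
by exists (porbit u x); rewrite ?porbit_id // imset_f.
Qed.

Lemma stable_cover u E (P : {set {set T}}) : P \subset cycles_in u E -> stable (cover P) u.
Proof.
move=> PE; apply: stable_sub => x /bigcupP[C CP xC]; apply/bigcupP; exists C => //.
have /imsetP[y _ e] := subsetP PE _ CP; rewrite e in xC *.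
by have /stableP -> := stable_porbit u y.
Qed.

Lemma cycles_in_cover u E (P : {set {set T}}) : P \subset cycles_in u E ->
  cycles_in u (cover P) = P.
Proof.
move=> PE; apply/setP => C; apply/imsetP/idP => [[x /bigcupP[D DP xD] ->]|CP].
  have /imsetP[y _ e] := subsetP PE _ DP; rewrite e in xD DP.
  by have /eqP -> : porbit u x == porbit u y by rewrite eq_porbit_mem.
have /imsetP[y _ e] := subsetP PE _ CP.
by exists y => //; apply/bigcupP; exists C; rewrite // e porbit_id.
Qed.

Lemma perm_pow_inj u z k l : (k < #|porbit u z|)%N -> (l < #|porbit u z|)%N ->
  (u ^+ k)%g z = (u ^+ l)%g z -> k = l.
Proof.
move=> ka la; rewrite !permX => e.
have /uniqP := uniq_traject_porbit u z => /(_ z k l).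
by rewrite !inE !size_traject !nth_traject //; apply.
Qed.

(** The points z, u z, ..., u^(j-1) z form the new cycle: the next step of u would lead to i, and
    the transposition redirects it to z. *)
Lemma porbit_cut u z j (i := (u ^+ j)%g z) : (0 < j < #|porbit u z|)%N ->
  #|porbit (u * tperm i z)%g z| = j /\ i \notin porbit (u * tperm i z)%g z.
Proof.
case/andP=> j0 ja; set v := (u * tperm i z)%g.
pose D := [set (u ^+ (val k))%g z | k : 'I_j].
have cardD : #|D| = j.
  rewrite card_imset ?card_ord // => k l e; apply: val_inj.
  exact: (perm_pow_inj (ltn_trans (ltn_ord k) ja) (ltn_trans (ltn_ord l) ja) e).
have uX k : u ((u ^+ k)%g z) = (u ^+ k.+1)%g z by rewrite expgSr permM.
have powE k : (k.+1 < j)%N -> v ((u ^+ k)%g z) = (u ^+ k.+1)%g z.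
  move=> kj; rewrite permM uX tpermD //.
    by apply/eqP => /(perm_pow_inj ja (ltn_trans kj ja)); lia.
  apply/eqP; rewrite -{1}[z]perm1 -(expg0 u) => /(perm_pow_inj _ (ltn_trans kj ja)).
  by move=> /(_ (ltn_trans j0 ja)).
have vD : stable D v.
  apply: stable_sub => _ /imsetP[k _ ->].
  have [kj|jk] := ltnP k.+1 j.
    by rewrite powE //; apply/imsetP; exists (Ordinal kj).
  have -> : v ((u ^+ k)%g z) = z.
    rewrite permM uX (_ : k.+1 = j) ?tpermL //.
    by move: (ltn_ord k); lia.
  by apply/imsetP; exists (Ordinal j0); rewrite ?expg0 ?perm1.
have zD : z \in D by apply/imsetP; exists (Ordinal j0); rewrite ?expg0 ?perm1.
have vk k : (k < j)%N -> (v ^+ k)%g z = (u ^+ k)%g z.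
  elim: k => [|k IHk] kj; first by rewrite !expg0.
  by rewrite expgSr permM IHk ?powE //; lia.
have -> : porbit v z = D.
  apply/eqP; rewrite eqEsubset porbit_sub //; apply/subsetP => _ /imsetP[k _ ->].
  by apply/porbitP; exists k; rewrite vk.
split=> //; apply/imsetP => -[k _] /(perm_pow_inj ja (ltn_trans (ltn_ord k) ja)).
by move: (ltn_ord k); lia.
Qed.

Lemma porbit_pow u z i : i \in porbit u z -> i != z ->
  exists2 j, (0 < j < #|porbit u z|)%N & i = (u ^+ j)%g z.
Proof.
rewrite porbit_traject => /trajectP[j ja ->] jz; exists j; rewrite ?permX // ja andbT.
by rewrite lt0n; apply: contraNneq jz => ->.
Qed.

(** [porbit_cut] is applied a second time starting from i, since the remaining steps of the old
    cycle lead from i back to z. *)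
Lemma porbit_cut_both u z j (i := (u ^+ j)%g z) (v := (u * tperm i z)%g) :
  (0 < j < #|porbit u z|)%N ->
  [/\ #|porbit v z| = j, #|porbit v i| = (#|porbit u z| - j)%N, i \notin porbit v z &
      porbit v z :|: porbit v i = porbit u z].
Proof.
move=> ja; have [c1 d1] := porbit_cut ja; rewrite -/i -/v in c1 d1.
have aE : #|porbit u i| = #|porbit u z| by rewrite /i porbit_perm.
have zE : (u ^+ (#|porbit u z| - j))%g i = z.
  rewrite /i -permM -expgD subnKC ?permX ?iter_porbit //; lia.
have [|c2 d2] := @porbit_cut u i (#|porbit u z| - j)%N; first by rewrite aE; lia.
rewrite zE tpermC -/v in c2 d2.
have vC : stable (porbit u z) v.
  apply: stableM (stable_porbit u z) _; apply: stable_tperm; rewrite ?porbit_id //.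
  exact: mem_porbit.
have disj : porbit v z :&: porbit v i = set0.
  apply/setP => x; rewrite !inE; apply/negbTE/negP => /andP[].
  rewrite -!eq_porbit_mem => /eqP -> /eqP e.
  by case/negP: d1; rewrite porbit_sym -e porbit_id.
split=> //; apply/eqP; rewrite eqEcard subUset !porbit_sub ?porbit_id ?mem_porbit //=.
by rewrite -[X in (_ <= X)%N]addn0 -(cards0 T) -disj cardsUI c1 c2; lia.
Qed.

(** If the new cycle of z missed i, its intersection with the old cycle of i would be invariant
    under u. It contains the preimage of z under v, which u sends to i, so it would contain i after
    all. *)
Lemma porbit_join u z i (v := (u * tperm i z)%g) : i \notin porbit u z ->
  porbit v z = porbit u z :|: porbit u i.
Proof.
move=> iz.
have zi : z \notin porbit u i by rewrite porbit_sym.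
have uE : u = (v * tperm i z)%g by rewrite /v -mulgA tperm2 mulg1.
have iD : i \in porbit v z.
  apply/negPn/negP => iD.
  pose x := (v^-1)%g z; have xD : x \in porbit v z.
    by rewrite -porbitV; apply/porbitP; exists 1%N; rewrite expg1.
  have ux : u x = i by rewrite uE permM permKV tpermR.
  have xi : x \in porbit u i.
    by rewrite porbit_sym; apply/porbitP; exists 1%N; rewrite expg1 ux.
  have : stable (porbit v z :&: porbit u i) u^-1%g.
    apply: stable_sub => y; rewrite !inE => /andP[yD yi].
    have wi : u^-1%g y \in porbit u i.
      by have /stableP -> := stableV (stable_porbit u i).
    rewrite wi andbT.
    have [yz|yz] := eqVneq y z; first by move: yi; rewrite yz porbit_sym (negbTE iz).
    have vw : v (u^-1%g y) = y.
      rewrite permM permKV tpermD // eq_sym //.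
      by apply: contraNneq iD => <-.
    rewrite -{}vw in yD.
    by have /stableP := stable_porbit v z => <-.
  move/stableV; rewrite invgK => st.
  have /(subsetP (porbit_sub st _)) h : i \in porbit u x by rewrite porbit_sym.
  have : i \in porbit v z :&: porbit u i by apply: h; rewrite inE xD.
  by rewrite inE (negbTE iD).
have uD : stable (porbit v z) u.
  rewrite uE; apply: stableM (stable_porbit v z) _.
  by apply: stable_tperm; rewrite ?porbit_id.
apply/eqP; rewrite eqEsubset subUset !porbit_sub ?porbit_id ?inE ?porbit_id //.
apply: stableM; first by apply: stableU; apply: stable_porbit.
by apply: stable_tperm; rewrite !inE ?porbit_id ?orbT.
Qed.

Lemma join_cycles u B z i (v := (u * tperm i z)%g) : stable B u -> z \in B -> i \in B ->
  i \notin porbit u z ->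
  [/\ stable B v, #|porbit v z| = (#|porbit u z| + #|porbit u i|)%N,
      porbit u i \in cycles_in u (B :\: porbit u z) &
      cycles_in v (B :\: porbit v z) = cycles_in u (B :\: porbit u z) :\ porbit u i].
Proof.
move=> uB zB iB iz; have vB : stable B v by apply/stableM/stable_tperm.
have iBz : i \in B :\: porbit u z by rewrite inE iz.
have uBz : stable (B :\: porbit u z) u by apply/stableD/stable_porbit.
split=> //; last first.
- rewrite porbit_join // -setDDl cycles_in_mul_tperm_out ?inE ?porbit_id ?negb_and ?negbK
    ?porbit_id ?orbT //.
    by rewrite cycles_inD1.
  by apply/stableD/stable_porbit.
- exact: imset_f.
- rewrite porbit_join // -cardsUI (_ : _ :&: _ = set0) ?cards0 ?addn0 //.
  apply/setP => x; rewrite !inE; apply/negbTE/negP => /andP[].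
  rewrite -!eq_porbit_mem => /eqP -> /eqP e.
  by case/negP: iz; rewrite porbit_sym -e porbit_id.
Qed.

Lemma card_join_cycles u B z i : stable B u -> z \in B -> i \in B ->
  i \notin porbit u z ->
  #|cycles_in u B| = (#|cycles_in (u * tperm i z)%g B|).+1.
Proof.
move=> uB zB iB iz; have [vB _ iC E] := join_cycles uB zB iB iz.
by rewrite (card_cycles_inD1 uB zB) (card_cycles_inD1 vB zB) E [in LHS](cardsD1 (porbit u i)) iC.
Qed.

Lemma card_cut_cycles u B z i : stable B u -> z \in B -> i != z ->
  i \in porbit u z ->
  #|cycles_in (u * tperm i z)%g B| = (#|cycles_in u B|).+1.
Proof.
move=> uB zB iz iC; have [j ja iE] := porbit_pow iC iz; rewrite iE in iz iC *.
set v := (u * _)%g; have [_ _ d1 dU] := porbit_cut_both ja; rewrite -/v in d1 dU.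
have CB : porbit u z \subset B by apply: porbit_sub.
have vB : stable B v by apply/stableM/stable_tperm => //; apply: (subsetP CB).
have vBz : stable (B :\: porbit v z) v by apply/stableD/stable_porbit.
rewrite (card_cycles_inD1 uB zB) (card_cycles_inD1 vB zB).
rewrite (card_cycles_inD1 vBz (z := (u ^+ j)%g z)); last by rewrite inE d1 (subsetP CB).
rewrite setDDl dU cycles_in_mul_tperm_out ?inE ?negb_and ?negbK ?porbit_id ?mem_porbit //.
by apply/stableD/stable_porbit.
Qed.

End Cycles.

(** * Support and leading coefficient of the connected series *)

Section Leading.
Variables (K : numFieldType) (T : finType).
Implicit Types (A B E S : {set T}) (C : {set T}) (u v : {perm T}) (x y z i : T).
Local Notation conn_fact := (@conn_fact K T).

(* Pads the size of the empty set, which is never a cycle, to a positive number. *)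
Definition csize C : nat := (#|C|.-1).+1.

Definition planar_lead B u : K :=
  \prod_(C in cycles_in u B) wcbin K #|C| *
  ((2 * #|B| + #|cycles_in u B| - 3)`!%:R / (2 * #|B|)`!%:R).

Lemma csizeE C u E : C \in cycles_in u E -> csize C = #|C|.
Proof.
by case/imsetP => x _ ->; rewrite /csize prednK // lt0n card_porbit_neq0.
Qed.

(** The formula is symmetric in the cycles, so any point z of B may choose the distinguished one. *)
Lemma planar_leadE B u z : stable B u -> z \in B ->
  planar_lead B u = planar K csize #|porbit u z| (cycles_in u (B :\: porbit u z)).
Proof.
move=> uB zB; rewrite /planar_lead /planar /cwt /swt.
rewrite (card_cycles_inD1 uB zB) -(card_cycles_in uB).
have zC : porbit u z \in cycles_in u B by apply: imset_f.
rewrite (big_setD1 _ zC) /= (big_setD1 (aop := addn) _ zC) /= -cycles_inD1 //.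
rewrite (eq_bigr (fun C => csize C)); last by move=> C /csizeE.
congr (_ * _ * (_ / _)); first by apply: eq_bigr => C /csizeE ->.
by congr (_%:R); congr (_`!); lia.
Qed.

Lemma fcoef_conn_fact0 B z u : z \in B -> stable B u ->
  fcoef (conn_fact B u) 0 = (B == [set z])%:R.
Proof.
move=> zB uB; rewrite (conn_fact_rec K u zB) fcoefB fcoefXM subr0 fcoef_nat eqxx mulr1.
case: eqP => // BE; suff -> : u z == z by [].
by move/stableP: uB => /(_ z); rewrite BE !inE eqxx.
Qed.

Lemma fcoef_conn_factS B z u l : z \in B ->
  fcoef (conn_fact B u) l.+1 = - \sum_(i in B :\ z)
    (fcoef (conn_fact B (u * tperm i z)%g) l +
      \sum_(S : {set T} | [&& z \in S, S \subset B & i \notin S]) \sum_(k < l.+1)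
        fcoef (conn_fact S (u * tperm i z)%g) k *
        fcoef (conn_fact (B :\: S) (u * tperm i z)%g) (l - k)%N).
Proof.
move=> zB; rewrite (conn_fact_rec K u zB) fcoefB fcoefXM fcoef_nat mulr0 add0r.
congr (- _); rewrite fcoef_sum; apply: eq_bigr => i _; rewrite fcoefD fcoef_sum.
by congr (_ + _); apply: eq_bigr => S _; rewrite fcoefM.
Qed.

(** Otherwise the transposition would join the cycles of z and i, and no invariant set could
    separate the two points. The quadratic terms of the recursion thus come from cuts only. *)
Lemma stable_cut S u z i : z \in S -> i \notin S -> stable S (u * tperm i z)%g ->
  i \in porbit u z.
Proof.
move=> zS iS vS; apply: contraR iS => /porbit_join e.
by apply: (subsetP (porbit_sub vS zS)); rewrite e inE porbit_id orbT.
Qed.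

(* The genus of a transitive factorisation is a natural number. *)
Lemma conn_fact_support l B u : B != set0 -> stable B u ->
  ((l + 2 < #|B| + #|cycles_in u B|)%N || odd (l + #|B| + #|cycles_in u B|)) ->
  fcoef (conn_fact B u) l = 0.
Proof.
elim/ltn_ind: l B u => -[|l] IHl B u /set0Pn[z zB] uB lBu.
  rewrite (fcoef_conn_fact0 zB uB); case: eqP => // BE; exfalso; move: lBu.
  have -> : #|B| = 1%N by rewrite BE cards1.
  suff -> : #|cycles_in u B| = 1%N by [].
  by rewrite BE /cycles_in imset_set1 cards1.
rewrite (fcoef_conn_factS u l zB) big1 ?oppr0 // => i; rewrite !inE => /andP[iz iB].
set v := (u * tperm i z)%g; have vB : stable B v by apply/stableM/stable_tperm.
have B0 : B != set0 by apply/set0Pn; exists z.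
have -> : fcoef (conn_fact B v) l = 0.
  apply: IHl => //; have [iC|iC] := boolP (i \in porbit u z).
    by have := card_cut_cycles uB zB iz iC; rewrite -/v; lia.
  by have := card_join_cycles uB zB iB iC; rewrite -/v; lia.
rewrite add0r big1 // => S /and3P[zS SB iS]; apply: big1 => k _.
have [vS|/conn_fact_unstable ->] := boolP (stable S v); last by rewrite fcoef0 mul0r.
have vD : stable (B :\: S) v by apply: stableD.
have S0 : S != set0 by apply/set0Pn; exists z.
have D0 : B :\: S != set0 by apply/set0Pn; exists i; rewrite inE iS.
have iC := stable_cut zS iS vS.
have e1 := card_cut_cycles uB zB iz iC; rewrite -/v in e1.
have e2 := card_cycles_split vS SB.
have e3 : (#|S| + #|B :\: S| = #|B|)%N by rewrite -(cardsID S B) (setIidPr SB).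
(* The degrees, sizes and cycle counts of the two factors add up to those of the whole. If the
   factor at S violates neither the bound nor the parity, the factor at the complement violates the
   one that B violates. *)
have [h|h] := boolP ((k + 2 < #|S| + #|cycles_in v S|)%N || odd (k + #|S| + #|cycles_in v S|)).
  by rewrite (IHl k) ?mul0r // ltnS -ltnS.
rewrite (IHl (l - k)%N _ (B :\: S)) ?mulr0 //; first by rewrite ltnS leq_subr.
move: h; rewrite negb_or -leqNgt => /andP[h1 h2].
have kl : (k <= l)%N by rewrite -ltnS.
case/orP: lBu => [lt|od]; apply/orP; [left; clear -lt h1 e1 e2 e3 kl; lia | right].
have e : (l.+1 + #|B| + #|cycles_in u B| =
    (k + #|S| + #|cycles_in v S|) + (l - k + #|B :\: S| + #|cycles_in v (B :\: S)|))%N.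
  by clear -e1 e2 e3 kl; lia.
by rewrite e oddD (negbTE h2) in od.
Qed.

(** An invariant set that contains z but not i is the new cycle of z together with a set P of cycles
    untouched by the cut. This bijection produces the quadratic term of [planar_rec]. *)
Lemma planar_cut u B z j (i := (u ^+ j.+1)%g z) (v := (u * tperm i z)%g) :
  stable B u -> z \in B -> (j.+1 < #|porbit u z|)%N ->
  \sum_(S : {set T} | [&& z \in S, S \subset B & i \notin S] && stable S v)
     planar_lead S v * planar_lead (B :\: S) v =
  \sum_(P : {set {set T}} | P \subset cycles_in u (B :\: porbit u z))
     planar K csize j.+1 P *
     planar K csize (#|porbit u z| - j.+1) (cycles_in u (B :\: porbit u z) :\: P).
Proof.
move=> uB zB ja; have ja' : (0 < j.+1 < #|porbit u z|)%N by [].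
have [c1 c2 d1 dU] := porbit_cut_both ja'; rewrite -/i -/v in c1 c2 d1 dU.
have CB : porbit u z \subset B by apply: porbit_sub.
have iB : i \in B by apply: (subsetP CB); apply: mem_porbit.
have vB : stable B v by apply/stableM/stable_tperm.
have zC : z \in porbit u z by apply: porbit_id.
have iC : i \in porbit u z by apply: mem_porbit.
have uE : stable (B :\: porbit u z) u by apply/stableD/stable_porbit.
have cE S : S \subset B :\: porbit u z -> stable S v -> stable S u.
  move=> SE; rewrite /v stableMr //; apply: stable_tperm_out.
    by apply: contraL iC => /(subsetP SE); rewrite inE => /andP[].
  by apply: contraL zC => /(subsetP SE); rewrite inE => /andP[].
have vC : stable (porbit u z) v.
  by rewrite -dU; apply: stableU; apply: stable_porbit.
have AE : cycles_in u (B :\: porbit u z) = cycles_in v (B :\: porbit u z).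
  by rewrite /v cycles_in_mul_tperm_out // inE ?iC ?zC.
rewrite AE; set A := cycles_in v (B :\: porbit u z).
have coverA (P : {set {set T}}) : P \subset A -> cover P \subset B :\: porbit u z.
  move=> PA; rewrite -(cover_cycles_in (stableD vB vC)); apply/subsetP => x.
  case/bigcupP => C CP xC; apply/bigcupP; exists C => //; exact: (subsetP PA).
have ctz S : z \in S -> stable S v -> porbit v z \subset S by move=> zS vS; apply: porbit_sub.
have cti S : S \subset B -> i \notin S -> stable S v -> [disjoint S & porbit v i].
  move=> SB iS vS; apply/pred0P => x /=; apply/negbTE/negP => /andP[xS].
  rewrite porbit_sym => ix; case/negP: iS.
  exact: (subsetP (porbit_sub vS xS)).
rewrite [RHS](reindex_onto (fun S => cycles_in v (S :\: porbit v z))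
   (fun P => porbit v z :|: cover P)) /=; last first.
  move=> P PA; have := coverA P PA; rewrite subsetD => /andP[cB cd].
  have -> : (porbit v z :|: cover P) :\: porbit v z = cover P.
    rewrite setDUl setDv set0U; apply/setDidPl; apply: disjointWr cd.
    by rewrite -dU subsetUl.
  exact: cycles_in_cover PA.
apply: eq_big => [S|S].
  apply/andP/andP => [[/and3P[zS SB iS] vS]|[PA /eqP SE]].
    have SDE : S :\: porbit v z = S :\: porbit u z.
      rewrite -dU -setDDl; apply/esym/setDidPl; apply: disjointWl (cti S SB iS vS).
      exact: subsetDl.
    split; first by rewrite SDE; apply: imsetS; apply: setSD.
    apply/eqP; rewrite cover_cycles_in; last by apply/stableD/stable_porbit.
    by rewrite -[RHS](setID S (porbit v z)) (setIidPr (ctz S zS vS)).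
  have := coverA _ PA; set P := cycles_in _ _ in PA SE * => cE'.
  have vS : stable S v.
    rewrite -SE; apply: stableU; first exact: stable_porbit.
    exact: stable_cover PA.
  split=> //; rewrite -SE !inE porbit_id /= (negbTE d1) /= subUset.
  rewrite (subset_trans _ CB) /=; last by rewrite -dU subsetUl.
  rewrite (subset_trans cE' (subsetDl _ _)) /=.
  by apply: contraL iC => /(subsetP cE'); rewrite inE => /andP[].
case/andP=> /and3P[zS SB iS] vS.
have iD : i \in B :\: S by rewrite inE iS.
have vD : stable (B :\: S) v by apply: stableD.
rewrite (planar_leadE vS zS) (planar_leadE vD iD) c1 c2; congr (_ * planar _ _ _ _).
have vSz : stable (S :\: porbit v z) v by apply/stableD/stable_porbit.
rewrite -cycles_in_setD //; last first.
  rewrite subsetD (subset_trans (subsetDl _ _) SB) -dU -setI_eq0 setIUr setU_eq0 !setI_eq0.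
  rewrite (disjointWl (subsetDl _ _) (cti S SB iS vS)) andbT.
  by rewrite disjoint_sym -setI_eq0 setIDA setD_eq0 subsetIl.
congr (cycles_in v _); rewrite -dU; apply/setP => x; rewrite !inE.
have [xS|xS] := boolP (x \in S).
  rewrite /= andbT; have -> : x \in porbit v i = false by rewrite (disjointFr (cti S SB iS vS)).
  by rewrite orbF; case: (x \in porbit v z); rewrite ?andbF.
have -> : x \in porbit v z = false.
  by apply/negbTE; apply: contra xS; apply/subsetP/ctz.
by rewrite /= andbC.
Qed.

(** In the lowest degree the recursion [conn_fact_rec] becomes [planar_rec]. For i outside the cycle
    of z the quadratic terms vanish by [stable_cut]; for i inside it the linear term lies below its
    support, and the products reduce to products of leading coefficients. *)
Lemma conn_fact_lead l B u : B != set0 -> stable B u ->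
  (l + 2 = #|B| + #|cycles_in u B|)%N ->
  fcoef (conn_fact B u) l = (-1) ^+ (#|B| + #|cycles_in u B|) * planar_lead B u.
Proof.
elim/ltn_ind: l B u => l IHl B u /set0Pn[z zB] uB lBu.
have r0 := card_cycles_inD1 uB zB.
have B0 : (0 < #|B|)%N by rewrite (cardD1 z) zB.
have cgt0 : forall C, (0 < csize C)%N by [].
have [n En] : exists n, #|porbit u z| = n.+1.
  by exists #|porbit u z|.-1; rewrite prednK // lt0n card_porbit_neq0.
have CB : porbit u z \subset B by apply: porbit_sub.
rewrite (planar_leadE uB zB) En planar_rec //.
set A := cycles_in u (B :\: porbit u z).
case: l IHl lBu => [|l] IHl lBu.
  have B1 : B = [set z].
    apply/eqP; rewrite eq_sym eqEcard sub1set zB cards1; lia.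
  have A0 : A = set0 by apply/eqP; rewrite -cards_eq0 /A; lia.
  have n0 : n = 0%N by have := subset_leq_card CB; rewrite En; lia.
  rewrite (fcoef_conn_fact0 zB uB) -lBu {1}B1 !eqxx A0 n0 big_set0 big_ord0 !eqxx.
  by rewrite !addr0 expr2 mulrNN !mulr1.
have -> : (n == 0%N) && (A == set0) = false.
  apply/negbTE/negP => /andP[/eqP n0 /eqP A0].
  have : #|B| = 1%N.
    rewrite -(card_cycles_in uB) (big_setD1 (porbit u z)) ?imset_f //= -cycles_inD1 //.
    by rewrite -/A A0 big_set0 En n0.
  by move: lBu; rewrite r0 -/A A0 cards0; lia.
rewrite add0r (fcoef_conn_factS u l zB).
set sg := (-1) ^+ _; rewrite mulrDr -sumrN.
have zCn : z \notin B :\: porbit u z by rewrite inE porbit_id.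
rewrite (big_setID (B :\: porbit u z)) /= [in X in X + _](_ : (B :\ z) :&: (B :\: porbit u z) = B :\: porbit u z);
  last first.
  apply/setIidPr/subsetP => x xE; rewrite !inE; move: (xE); rewrite inE => /andP[_ ->].
  by rewrite andbT; apply: contraNneq zCn => xz; rewrite xz in xE.
congr (_ + _).
  rewrite mulr_sumr.
  have uE : stable (B :\: porbit u z) u by apply/stableD/stable_porbit.
  (* The contribution of i depends only on its cycle C, so C is counted |C| times; this is the
     factor [al k] of [planar_rec]. *)
  pose f C := sg * planar K csize (n.+1 + csize C) (A :\ C).
  rewrite (eq_bigr (fun i => f (porbit u i))); last first.
    move=> i; rewrite inE => /andP[iC iB].
    have [vB c3 iA cA] := join_cycles uB zB iB iC.
    rewrite [X in _ + X]big1 ?addr0; last first.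
      move=> S /and3P[zS SB iS]; apply: big1 => k _; rewrite conn_fact_unstable ?fcoef0 ?mul0r //.
      by apply: contra iC => vS; apply: stable_cut vS.
    have e := card_join_cycles uB zB iB iC.
    rewrite IHl //; [|by apply/set0Pn; exists z|by clear -e lBu; lia].
    rewrite (planar_leadE vB zB) c3 cA -/A En /f (csizeE iA) -mulNr; congr (_ * _).
    by rewrite /sg e addnS exprS mulN1r.
  rewrite (sum_cycles_in f uE); apply: eq_bigr => C CA.
  by rewrite /f (csizeE CA) -[LHS]mulr_natl mulrCA.
have -> : (B :\ z) :\: (B :\: porbit u z) = porbit u z :\ z.
  apply/setP => x; rewrite !inE; have [xC|xC] := boolP (x \in porbit u z).
    by rewrite (subsetP CB) ?andbT.
  by rewrite /= andbF; case: (x \in B); rewrite ?andbF.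
have -> : porbit u z :\ z = [set (u ^+ (nat_of_ord j).+1)%g z | j : 'I_n].
  apply/setP => x; rewrite !inE; apply/andP/imsetP => [[xz /porbit_pow/(_ xz)]|[j _ ->]].
    case=> -[|j] // ja ->; have jn : (j < n)%N by move: ja; rewrite En; lia.
    by exists (Ordinal jn).
  split; last exact: mem_porbit.
  apply/eqP; rewrite -[X in _ = X]perm1 -(expg0 u) => /(perm_pow_inj _ _) e.
  by suff : (j.+1 = 0)%N by []; apply: e; rewrite En; move: (ltn_ord j); lia.
rewrite big_imset /=; last first.
  move=> j k _ _ /(perm_pow_inj _ _) e; apply: val_inj.
  suff : (j.+1 = k.+1)%N by case.
  by apply: e; rewrite En; [move: (ltn_ord j) | move: (ltn_ord k)]; lia.
rewrite mulr_sumr; apply: eq_bigr => j _.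
have ja : (j.+1 < #|porbit u z|)%N by rewrite En; move: (ltn_ord j); lia.
set i := (u ^+ j.+1)%g z; set v := (u * tperm i z)%g.
have iC : i \in porbit u z by apply: mem_porbit.
have iz : i != z.
  apply/eqP; rewrite /i -[X in _ = X]perm1 -(expg0 u) => /(perm_pow_inj _ _) e.
  by suff : (j.+1 = 0)%N by []; apply: e => //; rewrite En.
have iB : i \in B by apply: (subsetP CB).
have vB : stable B v by apply/stableM/stable_tperm.
have ec := card_cut_cycles uB zB iz iC; rewrite -/v in ec.
rewrite conn_fact_support ?add0r //; last first.
- by apply/orP; left; rewrite ec; clear -lBu; lia.
- by apply/set0Pn; exists z.
have := planar_cut uB zB ja; rewrite -/i -/v -/A En subSS => <-.
rewrite mulr_sumr (bigID (fun S => stable S v)) /= [X in _ + X]big1 ?addr0; last first.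
  move=> S /andP[_ nS]; apply: big1 => k _.
  by rewrite conn_fact_unstable // fcoef0 mul0r.
rewrite -sumrN; apply: eq_bigr => S /andP[/and3P[zS SB iS] vS].
have vD : stable (B :\: S) v by apply: stableD.
have S0 : S != set0 by apply/set0Pn; exists z.
have D0 : B :\: S != set0 by apply/set0Pn; exists i; rewrite inE iS.
have e2 := card_cycles_split vS SB.
have e3 : (#|S| + #|B :\: S| = #|B|)%N by rewrite -(cardsID S B) (setIidPr SB).
have p1 : (0 < #|S|)%N by rewrite card_gt0.
have p2 : (0 < #|B :\: S|)%N by rewrite card_gt0.
have p3 : (0 < #|cycles_in v S|)%N by rewrite (card_cycles_inD1 vS zS).
have iD : i \in B :\: S by rewrite inE iS.
have p4 : (0 < #|cycles_in v (B :\: S)|)%N by rewrite (card_cycles_inD1 vD iD).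
(* k0 and l - k0 are the lowest degrees of the two factors. Any other k falls below the support of
   one of them. *)
have [k0 [k0l h1 h2]] : exists k0, [/\ (k0 < l.+1)%N, (k0 + 2 = #|S| + #|cycles_in v S|)%N &
    (l - k0 + 2 = #|B :\: S| + #|cycles_in v (B :\: S)|)%N].
  exists (#|S| + #|cycles_in v S| - 2)%N; clear -lBu ec e2 e3 p1 p2 p3 p4.
  by split; lia.
rewrite (bigD1 (Ordinal k0l)) //= big1 ?addr0; last first.
  move=> k kk0; have kl : (k <= l)%N by rewrite -ltnS.
  have kk0' : (k != k0 :> nat)%N by apply: contraNneq kk0 => e; apply/eqP/val_inj.
  have [lt|ge] := ltnP (k + 2) (#|S| + #|cycles_in v S|)%N.
    by rewrite (conn_fact_support (B := S)) ?mul0r // lt.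
  rewrite (conn_fact_support (B := B :\: S)) ?mulr0 //.
  by apply/orP; left; clear -kk0' ge kl h1 h2 k0l; lia.
rewrite IHl // IHl //; last by rewrite ltnS leq_subr.
rewrite mulrACA -exprD -mulNr; congr (_ * _).
rewrite /sg (_ : (_ + (_ + _))%N = (#|B| + #|cycles_in u B|).+1);
  last by clear -ec e2 e3; lia.
by rewrite exprS mulN1r opprK.
Qed.

End Leading.

(** * Transfer from permutations of a block B to permutations of #|B| points *)

Section Transfer.
Variables (n : nat) (B : {set 'I_n}).
Implicit Types (r s u : 'S_n) (w : seq 'S_n) (A : {set 'I_n}).
Local Notation bp := (block_perm B).
Local Notation ev := (@enum_val _ (mem B)).

Lemma enum_valE x : x \in B -> exists i, x = ev i.
Proof. by move=> xB; exists (enum_rank_in xB x); rewrite enum_rankK_in. Qed.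

Lemma block_permM r s : stable B r -> stable B s -> bp (r * s)%g = (bp r * bp s)%g.
Proof.
move=> rB sB; apply/permP => i; apply: enum_val_inj.
by rewrite permM !block_permE ?permM //; apply: stableM.
Qed.

Lemma block_perm1 : bp 1%g = 1%g.
Proof.
by apply/permP => i; apply: enum_val_inj; rewrite block_permE ?perm1 //; apply: stable1.
Qed.

Lemma block_permV r : stable B r -> bp r^-1%g = (bp r)^-1%g.
Proof.
move=> rB; apply/eqP; rewrite eq_sym eq_invg_mul -block_permM ?stableV //.
by rewrite mulgV block_perm1.
Qed.

Lemma block_perm_restr u : stable B u -> bp (restr_perm B u) = bp u.
Proof.
move=> uB; apply/permP => i; apply: enum_val_inj.
rewrite !block_permE ?restrE ?enum_valP //.
exact: (perm_on_stable (restr_perm_on B u) (subxx _)).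
Qed.

Lemma block_perm_inj r s : perm_on B r -> perm_on B s -> bp r = bp s -> r = s.
Proof.
move=> rB sB e; apply/permP => x; have [/enum_valE[i ->]|xB] := boolP (x \in B).
  rewrite -(block_permE i (perm_on_stable rB (subxx _))).
  by rewrite -(block_permE i (perm_on_stable sB (subxx _))) e.
by rewrite !(out_perm _ xB).
Qed.

(** An injection between sets of the same cardinality, the factorial of #|B|. *)
Lemma block_perm_surj (t : 'S_#|B|) : exists2 s, perm_on B s & bp s = t.
Proof.
have /subset_leqif_cards[_ /esym] := subsetT [set bp s | s in [set s | perm_on B s]].
rewrite card_in_imset; last first.
  by move=> r s; rewrite !inE; apply: block_perm_inj.
rewrite cardsT card_Sn cardsE card_perm eqxx => /eqP e.
have : t \in [set: 'S_#|B|] by rewrite inE.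
by rewrite -e => /imsetP[s]; rewrite inE => sB ->; exists s.
Qed.

Lemma stable_block A u : A \subset B -> stable B u ->
  stable A u = stable (ev @^-1: A) (bp u).
Proof.
move=> AB uB; apply/idP/idP => /stableP h.
  by apply/stableP => i; rewrite !inE block_permE // h.
apply: stable_sub => x xA; have [i xi] := enum_valE (subsetP AB _ xA).
by rewrite xi -block_permE //; move: (h i); rewrite !inE -xi xA.
Qed.

Lemma irred_block w : all (stable B) w -> irred B w = irred [set: 'I_#|B|] (map bp w).
Proof.
move=> wB; have stE A : A \subset B -> all (stable A) w = all (stable (ev @^-1: A)) (map bp w).
  move=> AB; rewrite all_map; apply: eq_in_all => r /(allP wB) rB.
  exact: stable_block.
have evK (A' : {set 'I_#|B|}) : ev @^-1: (ev @: A') = A'.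
  apply/setP => i; rewrite inE; apply/imsetP/idP => [[j jA /enum_val_inj ->] //|iA].
  by exists i.
have evS (A' : {set 'I_#|B|}) : ev @: A' \subset B.
  by apply/subsetP => _ /imsetP[i _ ->]; apply: enum_valP.
apply/irredP/irredP => -[B0 Bw h]; split.
- by rewrite -cards_eq0 cardsT card_ord cards_eq0.
- by apply/allP => r _; apply: stableT.
- move=> A' _ A0 A'w; apply/eqP; rewrite -subTset; apply/subsetP => i _.
  rewrite -(evK A') inE (h (ev @: A')) ?enum_valP //; last by rewrite stE // evK.
  by case/set0Pn: A0 => j jA; apply/set0Pn; exists (ev j); apply: imset_f.
- by rewrite -cards_eq0 -[#|B|]card_ord -cardsT cards_eq0.
- by [].
- move=> A AB A0 Aw; apply/eqP; rewrite eqEsubset AB; apply/subsetP => x /enum_valE[i ->].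
  suff : i \in ev @^-1: A by rewrite inE.
  rewrite (h (ev @^-1: A)) ?inE // -?stE //.
  case/set0Pn: A0 => y yA; have [j yj] := enum_valE (subsetP AB _ yA).
  by apply/set0Pn; exists j; rewrite inE -yj.
Qed.

Lemma porbit_block u i : stable B u -> porbit u (ev i) = ev @: porbit (bp u) i.
Proof.
move=> uB.
have E k : (u ^+ k)%g (ev i) = ev ((bp u ^+ k)%g i).
  elim: k => [|k IHk]; first by rewrite !expg0 !perm1.
  by rewrite !expgSr !permM IHk block_permE.
apply/setP => x; apply/porbitP/imsetP => [[k ->]|[j /porbitP[k ->] ->]].
  by exists ((bp u ^+ k)%g i); rewrite ?mem_porbit.
by exists k.
Qed.

Lemma card_cycles_block u : stable B u -> #|porbits (bp u)| = #|cycles_in u B|.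
Proof.
move=> uB; rewrite -(card_imset _ (imset_inj (@enum_val_inj _ (mem B)))).
congr #|pred_of_set _|; apply/setP => C; apply/imsetP/imsetP.
  by case=> _ /imsetP[i _ ->] ->; exists (ev i); rewrite ?enum_valP ?porbit_block.
case=> _ /enum_valE[i ->] ->; exists (porbit (bp u) i); rewrite ?porbit_block //.
exact: imset_f.
Qed.

Lemma pnorm_block u : perm_on B u -> pnorm (bp u) = pnorm u.
Proof.
move=> uB; have st := perm_on_stable uB (subxx _).
rewrite /pnorm card_cycles_block // -[in RHS](restr_id uB) card_porbits_restr // !card_ord.
have := cardsC B; rewrite card_ord.
by have := card_cycles_le u B; lia.
Qed.

Lemma wprod_block w : all (perm_on B) w -> wprod (map bp w) = bp (wprod w).
Proof.
elim: w => [|r w IHw] /=; first by rewrite block_perm1.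
case/andP => rB wB; rewrite IHw // block_permM //.
  exact: (perm_on_stable (wprod_perm_on wB) (subxx _)).
exact: (perm_on_stable rB (subxx _)).
Qed.

Lemma wnorm_block w : all (perm_on B) w -> wnorm (map bp w) = wnorm w.
Proof.
move=> wB; rewrite /wnorm big_map !big_seq; apply: eq_bigr => r /(allP wB).
exact: pnorm_block.
Qed.

Variable K : numFieldType.

Lemma fact_word_block u w : perm_on B u -> all (perm_on B) w ->
  fact_word K u w = fact_word K (bp u) (map bp w).
Proof.
move=> uB wB; rewrite /fact_word wnorm_block // wprod_block //; congr ((nat_of_bool _)%:R * _).
apply/idP/idP => /eqP e; apply/eqP; first by rewrite e.
by apply: block_perm_inj e => //; apply: wprod_perm_on.
Qed.

Lemma trans_word_block u w : perm_on B u -> all (perm_on B) w ->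
  trans_word K B u w = trans_word K [set: 'I_#|B|] (bp u) (map bp w).
Proof.
move=> uB wB; rewrite /trans_word fact_word_block // irred_block //.
by apply: sub_all wB => r rB; apply: perm_on_stable rB (subxx _).
Qed.

Lemma signed_sum_block (F : seq 'S_n -> fps K) (G : seq 'S_#|B| -> fps K) :
  (forall w, all (perm_on B) w -> F w = G (map bp w)) ->
  signed_sum (nontriv B) F = signed_sum (nontriv [set: 'I_#|B|]) G.
Proof.
move=> FG; apply: fps_ext => l; rewrite /signed_sum !fcoefE; apply: eq_bigr => j _.
congr (_ * fcoef _ l).
(* The inverse of [block_perm]; the default value is never taken, by [block_perm_surj]. *)
pose h' (t : 'S_#|B|) := odflt 1%g [pick s | perm_on B s && (bp s == t)].
have h'P t : perm_on B (h' t) /\ bp (h' t) = t.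
  rewrite /h'; case: pickP => [s /andP[sB /eqP] //|h].
  by have [s sB st] := block_perm_surj t; move: (h s); rewrite sB st eqxx.
rewrite [RHS](@wsum_reindex _ _ _ _ (nontriv B) bp h').
- apply: eq_wsum => w wB _; apply: FG; apply: sub_all wB => r /andP[] //.
- move=> r /andP[rB r1]; rewrite /nontriv /=; apply/andP; split.
    by apply/subsetP => x _; rewrite inE.
  by apply: contraNneq r1 => e; apply/eqP/block_perm_inj; rewrite ?perm_on1 ?block_perm1.
- move=> t /andP[_ t1]; have [h1 h2] := h'P t; rewrite /nontriv /= h1 /=.
  by apply: contraNneq t1 => e; rewrite -h2 e block_perm1.
- by move=> t _; have [] := h'P t.
- move=> r /andP[rB _]; have [h1 h2] := h'P (bp r).
  exact: block_perm_inj.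
Qed.

Lemma restr_permT m (u : 'S_m) : restr_perm [set: 'I_m] u = u.
Proof. by apply: restr_id; apply/subsetP => x _; rewrite inE. Qed.

Lemma all_fact_block u : stable B u ->
  all_fact K B u = all_fact K [set: 'I_#|B|] (bp u).
Proof.
move=> uB; rewrite /all_fact uB stableT restr_permT.
rewrite -(block_perm_restr uB); apply: signed_sum_block => w wB.
by apply: fact_word_block => //; apply: restr_perm_on.
Qed.

Lemma conn_fact_block u : stable B u ->
  conn_fact K B u = conn_fact K [set: 'I_#|B|] (bp u).
Proof.
move=> uB; rewrite /conn_fact uB stableT restr_permT.
rewrite -(block_perm_restr uB); apply: signed_sum_block => w wB.
by apply: trans_word_block => //; apply: restr_perm_on.
Qed.

End Transfer.

(** * Words of permutations and the numbers [gamma_count] *)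

Section GammaCount.
Variable m : nat.

Definition fword k (rho : {ffun 'I_k -> 'S_m}) := [seq rho i | i <- enum 'I_k].

Lemma enum_ord0 : enum 'I_0 = [::].
Proof. by apply: size0nil; rewrite size_enum_ord. Qed.

Lemma sum_ffun_word (V : nmodType) k (F : seq 'S_m -> V) :
  \sum_(rho : {ffun 'I_k -> 'S_m}) F (fword rho) = wsum predT k F.
Proof.
elim: k F => [|k IHk] F.
  rewrite (big_pred1 [ffun=> 1%g]) /fword ?enum_ord0 // => rho.
  by rewrite /=; apply/esym/eqP/ffunP => -[].
rewrite /= -(eq_bigr _ (fun r _ => IHk (fun s => F (r :: s)))) pair_big /=.
rewrite (reindex (fun p : 'S_m * {ffun 'I_k -> 'S_m} =>
   [ffun i => oapp p.2 p.1 (unlift ord0 i)])) /=.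
  apply: eq_bigr => -[r rho] _ /=; congr F.
  rewrite /fword enum_ordSl /= ffunE unlift_none /= -map_comp; congr (_ :: _).
  by apply: eq_map => i /=; rewrite ffunE liftK.
exists (fun rho : {ffun 'I_k.+1 -> 'S_m} => (rho ord0, [ffun i => rho (lift ord0 i)])).
  move=> [r rho] _; rewrite ffunE unlift_none /=; congr (_, _).
  by apply/ffunP => i; rewrite !ffunE liftK.
move=> rho _; apply/ffunP => i; rewrite ffunE.
by case: unliftP => [j|] -> /=; rewrite ?ffunE.
Qed.

Lemma wprod_fword k (rho : {ffun 'I_k -> 'S_m}) :
  wprod (fword rho) = (\prod_(i < k) rho (rev_ord i))%g.
Proof.
suff E : forall f : 'I_k -> 'S_m,
    wprod [seq f i | i <- enum 'I_k] = (\prod_(i < k) f (rev_ord i))%g by apply: E.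
elim: k {rho} => [|k IHk] f.
  by rewrite enum_ord0 big_ord0.
rewrite enum_ordSl /= -map_comp (IHk (f \o lift ord0)) big_ord_recr /=.
congr (_ * f _)%g; last by apply: val_inj; rewrite /= subSS subnn.
by apply: eq_bigr => i _ /=; congr f; apply: val_inj; rewrite /= /bump /= add1n subSS subnSK.
Qed.

Lemma wnorm_fword k (rho : {ffun 'I_k -> 'S_m}) :
  wnorm (fword rho) = (\sum_(i < k) perm_norm (rho i))%N.
Proof.
rewrite /wnorm /fword big_map big_enum /=; apply: eq_bigr => i _.
by rewrite /pnorm card_ord.
Qed.

Lemma irred_fword k (rho : {ffun 'I_k -> 'S_m}) :
  irred [set: 'I_m] (fword rho) =
  [transitive <<[set rho i | i : 'I_k]>>, on [set: 'I_m] | 'P]%g.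
Proof.
set G := <<_>>%g.
have stG A : all (stable A) (fword rho) = (G \subset 'N(A | 'P)%g).
  rewrite gen_subG; apply/allP/subsetP => [h r /imsetP[i _ ->]|h r /mapP[i _ ->]].
    by apply: h; apply: map_f; rewrite mem_enum.
  by apply: h; apply: imset_f.
apply/irredP/imsetP => [[/set0Pn[x _] _ h]|[x _ xE]].
  exists x => //; apply/esym/h; rewrite ?subsetT //.
    by apply/set0Pn; exists x; apply: orbit_refl.
  rewrite stG; apply/subsetP => g gG; apply: stable_sub => y /orbitP[g' g'G <-].
  by apply/orbitP; exists (g' * g)%g; rewrite ?groupM //= /aperm permM.
split; first by apply/set0Pn; exists x.
  by apply/allP => r _; apply: stableT.
move=> A _ /set0Pn[y yA]; rewrite stG => GA; apply/eqP; rewrite -subTset; apply/subsetP => t _.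
have : y \in orbit 'P%act G x by rewrite -xE inE.
case/orbitP => g gG gy; have : t \in orbit 'P%act G x by rewrite -xE inE.
case/orbitP => g' g'G <-.
have : (g^-1 * g')%g \in 'N(A | 'P)%g by apply: (subsetP GA); rewrite groupM ?groupV.
move/stableP => /(_ y); rewrite yA permM -gy /= /aperm permK => -> //.
Qed.

Lemma fcoef_conn_factT (K : numFieldType) (u : 'S_m) l :
  fcoef (conn_fact K [set: 'I_m] u) l = (gamma_l l u)%:~R.
Proof.
rewrite /conn_fact stableT restr_permT /gamma_l /conn_fact0 /signed_sum fcoefE rmorph_sum /=.
apply: eq_bigr => k _; rewrite rmorphM /= rmorphXn /= rmorphN1; congr (_ * _).
rewrite fcoef_wsum.
rewrite (@eq_wsum _ _ _ _ _ (fun w => (irred [set: 'I_m] w && (wprod w == u) && (wnorm w == l))%:R));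
  last first.
  move=> w _ _; rewrite /trans_word /fact_word !fcoef_natM fcoefXn [l == _]eq_sym.
  by rewrite -!natrM !mulnb andbA.
pose F (w : seq 'S_m) : K := [&& all (predC1 1%g) w, irred [set: 'I_m] w, wprod w == u &
   wnorm w == l]%:R.
rewrite (@eq_wsum _ _ _ _ _ F); last first.
  move=> w wQ _; rewrite /F -andbA.
  by have -> : all (predC1 1%g) w by apply: sub_all wQ => r /andP[].
rewrite -(@wsum_sub _ _ predT) //; last first.
  move=> w _; apply: contraNeq; rewrite /F; case: (boolP (all (predC1 1%g) w)) => [wQ _|_ /=];
    last by rewrite eqxx.
  apply: sub_all wQ => r r1; apply/andP; split=> //.
  by apply/subsetP => x _; rewrite inE.
rewrite -sum_ffun_word.
rewrite -natr_sum -[RHS]/((gamma_count l k u)%:R); congr _%:R.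
rewrite /gamma_count -sum1_card big_mkcond [RHS]big_mkcond /=; apply: eq_bigr => rho _.
rewrite inE wprod_fword wnorm_fword -irred_fword.
have -> : all (predC1 1%g) (fword rho) = [forall i, rho i != 1%g].
  apply/allP/forallP => [h i|h r /mapP[i _ ->]]; last exact: (h i).
  by apply: h; apply: map_f; rewrite mem_enum.
by case: [forall i, rho i != 1%g]; case: (irred [set: 'I_m] (fword rho));
  case: (_ == u); case: (_ == l).
Qed.

End GammaCount.

Lemma fcoef_conn_fact_gamma (K : numFieldType) n (B : {set 'I_n}) (u : 'S_n) l :
  stable B u -> fcoef (conn_fact K B u) l = (gamma_l l (block_perm B u))%:~R.
Proof. by move=> uB; rewrite conn_fact_block // fcoef_conn_factT. Qed.

(** * The genus expansion of gamma_l *)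

Section GammaGenus.
Variables (K : numFieldType) (m : nat) (nu : 'S_m).
Hypothesis m_gt0 : (0 < m)%N.

Let T0 : [set: 'I_m] != set0.
Proof. by rewrite -cards_eq0 cardsT card_ord -lt0n. Qed.

Lemma ncyclesE : ncycles nu = #|cycles_in nu [set: 'I_m]|.
Proof. by rewrite /ncycles porbitsE. Qed.

Lemma ncycles_gt0 : (0 < ncycles nu)%N.
Proof.
by rewrite /ncycles card_gt0; apply/set0Pn; exists (porbit nu (Ordinal m_gt0)); apply: imset_f.
Qed.

Lemma ncycles_le : (ncycles nu <= m)%N.
Proof. by rewrite /ncycles -[X in (_ <= X)%N]card_ord card_porbits_le. Qed.

Lemma gamma_l_support l : ((l + 2 < m + ncycles nu)%N || odd (l + m + ncycles nu)) ->
  (gamma_l l nu)%:~R = 0 :> K.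
Proof.
move=> h; rewrite -fcoef_conn_factT; apply: conn_fact_support => //; first exact: stableT.
by rewrite cardsT card_ord -ncyclesE.
Qed.

Lemma prod_ncycles_of_length (F : nat -> K) :
  \prod_(1 <= p < m.+1) F p ^+ ncycles_of_length p nu = \prod_(C in porbits nu) F #|C|.
Proof.
have e0 : ncycles_of_length 0 nu = 0%N.
  apply/eqP; rewrite cards_eq0; apply/eqP/setP => C; rewrite !inE.
  apply/negbTE/negP => /andP[/imsetP[x _ ->]].
  by rewrite (negbTE (card_porbit_neq0 _ _)).
have <- : \prod_(0 <= p < m.+1) F p ^+ ncycles_of_length p nu =
    \prod_(1 <= p < m.+1) F p ^+ ncycles_of_length p nu.
  by rewrite big_ltn // e0 expr0 mul1r.
rewrite big_mkord.
rewrite (partition_big (fun C : {set 'I_m} => inord #|C| : 'I_m.+1) xpredT) //=.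
apply: eq_bigr => p _.
rewrite /ncycles_of_length -prodr_const big_mkcond [RHS]big_mkcond /=; apply: eq_bigr => C _.
rewrite !inE; case: (C \in porbits nu) => //=.
have Cm : (#|C| < m.+1)%N by rewrite ltnS -[X in (_ <= X)%N]card_ord max_card.
have -> : (#|C| == p) = ((inord #|C| : 'I_m.+1) == p).
  by rewrite -val_eqE /= inordK.
by case: eqP => // <-; rewrite inordK.
Qed.

(** For a cycle of length p, [wcbin] gives p C(2p, p) = (1/p) C(2p-2, p-1) 2p(2p-1). The signs match
    because the numbers p-1 add up to m - #(nu). *)
Lemma gamma_l_lead :
  (gamma_l (m + ncycles nu - 2) nu)%:~R = gamma_lead K nu.
Proof.
have r0 := ncycles_gt0; have rm := ncycles_le.
rewrite -fcoef_conn_factT conn_fact_lead ?stableT //; last first.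
  by rewrite cardsT card_ord -ncyclesE subnK //; lia.
rewrite /planar_lead cardsT card_ord -ncyclesE.
rewrite /gamma_lead /Moebius_perm !prod_ncycles_of_length.
have -> : (3 * m - perm_norm nu - 3 = 2 * m + ncycles nu - 3)%N.
  by rewrite /perm_norm; lia.
rewrite mulrA [RHS]mulrAC -big_split /=; congr (_ * _).
have e : (\sum_(C in porbits nu) (#|C| - 1) + ncycles nu = m)%N.
  rewrite /ncycles -sum1_card -big_split /= -[RHS]card_ord -cardsT.
  rewrite -(card_cycles_in (stableT nu)) -porbitsE; apply: eq_bigr => C.
  by case/imsetP => x _ ->; rewrite subnK // lt0n card_porbit_neq0.
have -> : (m + ncycles nu = \sum_(C in porbits nu) (#|C| - 1) + 2 * ncycles nu)%N by lia.
rewrite exprD exprM sqrrN !expr1n mulr1 expr_sum.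
rewrite -porbitsE -big_split /=; apply: eq_bigr => C /imsetP[x _ ->].
have [q ->] : exists q, #|porbit nu x| = q.+1.
  by exists #|porbit nu x|.-1; rewrite prednK // lt0n card_porbit_neq0.
rewrite /wcbin cbinS subn1 /= /cbin (_ : 2 * q.+1 - 2 = q.*2)%N; last by lia.
rewrite (_ : 2 * q.+1 * (2 * q.+1 - 1) = q.+1 * (4 * q + 2))%N; last by lia.
have nz : q.+1%:R != 0 :> K by rewrite pnatr_eq0.
by rewrite natrM; move: q.+1%:R nz => p nz; field.
Qed.

End GammaGenus.

(** * Sums over set partitions *)

Section PartitionSum.
Variables (T : finType) (V : comNzRingType).
Implicit Types (A B E S : {set T}) (P Q : {set {set T}}) (f : {set T} -> V) (z : T).

Definition part_sum f B : V := \sum_(P | partition P B) \prod_(S in P) f S.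

Lemma part_sum0 f : part_sum f set0 = 1.
Proof.
rewrite /part_sum (big_pred1 set0) => [|P]; last by rewrite partition_set0.
by rewrite big_set0.
Qed.

(** S is the block of z. The relation has the shape of [all_fact_split], which is how the two are
    compared. *)
Lemma part_sum_rec f B z : z \in B ->
  part_sum f B = \sum_(S : {set T} | (z \in S) && (S \subset B)) f S * part_sum f (B :\: S).
Proof.
move=> zB; rewrite /part_sum.
rewrite (partition_big (fun P => pblock P z) (fun S => (z \in S) && (S \subset B))); last first.
  move=> P pP; have zP : z \in cover P by rewrite (cover_partition pP).
  by rewrite mem_pblock zP (partitionS pP) // pblock_mem.
apply: eq_bigr => S /andP[zS SB]; rewrite mulr_sumr.
rewrite (reindex_onto (fun P => S |: P) (fun P => P :\ S)) /=; last first.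
  move=> P /andP[pP /eqP <-]; rewrite setD1K //.
  by apply: pblock_mem; rewrite (cover_partition pP).
have disj P : partition P (B :\: S) -> S \notin P.
  move=> pP; apply/negP => SP; have := partitionS pP SP.
  by move/subsetP => /(_ z zS); rewrite inE zS.
apply: eq_big => [P|P /andP[/andP[pP _] /eqP e]].
  apply/idP/idP => [/andP[/andP[pP _] /eqP e]|pP].
    rewrite -e; apply: partitionD1 => //; exact: setU11.
  have pSP : partition (S |: P) B.
    rewrite -[B](setID B S) (setIidPr SB); apply: partitionU1 => //.
      by apply/set0Pn; exists z.
    by rewrite -setI_eq0 setIDA setD_eq0 subsetIl.
  rewrite pSP /= (def_pblock (partition_trivIset pSP) (setU11 S P) zS) eqxx /=.
  by rewrite setU1K // disj.
rewrite big_setU1 //=; rewrite -e !inE eqxx //.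
Qed.

Lemma eq_part_sum f g B : (forall S, S \subset B -> f S = g S) ->
  part_sum f B = part_sum g B.
Proof.
move=> fg; apply: eq_bigr => P pP; apply: eq_bigr => S SP.
by apply: fg; apply: partitionS pP SP.
Qed.

(** A partition of nonzero weight has no block meeting both A and E, hence it is a partition of A
    together with one of E. The induction removes the block of a point of A. *)
Lemma part_sumU f A E : [disjoint A & E] ->
  (forall S, ~~ [disjoint S & A] -> ~~ [disjoint S & E] -> f S = 0) ->
  part_sum f (A :|: E) = part_sum f A * part_sum f E.
Proof.
have [k] := ubnP #|A|; elim: k A => // k IHk A Ak dAE f0.
have [->|/set0Pn[z zA]] := eqVneq A set0; first by rewrite set0U part_sum0 mul1r.
rewrite (@part_sum_rec f (A :|: E) z) ?inE ?zA // (part_sum_rec f zA) mulr_suml.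
rewrite (bigID (fun S : {set T} => S \subset A)) /= [X in _ + X]big1 ?addr0.
  apply: eq_big => [S|S /andP[/andP[zS SAE] SA]].
    rewrite -andbA; congr (_ && _); apply/andP/idP => [[] //|SA]; split=> //.
    exact: subset_trans SA (subsetUl _ _).
  rewrite setDUl (setDidPl (_ : [disjoint E & S])); last first.
    by rewrite disjoint_sym; apply: disjointWl SA dAE.
  rewrite IHk ?mulrA //.
  - apply: leq_trans (_ : #|A| <= k)%N; last by rewrite -ltnS.
    apply: proper_card; rewrite properEneq subsetDl andbT.
    by apply: contraTneq zA => <-; rewrite inE zS.
  - by apply: disjointWl dAE; apply: subsetDl.
  move=> S' h1 h2; apply: f0 => //; apply: contra h1; apply: disjointWr.
  exact: subsetDl.
move=> S /andP[/andP[zS SAE] SA]; rewrite f0 ?mul0r //.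
  by apply/pred0Pn; exists z; rewrite /= zS.
have /subsetPn[y yS yA] := SA; apply/pred0Pn; exists y; rewrite /= yS /=.
by have := subsetP SAE _ yS; rewrite inE (negbTE yA).
Qed.

(** The weight g is f on sets inside a block of P and 0 elsewhere. It suppresses the partitions that
    do not refine P, and it lets [part_sumU] add one block of P at a time. *)
Lemma prod_part_sum f P : set_partition P ->
  \prod_(B in P) part_sum f B =
  \sum_(Q | set_partition Q && refines Q P) \prod_(S in Q) f S.
Proof.
move=> pP; pose g S : V := if [exists B in P, S \subset B] then f S else 0.
have gE B : B \in P -> part_sum f B = part_sum g B.
  move=> BP; apply: eq_part_sum => S SB; rewrite /g ifT //.
  by apply/existsP; exists B; rewrite BP.
rewrite (eq_bigr _ gE).
have -> : \sum_(Q | set_partition Q && refines Q P) \prod_(S in Q) f S = part_sum g [set: T].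
  rewrite /part_sum big_mkcondr /=; apply: eq_bigr => Q pQ; case: ifP => h.
    apply: eq_bigr => S SQ; rewrite /g ifT //.
    by move/forall_inP: h; apply.
  have /forall_inPn[S SQ nS] := negbT h.
  by rewrite (bigD1 S) //= /g (negbTE nS) mul0r.
have covP := cover_partition pP; have triv := partition_trivIset pP.
rewrite -covP.
have : P \subset P by []; have [k] := ubnP #|P|; move: {1 2 4 5}P => Q.
elim: k Q => // k IHk Q Qk QP.
have [->|/set0Pn[B BQ]] := eqVneq Q set0.
  by rewrite big_set0 /cover big_set0 part_sum0.
have Q'k : (#|Q :\ B| < k)%N by move: Qk; rewrite (cardsD1 B) BQ.
have Q'P : Q :\ B \subset P by apply: subset_trans (subsetDl _ _) QP.
rewrite (big_setD1 B) //= (IHk _ Q'k Q'P).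
have trQ : trivIset Q by apply: trivIsetS triv.
have covQ : cover Q = B :|: cover (Q :\ B).
  by rewrite -{1}(setD1K BQ) /cover big_setU1 //= !inE eqxx.
have dB : [disjoint B & cover (Q :\ B)].
  by rewrite coverD1 // -setI_eq0 setIDA setD_eq0 subsetIl.
rewrite covQ part_sumU // => S SB SE; rewrite /g; case: ifP => // /exists_inP[B' B'P SB'].
exfalso; have BP := subsetP QP _ BQ.
have eB : B' = B.
  apply/eqP; apply: contraNT SB => ne.
  by apply: disjointWl SB' _; apply: (trivIsetP triv).
case/negP: SE; apply: disjointWl dB; by rewrite -eB.
Qed.

End PartitionSum.

(** * Maps constant on blocks, counted by their kernels *)

Section Colourings.
Variables (T X : finType).
Implicit Types (P Q : {set {set T}}) (g : {ffun T -> X}).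

Definition const_on P g := [forall x, [forall y in pblock P x, g y == g x]].

Lemma const_onP P g : reflect (forall x y, y \in pblock P x -> g y = g x) (const_on P g).
Proof.
apply: (iffP forallP) => [h x y yx|h x].
  by apply/eqP; move/forall_inP: (h x); apply.
by apply/forall_inP => y yx; apply/eqP/h.
Qed.

Lemma mem_kernel g x y : (y \in pblock (preim_partition g [set: T]) x) = (g x == g y).
Proof.
rewrite pblock_equivalence_partition ?inE // => a b c _ _ _.
by split=> // /eqP ->.
Qed.

Section OnBlocks.
Variable P : {set {set T}}.
Hypothesis pP : set_partition P.

Let covP : cover P = [set: T]. Proof. exact: cover_partition pP. Qed.
Let trivP : trivIset P. Proof. exact: partition_trivIset pP. Qed.

Lemma pblock_in x : pblock P x \in P.
Proof. by rewrite pblock_mem // covP. Qed.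

Definition block_of x : {B : {set T} | B \in P} := exist _ (pblock P x) (pblock_in x).
Definition pull (h : {ffun {B : {set T} | B \in P} -> X}) : {ffun T -> X} :=
  [ffun x => h (block_of x)].

Lemma block_of_surj B : exists x, block_of x = B.
Proof.
case: B => B BP; have /set0Pn[x xB] := partition_neq0 pP BP.
by exists x; apply: val_inj; rewrite /= (def_pblock trivP BP xB).
Qed.

Lemma block_of_eq x y : (block_of x == block_of y) = (y \in pblock P x).
Proof. by rewrite -val_eqE /= eq_pblock // covP. Qed.

Lemma pull_inj : injective pull.
Proof.
move=> h h' /ffunP e; apply/ffunP => B; have [x <-] := block_of_surj B.
by have := e x; rewrite !ffunE.
Qed.

Lemma pull_codom g : (forall x y, y \in pblock P x -> g y = g x) -> exists h, pull h = g.
Proof.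
move=> gP; have sx B : {x | block_of x == B}.
  by apply: sigW; have [x <-] := block_of_surj B; exists x.
exists [ffun B => g (sval (sx B))]; apply/ffunP => x; rewrite !ffunE.
case: (sx _) => y /= ; rewrite block_of_eq => xy.
by rewrite (gP y x xy).
Qed.

Lemma card_const_on : #|[set g | const_on P g]| = (#|X| ^ #|P|)%N.
Proof.
have -> : #|P| = #|{: {B : {set T} | B \in P}}| by rewrite card_sig; apply: eq_card.
rewrite -card_ffun -[RHS](card_imset _ pull_inj).
congr #|pred_of_set _|.
apply/setP => g; rewrite inE; apply/const_onP/imsetP => [/pull_codom[h hg]|[h _ ->] x y yx].
  by exists h.
by rewrite !ffunE (_ : block_of y = block_of x) //; apply/esym/eqP; rewrite block_of_eq.
Qed.

Lemma card_kernel :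
  #|[set g : {ffun T -> X} | preim_partition g [set: T] == P]| = (#|X| ^_ #|P|)%N.
Proof.
have -> : #|P| = #|{: {B : {set T} | B \in P}}| by rewrite card_sig; apply: eq_card.
rewrite -card_inj_ffuns -(card_imset _ pull_inj).
congr #|pred_of_set _|.
apply/setP => g; rewrite inE; apply/eqP/imsetP => [gP|[h]].
  have [x y|h hg] := @pull_codom g; first by rewrite -gP mem_kernel => /eqP.
  exists h => //; rewrite inE; apply/injectiveP => B B'.
  have [x <-] := block_of_surj B; have [y <-] := block_of_surj B' => e.
  by apply/eqP; rewrite block_of_eq -gP mem_kernel -hg !ffunE e.
rewrite inE => /injectiveP hinj ->.
rewrite -(equivalence_partition_pblock (preim_partitionP (pull h) [set: T])).
rewrite -[RHS](equivalence_partition_pblock pP).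
apply: eq_imset => x; apply/setP => y; rewrite !inE mem_kernel !ffunE /= -block_of_eq.
by apply/eqP/eqP => [/hinj|->].
Qed.

End OnBlocks.

Lemma set_partition_kernel g : set_partition (preim_partition g [set: T]).
Proof. exact: preim_partitionP. Qed.

Lemma refines_kernel P g : set_partition P ->
  refines P (preim_partition g [set: T]) = const_on P g.
Proof.
move=> pP.
apply/refinesP/const_onP => // [|h x y yx|h x y yx].
- exact: set_partition_kernel.
- by have := h x y yx; rewrite mem_kernel => /eqP.
by rewrite mem_kernel (h x y yx).
Qed.

(** The maps constant on the blocks of P are sorted by their kernel Q; a map with kernel Q is an
    injective map on the blocks of Q. *)
Lemma sum_ffact_refines P : set_partition P ->
  (\sum_(Q | set_partition Q && refines P Q) #|X| ^_ #|Q|)%N = (#|X| ^ #|P|)%N.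
Proof.
move=> pP; rewrite -(card_const_on pP) -sum1_card.
rewrite (partition_big (fun g => preim_partition g [set: T])
   (fun Q => set_partition Q && refines P Q)) /=; last first.
  by move=> g; rewrite inE => gP; rewrite set_partition_kernel refines_kernel.
apply: eq_bigr => Q /andP[pQ PQ]; rewrite -(card_kernel pQ) -sum1_card.
apply: eq_bigl => g; rewrite !inE; apply/idP/andP => [/eqP e|[]//].
by rewrite -refines_kernel // e eqxx.
Qed.

End Colourings.

(** * The Moebius sum over coarser partitions *)

Section MoebiusSum.
Variables (K : numFieldType) (T : finType).
Implicit Types (P Q : {set {set T}}).

Definition ffact_poly k : {poly K} := \prod_(i < k) ('X - i%:R%:P).

Lemma ffact_polyE k q : (ffact_poly k).[q%:R] = (q ^_ k)%:R.
Proof.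
rewrite /ffact_poly horner_prod; elim: k => [|k IHk]; first by rewrite big_ord0 ffactn0.
rewrite big_ord_recr /= IHk !hornerE ffactnSr natrM.
have [qk|kq] := ltnP q k; first by rewrite ffact_small ?mul0r.
by rewrite natrB.
Qed.

Lemma coef1_ffact_poly k : (ffact_poly k.+1)`_1 = (-1) ^+ k * k`!%:R.
Proof.
rewrite /ffact_poly big_ord_recl /= subr0 coefXM /= -horner_coef0 horner_prod.
elim: k => [|k IHk]; first by rewrite big_ord0 mul1r.
rewrite big_ord_recr /= IHk !hornerE /bump /= add1n factS natrM exprS.
by ring.
Qed.

(** [sum_ffact_refines] expands x^|P| in falling factorials, first at all natural x and hence as
    polynomials. The coefficient of x in the falling factorial of length |Q| is (-1)^(|Q|-1)
    (|Q|-1)!. *)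
Lemma moebius_sum P : set_partition P -> P != set0 ->
  \sum_(Q | set_partition Q && refines P Q) (-1) ^+ (#|Q| - 1) * (#|Q| - 1)`!%:R =
  (#|P| == 1%N)%:R :> K.
Proof.
move=> pP P0.
have E : \sum_(Q | set_partition Q && refines P Q) ffact_poly #|Q| = 'X^#|P|.
  apply: poly_eq_nat => k; rewrite hornerXn horner_sum.
  have := sum_ffact_refines 'I_k pP; rewrite card_ord => h.
  by rewrite -natrX -h natr_sum; apply: eq_bigr => Q _; rewrite ffact_polyE.
have := congr1 (fun p : {poly K} => p`_1) E; rewrite coef_sum coefXn eq_sym => <-.
apply: eq_bigr => Q /andP[pQ PQ].
have Q0 : (0 < #|Q|)%N.
  case/set0Pn: P0 => B BP; have /exists_inP[C CQ _] := forall_inP PQ B BP.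
  by rewrite card_gt0; apply/set0Pn; exists C.
by rewrite -{3}(prednK Q0) coef1_ffact_poly subn1.
Qed.

End MoebiusSum.

(** * The rank inequality for joins *)

Section Rank.
Variable T : finType.
Implicit Types (P Q S : {set {set T}}).

(* Functions into F_2 constant on the blocks: sums of P- and Q-functions are constant
   on the blocks of S, and each fibre of the sum map is a torsor under the functions
   constant on the blocks of the join. *)
Lemma partition_join_rank P Q S : set_partition P -> set_partition Q -> set_partition S ->
  refines S P -> refines S Q -> (#|P| + #|Q| <= #|S| + #|partition_join P Q|)%N.
Proof.
move=> pP pQ pS SP SQ; have [pJ PJ QJ _] := partition_joinP pP pQ.
pose C R := [set g : {ffun T -> bool} | const_on R g].
have cC R : set_partition R -> #|C R| = (2 ^ #|R|)%N.
  by move=> pR; rewrite (card_const_on _ pR) card_bool.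
rewrite -(leq_exp2l _ _ (ltnSn 1)) !expnD -!cC // -cardsX.
pose ad (g h : {ffun T -> bool}) : {ffun T -> bool} := [ffun x => g x (+) h x].
pose f (p : {ffun T -> bool} * {ffun T -> bool}) := ad p.1 p.2.
have fS p : p \in setX (C P) (C Q) -> f p \in C S.
  case: p => g h; rewrite !inE /= => /andP[/const_onP gP /const_onP hQ].
  apply/const_onP => x y yx; rewrite !ffunE (gP x y) ?(hQ x y) //.
    by move/refinesP: SQ; apply.
  by move/refinesP: SP; apply.
rewrite -sum1_card (partition_big f (mem (C S))) //= -sum_nat_const.
apply: leq_sum => s sS; rewrite sum1_card.
case: (pickP [pred p | (p \in setX (C P) (C Q)) && (f p == s)]) => [[g0 h0] /= |h]; last first.
  by rewrite eq_card0 // => p; apply: (h p).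
rewrite inE /= => /andP[/andP[]]; rewrite !inE => /const_onP g0P /const_onP h0Q /eqP s0.
pose t (p : {ffun T -> bool} * {ffun T -> bool}) := ad p.1 g0.
rewrite -(card_in_imset (f := t)); last first.
  move=> [g h] [g' h']; rewrite !unfold_in /= => /andP[_ /eqP e1] /andP[_ /eqP e2] /ffunP e.
  have eg : g = g'.
    by apply/ffunP => x; have := e x; rewrite !ffunE /=; case: (g x); case: (g' x); case: (g0 x).
  congr (_, _) => //; apply/ffunP => x.
  have := congr1 (fun k : {ffun T -> bool} => k x) e1.
  have := congr1 (fun k : {ffun T -> bool} => k x) e2.
  by rewrite !ffunE /= eg; case: (g' x); case: (h x); case: (h' x); case: (s x).
apply: subset_leq_card; apply/subsetP => _ /imsetP[[g h] + ->].
rewrite unfold_in => /andP[]; rewrite in_setX !inE /= => /andP[/const_onP gP /const_onP hQ] /eqP e1.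
have tE x : ad g g0 x = ad h h0 x.
  have := congr1 (fun k : {ffun T -> bool} => k x) e1.
  have := congr1 (fun k : {ffun T -> bool} => k x) s0.
  by rewrite !ffunE /=; case: (g x); case: (g0 x); case: (h x); case: (h0 x); case: (s x).
suff : t (g, h) \in C (partition_join P Q) by [].
rewrite inE -refines_kernel //.
have [_ _ _ jmin] := partition_joinP pP pQ.
apply: jmin; first exact: set_partition_kernel.
  by rewrite refines_kernel //; apply/const_onP => x y yx; rewrite !ffunE (gP _ _ yx) (g0P _ _ yx).
rewrite refines_kernel //; apply/const_onP => x y yx; rewrite /t /= !tE !ffunE.
by rewrite (hQ _ _ yx) (h0Q _ _ yx).
Qed.

End Rank.

(** Both sides are images of integers, so the identity passes from the rationals to every
    commutative ring, in particular to power series. *)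
Lemma moebius_sum_ring (V : comNzRingType) (T : finType) (P : {set {set T}}) :
  set_partition P -> P != set0 ->
  \sum_(Q | set_partition Q && refines P Q) (-1) ^+ (#|Q| - 1) * (#|Q| - 1)`!%:R =
  (#|P| == 1%N)%:R :> V.
Proof.
move=> pP P0; have := moebius_sum rat pP P0.
pose s : int := \sum_(Q | set_partition Q && refines P Q)
  (-1) ^+ (#|Q| - 1) * (#|Q| - 1)`!%:R.
have E (W : comNzRingType) : \sum_(Q | set_partition Q && refines P Q)
    (-1) ^+ (#|Q| - 1) * (#|Q| - 1)`!%:R = s%:~R :> W.
  rewrite rmorph_sum /=; apply: eq_bigr => Q _.
  by rewrite rmorphM /= rmorphXn /= rmorphN1 rmorph_nat.
rewrite (E rat) => h; rewrite (E V).
suff -> : s = (#|P| == 1%N)%:R by rewrite rmorph_nat.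
by apply/eqP; rewrite -(eqr_int rat) h rmorph_nat.
Qed.

(** The orbit decomposition is iterated: both sides satisfy the same recursion on the part of a
    point z. *)
Lemma all_fact_part_sum (K : numFieldType) (T : finType) (B : {set T}) (u : {perm T}) :
  all_fact K B u = part_sum (fun S => conn_fact K S u) B.
Proof.
have [k] := ubnP #|B|; elim: k B => // k IHk B Bk.
have [->|/set0Pn[z zB]] := eqVneq B set0; first by rewrite all_fact_set0 part_sum0.
rewrite (all_fact_split K u zB) (part_sum_rec _ zB); apply: eq_bigr => S /andP[zS SB].
rewrite IHk //; apply: (@leq_trans #|B|); last by rewrite -ltnS.
apply: proper_card; rewrite properEneq subsetDl andbT.
by apply: contraTneq zB => <-; rewrite inE zS.
Qed.

(** * Refinement, cycle partitions and iterated joins *)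

Section Refinement.
Variable T : finType.
Implicit Types (P Q : {set {set T}}) (u : {perm T}).

Lemma set_partition_porbits u : set_partition (porbits u).
Proof.
apply/and3P; split.
- by rewrite porbitsE cover_cycles_in // stableT.
- apply/trivIsetP => _ _ /imsetP[x _ ->] /imsetP[y _ ->] ne; apply/pred0P => w /=.
  apply/negbTE/negP => /andP[]; rewrite -!eq_porbit_mem => /eqP e1 /eqP e2.
  by rewrite -e1 e2 eqxx in ne.
- by apply/negP => /imsetP[x _ /setP/(_ x)]; rewrite inE porbit_id.
Qed.

Lemma refines_porbits u P : set_partition P ->
  reflect (forall B, B \in P -> stable B u) (refines (porbits u) P).
Proof.
move=> pP; have triv := partition_trivIset pP; apply: (iffP forall_inP) => h.
  move=> B BP; apply: stable_sub => x xB.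
  have /exists_inP[B' B'P sub] := h (porbit u x) (imset_f _ isT).
  have xB' : x \in B' by apply: (subsetP sub); apply: porbit_id.
  rewrite -(def_pblock triv BP xB) (def_pblock triv B'P xB').
  by apply: (subsetP sub); apply/porbitP; exists 1%N; rewrite expg1.
move=> _ /imsetP[x _ ->]; apply/exists_inP.
have xP : x \in cover P by rewrite (cover_partition pP) inE.
exists (pblock P x); first exact: pblock_mem.
by apply: porbit_sub; rewrite ?mem_pblock // h // pblock_mem.
Qed.

Lemma refines_card P Q : set_partition P -> set_partition Q -> refines P Q -> (#|Q| <= #|P|)%N.
Proof.
move=> pP pQ PQ; rewrite -(leq_exp2l _ _ (ltnSn 1)) -[2%N]card_bool.
rewrite -(card_const_on bool pP) -(card_const_on bool pQ); apply: subset_leq_card.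
apply/subsetP => g; rewrite !inE => /const_onP gQ; apply/const_onP => x y yx.
by apply: gQ; move/refinesP: PQ; apply.
Qed.

Lemma refines_trans P Q S : set_partition P -> set_partition Q -> set_partition S ->
  refines P Q -> refines Q S -> refines P S.
Proof.
move=> pP pQ pS /refinesP PQ /refinesP QS; apply/refinesP => // x y yx.
by apply: QS => //; apply: PQ.
Qed.

Lemma set_partition_bottom : set_partition (@bottom_partition T).
Proof.
apply/and3P; split.
- apply/eqP/setP => x; rewrite inE; apply/bigcupP; exists [set x]; rewrite ?set11 //.
  exact: imset_f.
- apply/trivIsetP => _ _ /imsetP[x _ ->] /imsetP[y _ ->] ne.
  rewrite disjoints1 inE; apply: contra ne => /eqP -> //.
- by apply/negP => /imsetP[x _ /setP/(_ x)]; rewrite !inE eqxx.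
Qed.

Lemma refines_bottom P : set_partition P -> refines (@bottom_partition T) P.
Proof.
move=> pP; apply/forall_inP => _ /imsetP[x _ ->]; apply/exists_inP.
have xP : x \in cover P by rewrite (cover_partition pP) inE.
by exists (pblock P x); rewrite ?pblock_mem // sub1set mem_pblock.
Qed.

Lemma refines_join P Q S : set_partition P -> set_partition Q -> set_partition S ->
  refines (partition_join P Q) S = refines P S && refines Q S.
Proof.
move=> pP pQ pS; have [pJ PJ QJ jmin] := partition_joinP pP pQ.
apply/idP/andP => [JS|[]]; last exact: jmin.
by split; apply: refines_trans JS.
Qed.

Lemma big_joinP (I : finType) (pi : I -> {set {set T}}) (r : seq I) :
  (forall i, set_partition (pi i)) ->
  set_partition (\big[@partition_join T/@bottom_partition T]_(i <- r) pi i) /\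
  forall S, set_partition S ->
    refines (\big[@partition_join T/@bottom_partition T]_(i <- r) pi i) S =
    all (fun i => refines (pi i) S) r.
Proof.
move=> ppi; elim: r => [|i r [IH1 IH2]].
  by rewrite big_nil; split=> [|S pS]; [exact: set_partition_bottom|rewrite refines_bottom].
rewrite big_cons; split=> [|S pS] /=.
  by have [] := partition_joinP (ppi i) IH1.
by rewrite refines_join // IH2.
Qed.

Lemma one_block_card P : set_partition P -> (P == @one_block T) = (#|P| == 1%N).
Proof.
move=> pP; apply/eqP/idP => [->|/cards1P[B e]]; first by rewrite cards1.
by rewrite e /one_block -(cover_partition pP) e cover1.
Qed.

Lemma card_porbits_sum u P : set_partition P -> refines (porbits u) P ->
  #|porbits u| = (\sum_(B in P) #|cycles_in u B|)%N.
Proof.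
move=> pP /refines_porbits-/(_ pP) stP; have triv := partition_trivIset pP.
rewrite porbitsE -(cover_partition pP).
have : P \subset P by []; have [k] := ubnP #|P|; move: {1 2 4 5}P => Q.
elim: k Q => // k IHk Q Qk QP.
have [->|/set0Pn[B BQ]] := eqVneq Q set0.
  by rewrite big_set0 /cover big_set0 /cycles_in imset0 cards0.
have Q'k : (#|Q :\ B| < k)%N by move: Qk; rewrite (cardsD1 B) BQ.
have Q'P : Q :\ B \subset P by apply: subset_trans (subsetDl _ _) QP.
rewrite (big_setD1 B) //= -(IHk _ Q'k Q'P) coverD1 //; last exact: trivIsetS triv.
rewrite -card_cycles_split //; last exact: bigcup_sup.
by apply: stP; apply: (subsetP QP).
Qed.

End Refinement.

(** * The cumulant as a power series *)

Section Cumulants.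
Variables (K : numFieldType) (n D : nat) (n_gt0 : (0 < n)%N).
Variables (sigma tau : 'I_D -> 'S_n).
Implicit Types (P Q : {set {set 'I_n}}) (pi : {ffun 'I_D -> {set {set 'I_n}}}).

Local Notation nu := (quotient_perm sigma tau).
Local Notation Pi := (joint_orbits sigma tau).

Lemma set_partition_joint : set_partition Pi.
Proof.
rewrite /set_partition /joint_orbits; apply: orbit_partition.
by apply/subsetP => g _; apply: stableT.
Qed.

Lemma joint_stable P B c : set_partition P -> refines Pi P -> B \in P ->
  stable B (sigma c) /\ stable B (tau c).
Proof.
move=> pP PiP BP; have triv := partition_trivIset pP.
set G := <<[set sigma c | c : 'I_D] :|: [set tau c | c : 'I_D]>>%g.
have st g : g \in G -> stable B g.
  move=> gG; apply: stable_sub => x xB.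
  have /exists_inP[B' B'P sub] : [exists B' in P, orbit 'P%act G x \subset B'].
    by apply: (forall_inP PiP); apply: imset_f.
  have xB' : x \in B' by apply: (subsetP sub); apply: orbit_refl.
  rewrite -(def_pblock triv BP xB) (def_pblock triv B'P xB').
  by apply: (subsetP sub); apply: mem_orbit.
by split; apply: st; apply: mem_gen; rewrite inE imset_f ?orbT.
Qed.

Lemma quotient_stable P B c : set_partition P -> refines Pi P -> B \in P ->
  stable B (nu c).
Proof.
by move=> pP PiP BP; have [h1 h2] := joint_stable c pP PiP BP; apply/stableM/h1/stableV.
Qed.

Lemma porbits_refines_joint c : refines (porbits (nu c)) Pi.
Proof.
apply/refines_porbits => [|B BP]; first exact: set_partition_joint.
apply: quotient_stable BP; first exact: set_partition_joint.
by apply/refinesP; rewrite ?set_partition_joint.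
Qed.

Lemma set_partition_neq0 P : set_partition P -> P != set0.
Proof.
move=> pP; apply/set0Pn; exists (pblock P (Ordinal n_gt0)); apply: pblock_mem.
by rewrite (cover_partition pP) inE.
Qed.

Definition full_join pi := partition_join Pi
  (\big[@partition_join _/@bottom_partition _]_(c < D) pi c).

Lemma full_joinP pi : (forall c, set_partition (pi c)) ->
  set_partition (full_join pi) /\ forall S, set_partition S ->
    refines (full_join pi) S = refines Pi S && [forall c, refines (pi c) S].
Proof.
move=> ppi; have [pb bE] := big_joinP (index_enum 'I_D) ppi.
split=> [|S pS]; first by have [] := partition_joinP set_partition_joint pb.
rewrite refines_join ?set_partition_joint // bE //; congr (_ && _).
apply/allP/forallP => [h c|h c _ //]; exact/h/mem_index_enum.
Qed.

Definition conn_prod pi : fps K :=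
  \prod_(c < D) \prod_(S in pi c) conn_fact K S (nu c).

(** The expansion of N^(nD) W_C in x = 1/N, as [asym_W_C] shows. *)
Definition cumulant_series : fps K :=
  \sum_(P | set_partition P) (-1) ^+ (#|P| - 1) * ((#|P| - 1)`!)%:R *
    ((refines Pi P)%:R * \prod_(B in P) \prod_(c < D) all_fact K B (nu c)).

Lemma cumulant_seriesE :
  cumulant_series = \sum_(pi | admissible sigma tau pi) conn_prod pi.
Proof.
have E P : set_partition P -> \prod_(B in P) \prod_(c < D) all_fact K B (nu c) =
   \sum_(pi : {ffun 'I_D -> {set {set 'I_n}}}) if [forall c, set_partition (pi c) && refines (pi c) P]
      then conn_prod pi else 0.
  move=> pP; rewrite exchange_big /=.
  under eq_bigr => c _.
    under eq_bigr => B _ do rewrite all_fact_part_sum.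
    rewrite prod_part_sum // big_mkcond; over.
  rewrite bigA_distr_bigA; apply: eq_bigr => pi _; case: ifP => [/forallP h|/negbT].
    by apply: eq_bigr => c _; rewrite h.
  by rewrite negb_forall => /existsP[c hc]; rewrite (bigD1 c) //= (negbTE hc) mul0r.
rewrite /cumulant_series.
under eq_bigr => P pP do rewrite E // mulr_sumr mulr_sumr.
rewrite exchange_big /= [RHS]big_mkcond /=; apply: eq_bigr => pi _.
have [/forallP ppi|npi] := boolP [forall c, set_partition (pi c)]; last first.
  rewrite big1 => [|P _].
    case: ifP => // /andP[/forallP h _]; case/negP: npi; apply/forallP => c.
    by have /andP[] := h c.
  rewrite ifF ?mulr0 //; apply: contraNF npi => /forallP h; apply/forallP => c.
  by have /andP[] := h c.
have [pJ JE] := full_joinP ppi.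
transitivity ((#|full_join pi| == 1%N)%:R * conn_prod pi).
  rewrite -(moebius_sum_ring (fps K) pJ (set_partition_neq0 pJ)) mulr_suml.
  rewrite [RHS]big_mkcondr /=; apply: eq_bigr => P pP.
  rewrite JE //.
  have -> : [forall c, set_partition (pi c) && refines (pi c) P] = [forall c, refines (pi c) P].
    by apply: eq_forallb => c; rewrite ppi.
  case: (refines Pi P); last by rewrite mul0r mulr0.
  by rewrite mul1r /=; case: ifP => _; rewrite ?mulr0.
rewrite /admissible -/(full_join pi) one_block_card //.
case: (boolP [forall c, _]) => [_|]; first by case: eqP; rewrite ?mul1r ?mul0r.
rewrite negb_forall => /existsP[c]; rewrite ppi /= => nref.
rewrite /= /conn_prod (bigD1 c) //=.
have [B BP nB] : exists2 B, B \in pi c & ~~ stable B (nu c).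
  apply/exists_inP; rewrite -negb_forall_in; apply: contra nref => /forall_inP h.
  by apply/refines_porbits.
by rewrite (bigD1 B) //= conn_fact_unstable // !mul0r mulr0.
Qed.

Lemma admissibleP pi : admissible sigma tau pi ->
  [/\ forall c, set_partition (pi c), forall c, refines (porbits (nu c)) (pi c),
      forall c S, S \in pi c -> stable S (nu c), forall c S, S \in pi c -> (0 < #|S|)%N &
      #|full_join pi| = 1%N].
Proof.
case/andP=> /forallP h /eqP J1.
have ppi c : set_partition (pi c) by have /andP[] := h c.
have rpi c : refines (porbits (nu c)) (pi c) by have /andP[] := h c.
split=> //.
- by move=> c S; move/refines_porbits: (rpi c); apply.
- by move=> c S Sp; rewrite card_gt0; apply: partition_neq0 (ppi c) Sp.
by rewrite /full_join J1 cards1.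
Qed.

(** Starting from Pi, the pi_c are joined one after another until one block is left. By
    [partition_join_rank], with Pi(nu_c) as a common refinement, step c lowers the number of blocks
    by at most |Pi(nu_c)| - |pi_c|. *)
Lemma merge_count_ge pi : admissible sigma tau pi ->
  (#|Pi| - 1 <= merge_count sigma tau pi)%N.
Proof.
move=> /admissibleP[ppi rpi _ _ J1].
have [P [pP PiP hP le]] : exists P, [/\ set_partition P, refines Pi P,
    forall c, c \in index_enum 'I_D -> refines (pi c) P &
    (#|Pi| <= #|P| + merge_count sigma tau pi)%N].
  rewrite /merge_count; elim: (index_enum _) => [|c r [P [pP PiP hP le]]].
    exists Pi; rewrite big_nil addn0; split=> //; first exact: set_partition_joint.
    by apply/refinesP; rewrite ?set_partition_joint.
  have [pJ PJ QJ _] := partition_joinP pP (ppi c).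
  exists (partition_join P (pi c)); split=> //.
  - by apply: refines_trans PiP PJ; rewrite ?set_partition_joint.
  - move=> c'; rewrite inE => /orP[/eqP -> //|/hP h].
    by apply: refines_trans h PJ.
  rewrite big_cons; have := partition_join_rank pP (ppi c) (set_partition_porbits (nu c)).
  move=> /(_ _ (rpi c)) rk.
  have {}rk := rk (refines_trans (set_partition_porbits _) set_partition_joint pP
     (porbits_refines_joint c) PiP).
  apply: leq_trans le _; rewrite addnA leq_add2r.
  move: rk => /=; move: #|P| #|pi c| #|porbits (nu c)| #|partition_join P (pi c)|; clear; lia.
suff : #|P| = 1%N by clear -le; lia.
have [pJ JE] := full_joinP ppi.
have JP : refines (full_join pi) P.
  by rewrite JE // PiP; apply/forallP => c; apply: hP; apply: mem_index_enum.
apply/eqP; rewrite eqn_leq card_gt0 set_partition_neq0 // andbT.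
by rewrite -J1; apply: refines_card.
Qed.

Definition lead_exp pi := (\sum_(c < D) perm_norm (nu c) + 2 * merge_count sigma tau pi)%N.

Lemma prod_block_sum (P : {set {set 'I_n}}) (F : {set 'I_n} -> fps K) k :
  fcoef (\prod_(S in P) F S) k =
  \sum_(lB in weak_compositions {B : {set 'I_n} | B \in P} k)
     \prod_(B : {B : {set 'I_n} | B \in P}) fcoef (F (sval B)) (lB B).
Proof.
rewrite big_sub (fcoef_prod _ (leqnn k)).
by apply: eq_bigl => h; rewrite inE.
Qed.


(** The connected series of a block stripped of its lowest power of x and read in the variable x^2;
    the index is the genus. See [conn_fact_dil]. *)
Definition genus_series (S : {set 'I_n}) (u : 'S_n) : fps K :=
  Fps (fun g => (gamma_l (#|S| + ncycles (block_perm S u) + 2 * g - 2) (block_perm S u))%:~R).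

Lemma ncycles_block (S : {set 'I_n}) (u : 'S_n) : stable S u ->
  ncycles (block_perm S u) = #|cycles_in u S|.
Proof. exact: card_cycles_block. Qed.

Lemma conn_fact_dil (S : {set 'I_n}) (u : 'S_n) : stable S u -> (0 < #|S|)%N ->
  conn_fact K S u = fps_dil (#|S| + ncycles (block_perm S u) - 2) (genus_series S u).
Proof.
move=> uS S0; apply: fps_ext => l; rewrite fcoef_conn_fact_gamma // /fps_dil fcoefE.
have r0 := ncycles_gt0 (block_perm S u) S0.
set r := ncycles _ in r0 *; case: ifP => [/andP[le ev]|h].
  rewrite /genus_series fcoefE -/r; congr (gamma_l _ _)%:~R.
  have e : ((l - (#|S| + r - 2))./2.*2 = l - (#|S| + r - 2))%N.
    by rewrite -[RHS]odd_double_half (negbTE ev).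
  by move: e le; rewrite -mul2n; move: (_./2) => q; lia.
apply: gamma_l_support => //; rewrite -/r; move: h => /negbT; rewrite negb_and negbK -ltnNge.
case/orP => [lt|od]; apply/orP; first by left; lia.
have [lt|ge] := ltnP l (#|S| + r - 2); first by left; lia.
right; have -> : (l + #|S| + r = (l - (#|S| + r - 2)) + 2 * (#|S| + r - 1))%N by lia.
by rewrite oddD oddM /= addbF.
Qed.

(** The exponents |S| + #(u|S) - 2 of the blocks add up to n + #(u) - 2|P| = ||u|| + 2 (#(u) -
    |P|). *)
Lemma prod_conn_fact_dil P (u : 'S_n) : set_partition P -> refines (porbits u) P ->
  \prod_(S in P) conn_fact K S u =
  fps_dil (perm_norm u + 2 * (#|porbits u| - #|P|)) (\prod_(S in P) genus_series S u).
Proof.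
move=> pP rP; have st := refines_porbits u pP rP.
have S0 S : S \in P -> (0 < #|S|)%N.
  by move=> SP; rewrite card_gt0; apply: partition_neq0 pP SP.
rewrite (eq_bigr (fun S : {set 'I_n} => fps_dil (#|S| + ncycles (block_perm S u) - 2) (genus_series S u)));
  last by move=> S SP; apply: conn_fact_dil; [apply: st|apply: S0].
rewrite fps_dil_prod; congr fps_dil.
have e1 : (\sum_(S in P) #|S| = n)%N.
  by rewrite -(card_partition pP) cardsT card_ord.
have e2 : (\sum_(S in P) ncycles (block_perm S u) = #|porbits u|)%N.
  by rewrite (card_porbits_sum pP rP); apply: eq_bigr => S SP; rewrite ncycles_block ?st.
have e3 : (\sum_(S in P) (#|S| + ncycles (block_perm S u) - 2) + 2 * #|P| = n + #|porbits u|)%N.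
  transitivity (\sum_(S in P) (#|S| + ncycles (block_perm S u)))%N; last first.
    by rewrite big_split /= e1 e2.
  rewrite mulnC -sum_nat_const -big_split /=; apply: eq_bigr => S SP.
  rewrite subnK // -[2%N]/(1 + 1)%N leq_add ?S0 //.
  exact: ncycles_gt0 (S0 _ SP).
have := refines_card (set_partition_porbits u) pP rP.
have : (#|porbits u| <= n)%N by have := card_porbits_le u; rewrite card_ord.
rewrite /perm_norm /ncycles; move: e3.
by move: (\sum_(S in P) _)%N #|P| #|porbits u|; clear; lia.
Qed.

Lemma conn_prod_dil pi : admissible sigma tau pi ->
  conn_prod pi = fps_dil (lead_exp pi)
    (\prod_(c < D) \prod_(S in pi c) genus_series S (nu c)).
Proof.
move=> /admissibleP[ppi rpi _ _ _]; rewrite /conn_prod.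
under eq_bigr => c _ do rewrite prod_conn_fact_dil //.
by rewrite fps_dil_prod big_split /= -big_distrr.
Qed.

(** L is the excess of the number of merges over its minimum |Pi| - 1. *)
Lemma ell_le pi : admissible sigma tau pi -> exists L,
  merge_count sigma tau pi = (#|Pi| + L - 1)%N /\
  lead_exp pi = (ell sigma tau + 2 * L)%N.
Proof.
move=> /merge_count_ge mg; have Pi0 : (0 < #|Pi|)%N.
  by rewrite card_gt0 set_partition_neq0 // set_partition_joint.
exists (merge_count sigma tau pi - (#|Pi| - 1))%N; rewrite /lead_exp /ell.
by split; lia.
Qed.

Definition lead_prod pi : K :=
  \prod_(c < D) \prod_(B in pi c) gamma_lead K (block_perm B (nu c)).

Lemma fcoef0_prod (I : finType) (Q : pred I) (F : I -> fps K) :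
  fcoef (\prod_(i | Q i) F i) 0 = \prod_(i | Q i) fcoef (F i) 0.
Proof.
apply: (big_morph (fun f : fps K => fcoef f 0)) => // f g.
by rewrite fcoefM big_ord1.
Qed.

Lemma fcoef_conn_prod_lead pi : admissible sigma tau pi ->
  fcoef (\prod_(c < D) \prod_(S in pi c) genus_series S (nu c)) 0 = lead_prod pi.
Proof.
move=> /admissibleP[_ _ st S0 _]; rewrite fcoef0_prod; apply: eq_bigr => c _.
rewrite fcoef0_prod; apply: eq_bigr => S Sp.
by rewrite /genus_series fcoefE muln0 addn0 gamma_l_lead // (S0 c).
Qed.

Lemma fcoef_cumulant_low l : (l < ell sigma tau)%N -> fcoef cumulant_series l = 0.
Proof.
move=> ll; rewrite cumulant_seriesE fcoef_sum big1 // => pi ad.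
have [L [_ e]] := ell_le ad; rewrite conn_prod_dil // fcoefE e ifF //.
by apply/negbTE; rewrite negb_and -ltnNge; apply/orP; left; lia.
Qed.

Lemma fcoef_cumulant_odd l : odd (l + ell sigma tau) -> fcoef cumulant_series l = 0.
Proof.
move=> od; rewrite cumulant_seriesE fcoef_sum big1 // => pi ad.
have [L [_ e]] := ell_le ad; rewrite conn_prod_dil // fcoefE e; case: ifP => // /andP[le ev].
case/negP: ev; rewrite oddB // oddD oddM /= addbF.
by rewrite oddD in od.
Qed.

Lemma fcoef_cumulant_lead : fcoef cumulant_series (ell sigma tau) =
  \sum_(pi | admissible sigma tau pi && (merge_count sigma tau pi == #|Pi| - 1)%N) lead_prod pi.
Proof.
rewrite cumulant_seriesE fcoef_sum [RHS]big_mkcondr; apply: eq_bigr => pi ad.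
have [L [e1 e2]] := ell_le ad; rewrite conn_prod_dil // fcoefE e2.
have Pi0 : (0 < #|Pi|)%N.
  by rewrite card_gt0 set_partition_neq0 // set_partition_joint.
have -> : (merge_count sigma tau pi == #|Pi| - 1)%N = (L == 0%N).
  by rewrite e1; apply/eqP/eqP; lia.
case: eqP => [->|L0]; first by rewrite muln0 addn0 leqnn subnn /= fcoef_conn_prod_lead.
by rewrite ifF //; apply/negbTE; rewrite negb_and -ltnNge; apply/orP; left; lia.
Qed.

Lemma gamma_lead_sign m (u : 'S_m) : (0 < m)%N ->
  0 < (-1) ^+ (m + ncycles u) * gamma_lead K u.
Proof.
move=> m0; rewrite -gamma_l_lead // -fcoef_conn_factT conn_fact_lead ?stableT //; last 2 first.
- by rewrite -cards_eq0 cardsT card_ord -lt0n.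
- rewrite cardsT card_ord -ncyclesE subnK //.
  by have := ncycles_gt0 u m0; lia.
rewrite cardsT card_ord -ncyclesE mulrA -exprMn mulrNN mulr1 expr1n mul1r /planar_lead.
rewrite mulr_gt0 ?divr_gt0 ?ltr0n ?fact_gt0 //; apply: prodr_gt0 => C /imsetP[x _ ->].
by rewrite mulr_gt0 // ltr0n ?bin_gt0 -?addnn ?leq_addr // lt0n card_porbit_neq0.
Qed.

(** The sign is determined by the nu_c alone and is the same for every pi, so the terms of the
    leading coefficient do not cancel. *)
Lemma lead_prod_sign pi : admissible sigma tau pi ->
  0 < (\prod_(c < D) (-1) ^+ (n + #|porbits (nu c)|)) * lead_prod pi.
Proof.
move=> /admissibleP[ppi rpi st S0 _]; rewrite /lead_prod -big_split /=.
apply: prodr_gt0 => c _.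
have -> : (n + #|porbits (nu c)| = \sum_(B in pi c) (#|B| + ncycles (block_perm B (nu c))))%N.
  rewrite big_split /= -(card_partition (ppi c)) cardsT card_ord; congr (_ + _)%N.
  rewrite (card_porbits_sum (ppi c) (rpi c)); apply: eq_bigr => B Bp.
  by rewrite ncycles_block // (st c).
rewrite expr_sum -big_split /=; apply: prodr_gt0 => B Bp.
by apply: gamma_lead_sign; apply: (S0 c).
Qed.

(** One colour c0 does all the merging. From each block of Pi one cycle of nu_c0 is chosen, and
    these cycles are united into a single block M, at the cost of |Pi| - 1 merges; the other colours
    keep their cycles. Since M meets every block of Pi, the join has one block. *)
Lemma admissible_exists (D_gt0 : (0 < D)%N) :
  exists2 pi, admissible sigma tau pi & merge_count sigma tau pi = (#|Pi| - 1)%N.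
Proof.
pose c0 := Ordinal D_gt0; have pPi := set_partition_joint.
have triv := partition_trivIset pPi; have covPi := cover_partition pPi.
have [tr trP] : exists tr : {set 'I_n} -> 'I_n, forall O, O \in Pi -> tr O \in O.
  exists (fun O : {set 'I_n} => odflt (Ordinal n_gt0) [pick x in O]) => O OP.
  case: pickP => [x //|h]; have /set0Pn[x xO] := partition_neq0 pPi OP.
  by move: (h x); rewrite /= xO.
pose u := nu c0.
have uO O : O \in Pi -> stable O u.
  by move/refines_porbits: (porbits_refines_joint c0) => /(_ pPi); apply.
pose A := [set porbit u (tr O) | O in Pi].
have A_inj : {in Pi &, injective (fun O => porbit u (tr O))}.
  move=> O O' OP O'P e; rewrite -(def_pblock triv OP (trP _ OP)).
  rewrite -(def_pblock triv O'P (trP _ O'P)); apply: same_pblock => //.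
  rewrite (def_pblock triv O'P (trP _ O'P)).
  apply: (subsetP (porbit_sub (uO _ O'P) (trP _ O'P))); rewrite -e; exact: porbit_id.
have AP : A \subset porbits u by apply/subsetP => _ /imsetP[O _ ->]; apply: imset_f.
pose M := cover A; pose Q := M |: (porbits u :\: A).
have pu := set_partition_porbits u.
have covE : cover (porbits u :\: A) = ~: M.
  apply/setP => x; rewrite inE; apply/bigcupP/idP => [[C]|xM].
    rewrite inE => /andP[CA CP] xC; apply/bigcupP => -[C' C'A xC']; case/negP: CA.
    rewrite -(def_pblock (partition_trivIset pu) CP xC).
    by rewrite (def_pblock (partition_trivIset pu) (subsetP AP _ C'A) xC').
  exists (porbit u x); last exact: porbit_id.
  rewrite inE imset_f // andbT; apply: contra xM => CA; apply/bigcupP.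
  by exists (porbit u x); rewrite ?porbit_id.
have OM O : O \in Pi -> tr O \in M.
  by move=> OP; apply/bigcupP; exists (porbit u (tr O)); rewrite ?porbit_id // imset_f.
have [O0 O0P] : exists O, O \in Pi by apply/set0Pn/set_partition_neq0.
have pQ : set_partition Q.
  rewrite /set_partition (_ : [set: 'I_n] = M :|: ~: M); last by rewrite setUCr.
  rewrite /Q; apply: partitionU1.
  - rewrite -covE; apply/and3P; split=> //; first exact/trivIsetD/(partition_trivIset pu).
    by rewrite inE (partition0 pu) andbF.
  - by apply/set0Pn; exists (tr O0); apply: OM.
  - by rewrite -setI_eq0 setICr.
have MA : M \notin porbits u :\: A.
  apply/negP => h; have : tr O0 \in cover (porbits u :\: A).
    by apply/bigcupP; exists M => //; apply: OM.
  by rewrite covE inE OM.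
have cQ : (#|Q| = (#|porbits u| - #|Pi|).+1)%N.
  by rewrite cardsU1 MA /= add1n cardsD (setIidPr AP) /A (card_in_imset A_inj).
have rQ : refines (porbits u) Q.
  apply/forall_inP => C CP; apply/exists_inP; have [CA|CA] := boolP (C \in A).
    by exists M; [rewrite setU11|apply: bigcup_sup CA].
  by exists C => //; rewrite !inE CA CP orbT.
pose pi := [ffun c => if c == c0 then Q else porbits (nu c)].
have ppi c : set_partition (pi c).
  by rewrite ffunE; case: eqP => // _; apply: set_partition_porbits.
exists pi.
  rewrite /admissible -/(full_join pi); have [pJ JE] := full_joinP ppi.
  apply/andP; split.
    apply/forallP => c; rewrite ppi /= ffunE; case: eqP => [-> //|_].
    by apply/refinesP; rewrite ?set_partition_porbits.
  have := JE _ pJ; have -> : refines (full_join pi) (full_join pi) by apply/refinesP.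
  move/esym/andP => [/(refinesP pPi pJ) PiJ /forallP/(_ c0)].
  rewrite ffunE eqxx => /(refinesP pQ pJ) QJ.
  rewrite one_block_card // eqn_leq card_gt0 set_partition_neq0 // andbT.
  have trivJ := partition_trivIset pJ.
  have blockE x : pblock (full_join pi) x = pblock (full_join pi) (tr O0).
    have OP : pblock Pi x \in Pi by rewrite pblock_mem // covPi inE.
    have e1 : tr (pblock Pi x) \in pblock (full_join pi) x by apply: PiJ; apply: trP.
    rewrite -(same_pblock trivJ e1); apply/esym/same_pblock => //; apply: QJ.
    have MQ : M \in Q by rewrite setU11.
    by rewrite (def_pblock (partition_trivIset pQ) MQ (OM _ OP)) OM.
  apply/card_le1_eqP => B B' BJ B'J.
  have /set0Pn[x xB] := partition_neq0 pJ BJ; have /set0Pn[y yB'] := partition_neq0 pJ B'J.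
  by rewrite -(def_pblock trivJ BJ xB) -(def_pblock trivJ B'J yB') !blockE.
rewrite /merge_count (bigD1 c0) //= big1 => [|c cc0].
  have : (#|Pi| <= #|porbits u|)%N by rewrite -(card_in_imset A_inj) subset_leq_card.
  have Pi0 : (0 < #|Pi|)%N by rewrite card_gt0 set_partition_neq0.
  rewrite ffunE eqxx cQ -/u; move: Pi0.
  by move: #|Pi| #|porbits u|; clear; lia.
by rewrite ffunE (negbTE cc0) subnn.
Qed.

Lemma fcoef_cumulant_neq0 (D_gt0 : (0 < D)%N) : fcoef cumulant_series (ell sigma tau) != 0.
Proof.
rewrite fcoef_cumulant_lead.
pose sg : K := \prod_(c < D) (-1) ^+ (n + #|porbits (nu c)|).
suff : 0 < sg * \sum_(pi | admissible sigma tau pi && (merge_count sigma tau pi == #|Pi| - 1)%N)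
     lead_prod pi.
  by apply: contraTneq => ->; rewrite mulr0 ltxx.
have [pi0 ad0 mc0] := admissible_exists D_gt0.
rewrite mulr_sumr (bigD1 pi0) ?ad0 ?mc0 ?eqxx //=.
apply: ltr_pwDl; first exact: lead_prod_sign.
by apply: sumr_ge0 => pi /andP[/andP[ad _] _]; apply/ltW/lead_prod_sign.
Qed.

End Cumulants.

From mathcomp Require Import reals.

(** * Coefficients of the cumulant series *)

Section CumulantCoefficients.
Variables (R : realType) (n D : nat) (n_gt0 : (0 < n)%N).
Variables (sigma tau : 'I_D -> 'S_n).
Implicit Types (pi : {ffun 'I_D -> {set {set 'I_n}}}).
Local Notation nu := (quotient_perm sigma tau).
Local Notation Pi := (joint_orbits sigma tau).
Local Notation cumulant_series := (cumulant_series R sigma tau).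

Lemma fcoef_cumulant l : fcoef cumulant_series l =
  \sum_(pi | admissible sigma tau pi) \sum_(lc in weak_compositions 'I_D l)
    \prod_(c < D) block_gamma R (pi c) (nu c) (lc c).
Proof.
rewrite cumulant_seriesE // fcoef_sum; apply: eq_bigr => pi ad.
have [_ _ st _ _] := admissibleP ad.
rewrite /conn_prod (fcoef_prod _ (leqnn l)).
apply: eq_big => [lc|lc _]; first by rewrite inE.
apply: eq_bigr => c _; rewrite prod_block_sum; apply: eq_bigr => lB _.
by apply: eq_bigr => B _; rewrite fcoef_conn_fact_gamma //; apply: st; apply: valP.
Qed.

(** Each pi contributes only to the L given by its number of merges. If l - ell is odd, the
    condition on g has no solution, in agreement with the parity of the series. *)
Lemma fcoef_cumulant_genus l : (ell sigma tau < l)%N -> fcoef cumulant_series l =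
  \sum_(L < ((l - ell sigma tau)./2).+1)
    \sum_(pi | admissible sigma tau pi && (merge_count sigma tau pi == #|Pi| + L - 1)%N)
      \sum_(g : {ffun 'I_D -> 'I_l.+1} |
              (2 * (\sum_(c < D) g c + L) == l - ell sigma tau)%N)
        \prod_(c < D) block_gamma_genus R (pi c) (nu c) (g c).
Proof.
move=> ll; rewrite cumulant_seriesE // fcoef_sum.
rewrite (exchange_big_dep (admissible sigma tau)) /=; last by move=> L pi _ /andP[].
have Pi0 : (0 < #|Pi|)%N.
  by rewrite card_gt0 set_partition_neq0 // set_partition_joint.
apply: eq_bigr => pi ad; have [L0 [e1 e2]] := ell_le n_gt0 ad.
rewrite conn_prod_dil // fcoefE e2 ad /=.
set l0 := ell sigma tau in ll e2 *.
rewrite (eq_bigl (fun L : 'I_((l - l0)./2).+1 => nat_of_ord L == L0)); last first.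
  by move=> L; rewrite e1; apply/eqP/eqP; move: Pi0; move: #|Pi|; lia.
have hh := odd_double_half (l - l0).
have [L0l|L0l] := ltnP L0 ((l - l0)./2).+1; last first.
  rewrite [RHS]big1; last first.
    by move=> L eL; move: (ltn_ord L); rewrite (eqP eL) ltnNge L0l.
  rewrite ifF //; apply/negbTE; rewrite negb_and -ltnNge; apply/orP; left.
  by move: hh L0l; rewrite -mul2n; move: (_./2) (odd _) => h b; case: b; lia.
rewrite (big_pred1 (Ordinal L0l)) => [|L /=]; last by rewrite -[RHS]val_eqE.
have e3 : (l - (l0 + 2 * L0) = l - l0 - 2 * L0)%N by lia.
have gE (g : {ffun 'I_D -> 'I_l.+1}) : (2 * (\sum_(c < D) g c + L0) == l - l0)%N =
   [&& (l0 + 2 * L0 <= l)%N, ~~ odd (l - (l0 + 2 * L0)) &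
     (\sum_(c < D) g c == (l - (l0 + 2 * L0))./2)%N].
  move: (\sum_(c < D) g c)%N => G; rewrite e3.
  have le : (2 * L0 <= l - l0)%N.
    by move: hh L0l; rewrite -mul2n; move: (_./2) (odd _) => h b; case: b; lia.
  have -> /= : (l0 + 2 * L0 <= l)%N by lia.
  have h2 := odd_double_half (l - l0 - 2 * L0).
  apply/eqP/andP => [eG|[/negbTE ev /eqP ->]].
    have -> : (l - l0 - 2 * L0 = G.*2)%N by rewrite -mul2n; lia.
    by rewrite odd_double doubleK.
  by rewrite ev add0n -mul2n in h2; lia.
rewrite (eq_bigl _ _ gE); case: ifP => [/andP[le ev]|h]; last first.
  by rewrite big_pred0 // => g; rewrite andbA h.
rewrite (fcoef_prod _ (M := l)); last first.
  by move: (odd_double_half (l - (l0 + 2 * L0))); rewrite -mul2n; move: (_./2) => q; lia.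
apply: eq_big => [g|g _]; first by rewrite le ev.
by apply: eq_bigr => c _; rewrite prod_block_sum.
Qed.

End CumulantCoefficients.

(** * Asymptotic expansions in 1/N *)

Section Asymptotics.
Variable R : realType.
Implicit Types (f g : nat -> R) (s t : fps R) (L : nat).

Definition psum L s (x : R) : R := \sum_(l < L) fcoef s l * x ^+ l.

(** C and N0 depend on L: the expansion is asymptotic, and no convergence of s is asked. *)
Definition asym_to L f s := exists C, exists N0 : nat, (0 < N0)%N /\
  forall N, (N0 <= N)%N -> `|f N - psum L s N%:R^-1| <= C * N%:R^-1 ^+ L.

Definition asym f s := forall L, asym_to L f s.

Let inv_ge0 N : 0 <= N%:R^-1 :> R. Proof. by rewrite invr_ge0. Qed.
Let inv_le1 N : (0 < N)%N -> N%:R^-1 <= 1 :> R.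
Proof. by move=> N0; rewrite invf_le1 ?ltr0n // ler1n. Qed.

Lemma asym_to_ext L f g s N1 : (forall N, (N1 <= N)%N -> f N = g N) ->
  asym_to L f s -> asym_to L g s.
Proof.
move=> fg [C [N0 [N00 h]]]; exists C, (maxn N0 N1); split; first by rewrite leq_max N00.
by move=> N; rewrite geq_max => /andP[h0 h1]; rewrite -fg // h.
Qed.

Lemma eq_asym_to L f g s : f =1 g -> asym_to L f s -> asym_to L g s.
Proof. by move=> fg; apply: (@asym_to_ext _ _ _ _ 0) => N _; apply: fg. Qed.

Lemma eq_asym f g s : f =1 g -> asym f s -> asym g s.
Proof. by move=> fg fs L; apply: eq_asym_to fg (fs L). Qed.

Lemma psumD L s t x : psum L (s + t) x = psum L s x + psum L t x.
Proof. by rewrite /psum -big_split; apply: eq_bigr => l _; rewrite fcoefD mulrDl. Qed.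

Lemma psumN L s x : psum L (- s) x = - psum L s x.
Proof. by rewrite /psum -sumrN; apply: eq_bigr => l _; rewrite fcoefN mulNr. Qed.

Lemma psum_trunc L s x : psum L.+1 s x = (fps_trunc L s).[x].
Proof.
rewrite (@horner_coef_wide _ L.+1) ?size_poly //; apply: eq_bigr => l _.
by rewrite coef_fps_trunc // -ltnS.
Qed.

Lemma asym_toD L f g s t : asym_to L f s -> asym_to L g t ->
  asym_to L (fun N => f N + g N) (s + t).
Proof.
move=> [C [N0 [N00 h]]] [C' [N0' [N00' h']]]; exists (C + C'), (maxn N0 N0').
split=> [|N]; first by rewrite leq_max N00.
rewrite geq_max => /andP[l0 l0']; rewrite psumD opprD addrACA mulrDl.
by apply: le_trans (ler_normD _ _) _; apply: lerD; [apply: h|apply: h'].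
Qed.

Lemma asym_toN L f s : asym_to L f s -> asym_to L (fun N => - f N) (- s).
Proof.
move=> [C [N0 [N00 h]]]; exists C, N0; split=> // N l0.
by rewrite psumN -opprD normrN h.
Qed.

Lemma asym_to0 L : asym_to L (fun=> 0) 0.
Proof.
exists 0, 1%N; split=> // N _; rewrite /psum big1 => [|l _]; last by rewrite fcoef0 mul0r.
by rewrite subrr normr0 mul0r.
Qed.

Lemma asym_to1 L : asym_to L (fun=> 1) 1.
Proof.
exists 1, 1%N; split=> // N N0; case: L => [|L].
  by rewrite /psum big_ord0 subr0 normr1 expr0 mulr1.
rewrite /psum big_ord_recl big1 => [|l _]; last by rewrite fcoef1 mul0r.
by rewrite fcoef1 expr0 mulr1 addr0 subrr normr0 mulr_ge0 // exprn_ge0.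
Qed.

Lemma asym_to_sum L (I : finType) (P : pred I) (f : I -> nat -> R) (s : I -> fps R) :
  (forall i, P i -> asym_to L (f i) (s i)) ->
  asym_to L (fun N => \sum_(i | P i) f i N) (\sum_(i | P i) s i).
Proof.
move=> fs; rewrite -big_filter.
apply: (@eq_asym_to _ (fun N => \sum_(i <- [seq i <- index_enum I | P i]) f i N)).
  by move=> N; rewrite big_filter.
have : all P [seq i <- index_enum I | P i] by apply: filter_all.
elim: [seq _ <- _ | _] => [|i r IHr] /=.
  by move=> _; rewrite big_nil; apply: eq_asym_to (asym_to0 L) => N; rewrite big_nil.
case/andP => Pi /IHr Ir; rewrite big_cons.
by apply: eq_asym_to (asym_toD (fs i Pi) Ir) => N; rewrite big_cons.
Qed.

Lemma asym_to_X L f s : asym_to L f s ->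
  asym_to L.+1 (fun N => N%:R^-1 * f N) (fpsX * s).
Proof.
move=> [C [N0 [N00 h]]]; exists C, N0; split=> // N l0.
have -> : psum L.+1 (fpsX * s) N%:R^-1 = N%:R^-1 * psum L s N%:R^-1.
  rewrite /psum big_ord_recl fcoefXM mul0r add0r mulr_sumr; apply: eq_bigr => l _.
  by rewrite fcoefXM /= exprS mulrCA.
rewrite -mulrBr normrM ger0_norm // exprS mulrCA ler_wpM2l //.
exact: h.
Qed.

Lemma asym_toW L f s : asym_to L.+1 f s -> asym_to L f s.
Proof.
move=> [C [N0 [N00 h]]]; exists (`|C| + `|fcoef s L|), N0; split=> // N l0.
have N_gt0 : (0 < N)%N by apply: leq_trans l0.
have := h N l0; rewrite /psum big_ord_recr /= -/(psum L s _) => hN.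
have -> : f N - psum L s N%:R^-1 =
    f N - (psum L s N%:R^-1 + fcoef s L * N%:R^-1 ^+ L) + fcoef s L * N%:R^-1 ^+ L by ring.
apply: le_trans (ler_normD _ _) _; rewrite mulrDl; apply: lerD.
  apply: le_trans hN _; apply: le_trans (ler_norm _) _.
  rewrite normrM [`|_ ^+ _|]ger0_norm ?exprn_ge0 // ler_wpM2l //.
  by rewrite exprSr ler_piMr ?exprn_ge0 ?inv_le1.
by rewrite normrM [`|_ ^+ _|]ger0_norm ?exprn_ge0.
Qed.

(** Just one order is gained, whatever k >= 1 is; this is the step of the induction in
    [asym_inverse]. *)
Lemma asym_to_Xn L k f s : (0 < k)%N -> asym_to L f s ->
  asym_to L.+1 (fun N => N%:R^-1 ^+ k * f N) (fpsX ^+ k * s).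
Proof.
case: k => // k _; elim: k => [|k IHk] fs.
  by rewrite expr1; apply: eq_asym_to (asym_to_X fs) => N; rewrite expr1.
rewrite exprS -mulrA; apply: eq_asym_to (asym_toW (asym_to_X (IHk fs))) => N.
by rewrite mulrA -exprS.
Qed.

Lemma poly_tail (p : {poly R}) L : exists C, forall x, 0 <= x -> x <= 1 ->
  `|p.[x] - \sum_(l < L) p`_l * x ^+ l| <= C * x ^+ L.
Proof.
exists (\sum_(k < size p) `|p`_(L + k)|) => x x0 x1.
have -> : p.[x] = \sum_(l < L + size p) p`_l * x ^+ l.
  by rewrite (@horner_coef_wide _ (L + size p)) // leq_addl.
rewrite big_split_ord /= addrAC subrr add0r mulr_suml.
apply: le_trans (ler_norm_sum _ _ _) _; apply: ler_sum => k _.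
rewrite normrM [`|_ ^+ _|]ger0_norm ?exprn_ge0 // ler_wpM2l // exprD.
by rewrite ler_piMr ?exprn_ge0 // exprn_ile1.
Qed.

Lemma psum_bounded L s : exists A, forall x, 0 <= x -> x <= 1 -> `|psum L s x| <= A.
Proof.
exists (\sum_(l < L) `|fcoef s l|) => x x0 x1; apply: le_trans (ler_norm_sum _ _ _) _.
apply: ler_sum => l _; rewrite normrM [`|_ ^+ _|]ger0_norm ?exprn_ge0 //.
by rewrite ler_piMr // exprn_ile1.
Qed.

(** The expansions are used to order L+1, where the partial sums are the polynomials [fps_trunc L].
    Their product exceeds the partial sum of s * t by a tail that [poly_tail] bounds. *)
Lemma asymM f g s t : asym f s -> asym g t -> asym (fun N => f N * g N) (s * t).
Proof.
move=> fs gt L; apply: asym_toW.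
have [C [N0 [N00 h]]] := fs L.+1; have [C' [N0' [_ h']]] := gt L.+1.
have [A hA] := psum_bounded L.+1 s; have [B hB] := psum_bounded L.+1 t.
have [E hE] := poly_tail (fps_trunc L s * fps_trunc L t) L.+1.
exists (A * `|C'| + `|C| * B + `|C| * `|C'| + E), (maxn N0 N0').
split=> [|N]; first by rewrite leq_max N00.
rewrite geq_max => /andP[l0 l0']; have N_gt0 : (0 < N)%N by apply: leq_trans l0.
move: (h N l0) (h' N l0') (hA _ (inv_ge0 N) (inv_le1 N_gt0)) (hB _ (inv_ge0 N) (inv_le1 N_gt0)).
move: (hE _ (inv_ge0 N) (inv_le1 N_gt0)).
have xL0 : 0 <= N%:R^-1 ^+ L.+1 :> R by rewrite exprn_ge0.
have xL1 : N%:R^-1 ^+ L.+1 <= 1 :> R by rewrite exprn_ile1 ?inv_le1.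
have -> : \sum_(l < L.+1) (fps_trunc L s * fps_trunc L t)`_l * N%:R^-1 ^+ l =
    psum L.+1 (s * t) N%:R^-1.
  by apply: eq_bigr => l _; rewrite -(fcoef_mul_trunc (L := L)) // -ltnS.
rewrite hornerM -!psum_trunc.
move: (psum L.+1 (s * t) _) (psum L.+1 s _) (psum L.+1 t _) (N%:R^-1 ^+ L.+1) xL0 xL1.
move=> st p q X X0 X1 hst hf hg hp hq.
have -> : f N * g N - st = (p * (g N - q) + (f N - p) * q + (f N - p) * (g N - q)) + (p * q - st).
  by ring.
have {}hf : `|f N - p| <= `|C| * X by apply: le_trans hf (ler_wpM2r X0 (ler_norm C)).
have {}hg : `|g N - q| <= `|C'| * X by apply: le_trans hg (ler_wpM2r X0 (ler_norm C')).
apply: le_trans (ler_normD _ _) _; rewrite [leRHS]mulrDl; apply: lerD => //.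
apply: le_trans (ler_normD _ _) _; rewrite [leRHS]mulrDl; apply: lerD; last first.
  rewrite normrM; apply: le_trans (ler_pM (normr_ge0 _) (normr_ge0 _) hf hg) _.
  by rewrite mulrACA mulrA ler_piMr // !mulr_ge0.
apply: le_trans (ler_normD _ _) _; rewrite [leRHS]mulrDl; apply: lerD.
  by rewrite normrM -mulrA ler_pM.
by rewrite normrM mulrAC ler_pM.
Qed.

Lemma asym_prod (I : finType) (P : pred I) (f : I -> nat -> R) (s : I -> fps R) :
  (forall i, P i -> asym (f i) (s i)) ->
  asym (fun N => \prod_(i | P i) f i N) (\prod_(i | P i) s i).
Proof.
move=> fs; rewrite -big_filter.
apply: (@eq_asym (fun N => \prod_(i <- [seq i <- index_enum I | P i]) f i N)).
  by move=> N; rewrite big_filter.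
have : all P [seq i <- index_enum I | P i] by apply: filter_all.
elim: [seq _ <- _ | _] => [|i r IHr] /=.
  move=> _; rewrite big_nil; apply: (@eq_asym (fun=> 1)) => [N|L]; first by rewrite big_nil.
  exact: asym_to1.
case/andP => Pi /IHr Ir; rewrite big_cons.
by apply: eq_asym (asymM (fs i Pi) Ir) => N; rewrite big_cons.
Qed.

Lemma asym_nat k : asym (fun=> k%:R) k%:R.
Proof.
move=> L; elim: k => [|k IHk]; first exact: asym_to0.
have -> : k.+1%:R = k%:R + 1 :> fps R by rewrite natr1.
by apply: eq_asym_to (asym_toD IHk (asym_to1 L)) => N; rewrite natr1.
Qed.

Lemma asym_sign k : asym (fun=> (-1) ^+ k) ((-1) ^+ k).
Proof.
elim: k => [|k IHk]; first by move=> L; apply: asym_to1.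
have -> : (-1) ^+ k.+1 = -1 * (-1) ^+ k :> fps R by rewrite exprS.
by apply: eq_asym (asymM (fun L => asym_toN (asym_to1 L)) IHk) => N; rewrite exprS.
Qed.

Lemma small_eq0 (a C : R) N0 :
  (forall N, (N0 <= N)%N -> (0 < N)%N -> `|a| <= C * N%:R^-1) -> a = 0.
Proof.
move=> h; apply/eqP; rewrite -normr_eq0; apply/negPn/negP => a0.
have a_gt0 : 0 < `|a| by rewrite lt_def a0 normr_ge0.
pose N := (maxn N0 (Num.bound (C / `|a|))).+1.
have := h N (leqW (leq_maxl _ _)) (ltn0Sn _).
rewrite ler_pdivlMr ?ltr0n // leNgt => /negP; apply.
rewrite mulrC -ltr_pdivrMr //; apply: le_lt_trans (ler_norm _) _.
have : (Num.bound (C / `|a|) <= N)%N by apply/leqW/leq_maxr.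
rewrite -(ler_nat R); apply: lt_le_trans.
by have := archi_boundP (normr_ge0 (C / `|a|)); rewrite /Num.bound normr_id.
Qed.

(** Once the coefficients below l agree, dividing by N^(-l) leaves a constant bounded by a multiple
    of 1/N. *)
Lemma asym_uniq f s t : asym f s -> asym f t -> s = t.
Proof.
move=> fs ft; apply: fps_ext => l; elim/ltn_ind: l => l IHl.
have [C [N0 [N00 h]]] := fs l.+1; have [C' [N0' [_ h']]] := ft l.+1.
apply/eqP; rewrite -subr_eq0; apply/eqP.
apply: (@small_eq0 _ (C + C') (maxn N0 N0')) => N; rewrite geq_max => /andP[l0 l0'] N_gt0.
have x_gt0 : 0 < N%:R^-1 ^+ l :> R by rewrite exprn_gt0 // invr_gt0 ltr0n.
rewrite -(ler_pM2r x_gt0) -mulrA -exprS mulrDl.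
have -> : `|fcoef s l - fcoef t l| * N%:R^-1 ^+ l =
   `|(f N - psum l.+1 t N%:R^-1) - (f N - psum l.+1 s N%:R^-1)|.
  rewrite -[X in _ * X]ger0_norm ?ltW // -normrM; congr `|_|.
  rewrite /psum !big_ord_recr /=.
  have -> : \sum_(i < l) fcoef s i * N%:R^-1 ^+ i = \sum_(i < l) fcoef t i * N%:R^-1 ^+ i.
    by apply: eq_bigr => i _; rewrite IHl.
  by ring.
rewrite [leRHS]addrC; apply: le_trans (ler_normB _ _) _.
by apply: lerD; [apply: h'|apply: h].
Qed.

(** The terms with r different from 1 carry a factor N^(-|r|), so an expansion of order L on the
    right gives one of order L+1 on the left, and [all_fact] obeys the same recursion by
    [all_fact0_rec]. Order 0 is boundedness. *)
Lemma asym_inverse m (w : nat -> 'S_m -> R) N1 :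
  (forall N, (N1 <= N)%N -> forall u,
     \sum_(r : 'S_m) N%:R^-1 ^+ pnorm r * w N (u * r^-1)%g = (u == 1%g)%:R) ->
  forall u, asym (fun N => w N u) (all_fact R (finset.setTfor 'I_m) u).
Proof.
move=> wE.
have onT (r : 'S_m) : perm_on (finset.setTfor 'I_m) r by apply/subsetP => x _; rewrite inE.
have aE u : all_fact R (finset.setTfor 'I_m) u = (u == 1%g)%:R -
    \sum_(r : 'S_m | r != 1%g) fpsX ^+ pnorm r * all_fact R (finset.setTfor 'I_m) (u * r^-1)%g.
  rewrite /all_fact !stableT restr_permT.
  have := all_fact0_rec R (finset.setTfor 'I_m) u; rewrite (bigD1 1%g) ?onT //=.
  rewrite pnorm1 expr0 mul1r invg1 mulg1 => <-.
  rewrite [X in _ + X - _](eq_bigl (fun r : 'S_m => r != 1%g)); last by move=> r; rewrite onT.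
  rewrite -addrA [X in _ + X](_ : _ = 0) ?addr0 //; apply/eqP; rewrite subr_eq0; apply/eqP.
  by apply: eq_bigr => r _; rewrite stableT restr_permT.
have wE' N u : (N1 <= N)%N -> w N u = (u == 1%g)%:R -
    \sum_(r : 'S_m | r != 1%g) N%:R^-1 ^+ pnorm r * w N (u * r^-1)%g.
  move=> NN1; rewrite -(wE N NN1 u) (bigD1 1%g) //= pnorm1 expr0 mul1r invg1 mulg1.
  by rewrite addrK.
suff H L : forall u, asym_to L (fun N => w N u) (all_fact R (finset.setTfor 'I_m) u).
  by move=> u L; apply: H.
elim: L => [|L IHL] u; last first.
  rewrite aE; apply: (@asym_to_ext _ (fun N => (u == 1%g)%:R -
    \sum_(r : 'S_m | r != 1%g) N%:R^-1 ^+ pnorm r * w N (u * r^-1)%g) _ _ N1).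
    by move=> N NN1; rewrite -wE'.
  apply: asym_toD; first exact: asym_nat.
  apply: asym_toN; apply: asym_to_sum => r r1.
  by apply: asym_to_Xn (IHL _); apply: pnorm_gt0.
(* Summing the recursion over all permutations gives S <= M (1 + S / N), M = m!. *)
pose M := #|{: 'S_m}|; have M0 : (0 < M)%N by apply/card_gt0P; exists 1%g.
exists (2 * M%:R), (maxn N1 (2 * M)); split=> [|N]; first by rewrite leq_max muln_gt0 M0 orbT.
rewrite geq_max => /andP[NN1 NM]; rewrite /psum big_ord0 subr0 expr0 mulr1.
have N_gt0 : (0 < N)%N by apply: leq_trans NM; rewrite muln_gt0 M0.
pose S := \sum_v `|w N v|.
have wS v : `|w N v| <= S by rewrite /S (bigD1 v) //= lerDl sumr_ge0.
have S0 : 0 <= S by apply: sumr_ge0.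
have step v : `|w N v| <= 1 + N%:R^-1 * S.
  rewrite wE' //; apply: le_trans (ler_normB _ _) _; apply: lerD.
    by case: (v == 1%g); rewrite ?normr1 // normr0.
  apply: le_trans (ler_norm_sum _ _ _) _.
  apply: (@le_trans _ _ (\sum_(r : 'S_m | r != 1%g) N%:R^-1 * `|w N (v * r^-1)%g|)).
    apply: ler_sum => r r1; rewrite normrM ger0_norm ?exprn_ge0 // ler_wpM2r //.
    have := pnorm_gt0 r1; case: (pnorm r) => // k _.
    by rewrite exprS ler_piMr // exprn_ile1 // inv_le1.
  rewrite -mulr_sumr ler_wpM2l //.
  apply: (@le_trans _ _ (\sum_(r : 'S_m) `|w N (v * r^-1)%g|)).
    by rewrite [leRHS](bigID (fun r : 'S_m => r != 1%g)) /= lerDl sumr_ge0.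
  have inj : injective (fun r : 'S_m => (v * r^-1)%g) by move=> r r' /mulgI/invg_inj.
  by rewrite /S [leRHS](reindex_inj inj).
have SM : S <= M%:R * (1 + N%:R^-1 * S).
  rewrite mulr_natl -sumr_const; apply: ler_sum => v _; exact: step.
have MN : M%:R * N%:R^-1 <= 2^-1 :> R.
  rewrite ler_pdivrMr ?ltr0n // mulrC ler_pdivlMr ?ltr0n // -natrM ler_nat mulnC //.
apply: le_trans (wS u) _.
have : M%:R * (N%:R^-1 * S) <= 2^-1 * S by rewrite mulrA ler_wpM2r.
move: SM; rewrite mulrDr mulr1.
move: (M%:R * (N%:R^-1 * S)) M%:R => a b; clear -S0; move: S S0 => S S0.
by lra.
Qed.

End Asymptotics.

From mathcomp Require Import complex.
From mathcomp Require Import all_classical all_reals all_analysis.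
From mathcomp Require Import measurable_realfun.
Import numFieldNormedType.Exports.
Local Open Scope classical_set_scope.
Local Open Scope ring_scope.

(** * The orthogonality relation of the Weingarten function *)

Lemma prod_natr_bool (V : comNzRingType) (I : finType) (b : I -> bool) :
  \prod_i (b i)%:R = [forall i, b i]%:R :> V.
Proof.
case: forallP => [h|/forallP]; first by apply: big1 => i _; rewrite h.
by rewrite negb_forall => /existsP[i /negbTE bi]; rewrite (bigD1 i) //= bi mul0r.
Qed.

Section Weingarten.
Variables (R : realType) (N : nat).
Local Notation T := (unitary_borel R N).
Implicit Types (f g : T -> R[i]).

(** A class of integrable functions closed under products and conjugation. Matrix entries belong to
    it because the rows of a unitary matrix have norm 1. *)
Definition bounded_mfun f : Prop :=
  [/\ measurable_fun [set: T] (fun U => complex.Re (f U)),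
      measurable_fun [set: T] (fun U => complex.Im (f U)) &
      exists M : R, forall U, `|complex.Re (f U)| <= M /\ `|complex.Im (f U)| <= M].

Lemma ReM (z w : R[i]) :
  complex.Re (z * w) = complex.Re z * complex.Re w - complex.Im z * complex.Im w.
Proof. by case: z w => [a b] [c d]. Qed.

Lemma ImM (z w : R[i]) :
  complex.Im (z * w) = complex.Re z * complex.Im w + complex.Im z * complex.Re w.
Proof. by case: z w => [a b] [c d]. Qed.

Lemma Re_conj (z : R[i]) : complex.Re z^* = complex.Re z. Proof. by case: z. Qed.
Lemma Im_conj (z : R[i]) : complex.Im z^* = - complex.Im z. Proof. by case: z. Qed.

Lemma bounded_mfun1 : bounded_mfun (fun=> 1).
Proof.
split; [exact: measurable_cst|exact: measurable_cst|].
by exists 1 => U /=; rewrite normr1 normr0.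
Qed.

Lemma bounded_mfunM f g : bounded_mfun f -> bounded_mfun g ->
  bounded_mfun (fun U => f U * g U).
Proof.
move=> [f1 f2 [M hM]] [g1 g2 [M' hM']]; split.
- rewrite (_ : (fun U => _) = (fun U => complex.Re (f U) * complex.Re (g U) -
    complex.Im (f U) * complex.Im (g U))); last by apply/funext => U; rewrite ReM.
  by apply: measurable_funB; apply: measurable_funM.
- rewrite (_ : (fun U => _) = (fun U => complex.Re (f U) * complex.Im (g U) +
    complex.Im (f U) * complex.Re (g U))); last by apply/funext => U; rewrite ImM.
  by apply: measurable_funD; apply: measurable_funM.
exists (M * M' + M * M') => U; have [h1 h2] := hM U; have [h1' h2'] := hM' U.
rewrite ReM ImM; split.
  by apply: le_trans (ler_normB _ _) _; apply: lerD; rewrite normrM ler_pM.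
by apply: le_trans (ler_normD _ _) _; apply: lerD; rewrite normrM ler_pM.
Qed.

Lemma bounded_mfun_conj f : bounded_mfun f -> bounded_mfun (fun U => (f U)^*).
Proof.
move=> [f1 f2 [M hM]]; split.
- by rewrite (_ : (fun U => _) = (fun U => complex.Re (f U))) //; apply/funext => U; rewrite Re_conj.
- rewrite (_ : (fun U => _) = (fun U => - complex.Im (f U))); last first.
    by apply/funext => U; rewrite Im_conj.
  exact: measurableT_comp.
by exists M => U; rewrite Re_conj Im_conj normrN.
Qed.

Lemma bounded_mfun_prod (I : Type) (r : seq I) (F : I -> T -> R[i]) :
  (forall i, bounded_mfun (F i)) -> bounded_mfun (fun U => \prod_(i <- r) F i U).
Proof.
move=> hF; elim: r => [|i r IHr].
  have -> : (fun U => \prod_(i <- [::]) F i U) = fun=> 1 by apply/funext => U; rewrite big_nil.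
  exact: bounded_mfun1.
have -> : (fun U => \prod_(i <- i :: r) F i U) = fun U => F i U * \prod_(i <- r) F i U.
  by apply/funext => U; rewrite big_cons.
exact: bounded_mfunM.
Qed.

Lemma additive_continuous (h : R[i]^o -> R^o) :
  (forall z w, h z - h w = h (z - w)) -> (forall z, `|h z|%:C%C <= `|z|) -> continuous h.
Proof.
move=> hB h_le z A /nbhs_ballP[e /= e0 eA]; apply/nbhs_ballP.
exists (e%:C%C) => [|w]; first by rewrite /= ltcR.
rewrite -ball_normE /= => zw; apply: eA; rewrite -ball_normE /= -ltcR hB.
exact: le_lt_trans (h_le _) zw.
Qed.

Lemma Re_continuous : continuous (@complex.Re R : R[i]^o -> R^o).
Proof.
apply: additive_continuous => [[a b] [c d] //|z].
exact: normc_ge_Re.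
Qed.

Lemma Im_continuous : continuous (@complex.Im R : R[i]^o -> R^o).
Proof.
apply: additive_continuous => [[a b] [c d] //|z].
have -> : complex.Im z = complex.Re (- 'i * z) by case: z => [a b]; rewrite ReM /=; ring.
by apply: le_trans (normc_ge_Re _) _; rewrite normrM normrN normCi mul1r.
Qed.

Lemma measurable_entry (h : R[i]^o -> R^o) (i j : 'I_N) : continuous h ->
  measurable_fun [set: T] (fun U : T => h (sval U i j) : R).
Proof.
move=> hc; apply: (measurability _ (RGenOInfty.measurableE R)) => _ [_ [a ->] <-].
rewrite setTI; apply: sub_sigma_algebra.
exists ((fun A : 'M[R[i]^o]_N => h (A i j)) @^-1` `]a, +oo[%classic); last by [].
have /continuousP : continuous (fun A : 'M[R[i]^o]_N => h (A i j)).
  move=> A; apply: continuous_comp; first exact: coord_continuous.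
  exact: hc.
by apply; apply: interval_open.
Qed.

Lemma unitary_sum_row (U : unitary R N) i :
  \sum_k (complex.Re (sval U i k) ^+ 2 + complex.Im (sval U i k) ^+ 2) = 1.
Proof.
have /unitarymxP/matrixP/(_ i i) := svalP U; rewrite !mxE eqxx => /(congr1 (@complex.Re R)) /= <-.
rewrite raddf_sum /=; apply: eq_bigr => k _.
by rewrite !mxE ReM Re_conj Im_conj mulrN opprK.
Qed.

Lemma bounded_mfun_entry i j : bounded_mfun (fun U : T => sval U i j).
Proof.
split; [exact: measurable_entry Re_continuous|exact: measurable_entry Im_continuous|].
exists 1 => U; have := unitary_sum_row U i; rewrite (bigD1 j) //=.
set rest := \sum_(k | _) _ => e.
have r0 : 0 <= rest by apply: sumr_ge0 => k _; rewrite addr_ge0 ?sqr_ge0.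
have sq (x y : R) : x ^+ 2 + y ^+ 2 + rest = 1 -> `|x| <= 1.
  move=> exy; rewrite -(@ler_pXn2r _ 2) ?nnegrE // expr1n real_normK ?num_real //.
  by have := sqr_ge0 y; lra.
by split; [apply: sq e|apply: (sq _ (complex.Re (sval U i j))); rewrite (addrC (_ ^+ 2))].
Qed.

Lemma unitary_sum_col (U : unitary R N) x y :
  \sum_k sval U k x * (sval U k y)^* = (x == y)%:R.
Proof.
have /unitarymxP := svalP U => /mulmx1C/matrixP/(_ y x); rewrite !mxE [y == x]eq_sym => <-.
by apply: eq_bigr => k _; rewrite !mxE mulrC.
Qed.

Variable mu : probability T R.

Lemma integrable_bounded f : bounded_mfun f ->
  mu.-integrable [set: T] (EFin \o (fun U => complex.Re (f U))).
Proof.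
move=> [f1 _ [M hM]]; apply: measurable_bounded_integrable => //.
  by apply: le_lt_trans (probability_le1 mu measurableT) _; rewrite ltry.
exists M; split; first exact: num_real.
move=> M' MM' U _ /=; apply: le_trans (ltW MM'); by have [] := hM U.
Qed.

Lemma Rintegral_Re_sum (I : finType) (F : I -> T -> R[i]) :
  (forall i, bounded_mfun (F i)) ->
  \sum_i \int[mu]_U complex.Re (F i U) = \int[mu]_U complex.Re (\sum_i F i U).
Proof.
move=> hF; elim: (index_enum I) => [|i r IHr].
  have -> : \int[mu]_U complex.Re (\sum_(i <- [::]) F i U) = \int[mu]_(U in [set: T]) (0 : R).
    by apply: eq_Rintegral => U _; rewrite big_nil.
  by rewrite big_nil Rintegral_cst // mul0r.
rewrite big_cons IHr -RintegralD //.
- by apply: eq_Rintegral => U _; rewrite big_cons raddfD.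
- exact: integrable_bounded.
have -> : (fun U => complex.Re (\sum_(j <- r) F j U)) = (fun U => \sum_(j <- r) complex.Re (F j U)).
  by apply/funext => U; rewrite raddf_sum.
elim: r {IHr} => [|j r IHr].
  rewrite (_ : (fun U => _) = fun=> 0); last by apply/funext => U; rewrite big_nil.
  exact: integrable0.
rewrite (_ : (fun U => _) = (fun U => complex.Re (F j U) + \sum_(j <- r) complex.Re (F j U)));
  last by apply/funext => U; rewrite big_cons.
by apply: (integrableD _ (integrable_bounded (hF j)) IHr).
Qed.

(** The column indices are an injective a, available since m <= N, and b = a o u; the row indices h
    are the same on both sides and are summed over. Orthonormality of the columns makes the
    integrand the constant [u = 1]. In the Weingarten sum only tau = u^-1 survives, and sigma is
    counted by the N^#(sigma) maps h constant on its cycles. *)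
Lemma weingarten_inverse m (W : 'S_m -> R) : (m <= N)%N -> is_weingarten mu W ->
  forall u : 'S_m, \sum_(r : 'S_m) N%:R ^+ #|porbits r| * W (u * r^-1)%g = (u == 1%g)%:R.
Proof.
move=> mN hW u; pose a (s : 'I_m) : 'I_N := widen_ord mN s; pose b (s : 'I_m) := a (u s).
have a_inj : injective a by move=> s t /(congr1 val) /= e; apply: val_inj.
have tauE (t : 'S_m) : \prod_s (a s == b (t s))%:R = (t == u^-1%g)%:R :> R.
  rewrite prod_natr_bool; congr (nat_of_bool _)%:R; apply/forallP/eqP => [h|-> s]; last by rewrite /b permKV.
  apply/permP => s; apply: (@perm_inj _ u); rewrite permKV.
  by apply: a_inj; apply/esym/eqP; apply: h.
have sigE (s : 'S_m) (h : {ffun 'I_m -> 'I_N}) :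
    \prod_x (h x == h (s x))%:R = (const_on (porbits s) h)%:R :> R.
  rewrite prod_natr_bool; congr (nat_of_bool _)%:R.
  have pb x : finset.pblock (porbits s) x = porbit s x.
    by apply: finset.def_pblock (finset.partition_trivIset (set_partition_porbits s)) (imset_f _ isT) (porbit_id _ _).
  apply/forallP/const_onP => [hs x y|hs x]; last first.
    by rewrite (hs x (s x)) // pb; apply/porbitP; exists 1%N; rewrite expg1.
  rewrite pb => /porbitP[k ->]; elim: k => [|k IHk]; first by rewrite expg0 perm1.
  by rewrite expgSr permM -(eqP (hs _)).
have eqh (h : {ffun 'I_m -> 'I_N}) :
   \int[mu]_U complex.Re ((\prod_s sval U (h s) (a s)) * (\prod_s sval U (h s) (b s))^*) =
   \sum_(s : 'S_m) (const_on (porbits s) h)%:R * W (u * s)%g.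
  have := congr1 (@complex.Re R) (hW h a h b); rewrite /= => ->.
  apply: eq_bigr => s _; rewrite (bigD1 u^-1%g) //= tauE eqxx mulr1 invgK sigE big1 ?addr0 //.
  by move=> t /negbTE tu; rewrite tauE tu mulr0 mul0r.
have hb (h : {ffun 'I_m -> 'I_N}) : bounded_mfun (fun U : T =>
    (\prod_s sval U (h s) (a s)) * (\prod_s sval U (h s) (b s))^*).
  apply: bounded_mfunM; first by apply: bounded_mfun_prod => s; apply: bounded_mfun_entry.
  by apply: bounded_mfun_conj; apply: bounded_mfun_prod => s; apply: bounded_mfun_entry.
have := Rintegral_Re_sum hb; under eq_bigr => h _ do rewrite eqh.
rewrite exchange_big /=.
have -> : \sum_(s : 'S_m) \sum_(h : {ffun 'I_m -> 'I_N}) (const_on (porbits s) h)%:R * W (u * s)%g =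
   \sum_(r : 'S_m) N%:R ^+ #|porbits r| * W (u * r^-1)%g.
  rewrite (reindex_inj invg_inj) /=; apply: eq_bigr => r _.
  rewrite -mulr_suml porbitsV; congr (_ * _).
  rewrite -natr_sum -natrX; congr _%:R.
  rewrite -[X in (X ^ _)%N]card_ord -(card_const_on _ (set_partition_porbits r)) -sum1_card.
  by rewrite [RHS]big_mkcond; apply: eq_bigr => h _; rewrite inE; case: const_on.
move=> ->; transitivity (\int[mu]_(U in [set: T]) ((u == 1%g)%:R : R)); last first.
  rewrite Rintegral_cst // (_ : fine _ = 1) ?mulr1 //.
  by rewrite -[1]/(fine 1%E); congr fine; apply: probability_setT.
apply: eq_Rintegral => U _; under eq_bigr => h _ do rewrite rmorph_prod -big_split /=.
rewrite -(bigA_distr_bigA (fun s k => sval U k (a s) * (sval U k (b s))^*)).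
under eq_bigr => s _ do rewrite unitary_sum_col.
have -> : \prod_s (a s == b s)%:R = ((u == 1%g)%:R : R[i]).
  rewrite prod_natr_bool; congr (nat_of_bool _)%:R; apply/forallP/eqP => [h|u1 s];
    last by rewrite /b u1 perm1.
  by apply/permP => s; rewrite perm1; apply/esym/a_inj/eqP/h.
by case: eqP.
Qed.

End Weingarten.

(** * Expansion of the cumulant and comparison of coefficients *)

Lemma asym_weingarten (R : realType) (mu : forall N : nat, probability (unitary_borel R N) R)
    (m : nat) (W : nat -> 'S_m -> R) :
  (forall N, (m <= N)%N -> is_weingarten (mu N) (W N)) ->
  forall u, asym (fun N => N%:R ^+ m * W N u) (all_fact R (finset.setTfor 'I_m) u).
Proof.
move=> hW u; apply: (@asym_inverse R m (fun N u => N%:R ^+ m * W N u) (maxn 1 m)) => N.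
rewrite geq_max => /andP[N0 mN] {}u.
rewrite -(weingarten_inverse mN (hW N mN) u); apply: eq_bigr => r _.
rewrite mulrA; congr (_ * _).
have nz : N%:R != 0 :> R by rewrite pnatr_eq0 -lt0n.
have em : (#|porbits r| + pnorm r = m)%N.
  by rewrite /pnorm subnKC ?card_porbits_le // card_ord.
(* This turns the weights N^#(r) of the orthogonality relation into the weights N^(-|r|) of
   [asym_inverse]. *)
have -> : N%:R ^+ m = N%:R ^+ #|porbits r| * N%:R ^+ pnorm r :> R by rewrite -exprD em.
by rewrite exprVn mulrCA mulVf ?mulr1 // expf_neq0.
Qed.

Lemma asym_W_C (R : realType) (mu : forall N : nat, probability (unitary_borel R N) R)
    (W : forall N m : nat, 'S_m -> R) (n D : nat) (sigma tau : 'I_D -> 'S_n) :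
  (forall N m : nat, (m <= N)%N -> is_weingarten (mu N) (W N m)) ->
  asym (fun N => N%:R ^+ (n * D) * W_C (W N) sigma tau) (cumulant_series R sigma tau).
Proof.
move=> hW; rewrite /cumulant_series.
apply: (@eq_asym _ (fun N => \sum_(P | set_partition P) (-1) ^+ (#|P| - 1) * ((#|P| - 1)`!)%:R *
    ((refines (joint_orbits sigma tau) P)%:R * \prod_(B in P) \prod_(c < D)
       (N%:R ^+ #|B| * W N #|B| (block_perm B (quotient_perm sigma tau c)))))).
  move=> N; rewrite /W_C mulr_sumr; apply: eq_bigr => P pP.
  rewrite [RHS]mulrCA; congr (_ * _); rewrite /W_part.
  have [PiP|] := boolP (refines _ P); last by rewrite !mul0r mulr0.
  rewrite !mul1r.
  (* The blocks of P have total size n, so each factor W receives exactly the power N^|B| that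
     normalises it. *)
  have -> : N%:R ^+ (n * D) = \prod_(B in P) \prod_(c < D) N%:R ^+ #|B| :> R.
    rewrite (eq_bigr (fun B : {set 'I_n} => (N%:R ^+ D) ^+ #|B|)); last first.
      by move=> B _; rewrite prodr_const card_ord exprAC.
    by rewrite prodrXr -(finset.card_partition pP) cardsT card_ord -exprM mulnC.
  rewrite -big_split /=; apply: eq_bigr => B BP; rewrite -big_split /=; apply: eq_bigr => c _.
  have [s1 s2] := joint_stable c pP PiP BP.
  by rewrite /quotient_perm block_permM ?stableV // block_permV.
move=> L; apply: asym_to_sum => P pP; move: L.
have [PiP|_] := boolP (refines _ P); last first.
  rewrite mul0r mulr0; apply: (@eq_asym _ (fun=> 0)) => [N|L]; first by rewrite mul0r mulr0.
  exact: asym_to0.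
apply: asymM; first exact: asymM (asym_sign _ _) (asym_nat _ _).
apply: asymM; first exact: asym_nat.
apply: asym_prod => B BP; apply: asym_prod => c _.
rewrite all_fact_block; last exact: quotient_stable PiP BP.
by apply: (@asym_weingarten R mu #|B| (fun N => W N #|B|)) => N mN; apply: hW.
Qed.

(** Convergence at the smallest value N = n bounds the terms there, hence |a_l| <= C n^l. For N >=
    2n the tail after L terms is then dominated by a geometric series of ratio 1/2. *)
Lemma asym_series (R : realType) (a V : nat -> R) (n K : nat) : (0 < n)%N ->
  (forall N : nat, (n <= N)%N ->
    N%:R ^- K * series (fun l => a l * N%:R ^- l) k @[k --> \oo] --> V N) ->
  asym (fun N => N%:R ^+ K * V N) (Fps a).
Proof.
move=> n0 cv.
have cvS N : (n <= N)%N -> series (fun l => a l * N%:R ^- l) k @[k --> \oo] --> N%:R ^+ K * V N.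
  move=> nN; have nz : N%:R ^+ K != 0 :> R.
    by rewrite expf_neq0 // pnatr_eq0 -lt0n (leq_trans n0 nN).
  rewrite (_ : (fun k : nat => series (fun l => a l * N%:R ^- l) k) =
      (fun k : nat => N%:R ^+ K * (N%:R ^- K * series (fun l => a l * N%:R ^- l) k))).
    exact: cvgM (cvg_cst _) (cv N nN).
  by apply/funext => k; rewrite mulrA mulfV // mul1r.
have [C C0 hC] : exists2 C, 0 <= C & forall l, `|a l| <= C * n%:R ^+ l.
  have : cvgn (series (fun l => a l * n%:R ^- l)) by apply/cvg_ex; exists (n%:R ^+ K * V n); apply: cvS.
  move/cvg_series_cvg_0 => c0.
  have /cvg_seq_bounded[M [_ hM]] : cvgn (fun l => a l * n%:R ^- l).
    by apply/cvg_ex; exists 0.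
  exists (`|M| + 1); first by rewrite addr_ge0.
  move=> l; have nl : 0 < n%:R ^+ l :> R by rewrite exprn_gt0 // ltr0n.
  have := hM (`|M| + 1) _ l I; rewrite /= normrM normfV (gtr0_norm nl) ler_pdivrMr //; apply.
  by apply: le_lt_trans (ler_norm _) _; rewrite ltrDl.
move=> L; exists (C * 2 * n%:R ^+ L), (2 * n)%N; split=> [|N nN]; first by rewrite muln_gt0.
have nN' : (n <= N)%N by apply: leq_trans nN; rewrite leq_pmull.
have N_gt0 : 0 < N%:R :> R by rewrite ltr0n (leq_trans n0 nN').
pose q : R := n%:R * N%:R^-1.
have q0 : 0 <= q by rewrite mulr_ge0 // invr_ge0 ltW.
have q2 : q <= 2^-1.
  by rewrite ler_pdivrMr // mulrC ler_pdivlMr ?ltr0n // -natrM ler_nat mulnC.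
have psE k : psum k (Fps a) N%:R^-1 = series (fun l => a l * N%:R ^- l) k.
  by rewrite /psum /series /= big_mkord; apply: eq_bigr => l _; rewrite exprVn.
(* 2 - 2 * 2^(-j) is the exact partial sum of the geometric series, the form that the induction on j
   reproduces. *)
have tail j : `|psum (L + j) (Fps a) N%:R^-1 - psum L (Fps a) N%:R^-1| <=
    C * q ^+ L * (2 - 2 * 2^-1 ^+ j).
  elim: j => [|j IHj]; first by rewrite addn0 subrr normr0 expr0 mulr1 subrr mulr0.
  rewrite addnS {1}/psum big_ord_recr /= -/(psum _ _ _) addrAC.
  apply: le_trans (ler_normD _ _) _.
  have -> : C * q ^+ L * (2 - 2 * 2^-1 ^+ j.+1) =
     C * q ^+ L * (2 - 2 * 2^-1 ^+ j) + C * q ^+ L * 2^-1 ^+ j by rewrite exprS; field.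
  apply: lerD => //; rewrite normrM [`|_ ^+ _|]ger0_norm ?exprn_ge0 ?invr_ge0 ?ler0n //.
  apply: (@le_trans _ _ (C * q ^+ (L + j))).
    by rewrite /q exprMn mulrA ler_wpM2r ?exprn_ge0 ?invr_ge0 ?ler0n.
  by rewrite exprD mulrA ler_wpM2l ?mulr_ge0 ?exprn_ge0 // lerXn2r ?nnegrE ?invr_ge0 ?ler0n.
have tail' j : `|psum (L + j) (Fps a) N%:R^-1 - psum L (Fps a) N%:R^-1| <= C * q ^+ L * 2.
  apply: le_trans (tail j) _; rewrite ler_wpM2l ?mulr_ge0 ?exprn_ge0 //.
  by rewrite gerBl mulr_ge0 // exprn_ge0 // invr_ge0.
have -> : C * 2 * n%:R ^+ L * N%:R^-1 ^+ L = C * q ^+ L * 2.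
  by rewrite /q exprMn; ring.
apply/ler_addgt0Pl => e e0.
have /cvgrPdist_le/(_ e e0)[k0 _ hk] := cvS N nN'.
have := hk (L + k0)%N (leq_addl _ _); rewrite /= -psE => h1.
have -> : N%:R ^+ K * V N - psum L (Fps a) N%:R^-1 =
  (N%:R ^+ K * V N - psum (L + k0) (Fps a) N%:R^-1) +
  (psum (L + k0) (Fps a) N%:R^-1 - psum L (Fps a) N%:R^-1) by ring.
by apply: le_trans (ler_normD _ _) _; apply: lerD.
Qed.

(** The vanishing coefficient in degree l0+1 improves the relative error from order 1/N to order
    1/N^2. *)
Lemma asym_lead (R : realType) (f : nat -> R) (s : fps R) (l0 : nat) :
  asym f s -> (forall l, (l < l0)%N -> fcoef s l = 0) -> fcoef s l0 != 0 ->
  fcoef s l0.+1 = 0 ->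
  (fun N => f N * N%:R ^+ l0 / fcoef s l0 - 1) =O_\oo (fun N : nat => N%:R ^- 2 : R).
Proof.
move=> fs slow s0 s1; have [C [N0 [N00 h]]] := fs l0.+2.
apply/eqO_exP; exists (`|C| / `|fcoef s l0| + 1); first by rewrite ltr_wpDl ?divr_ge0.
exists N0 => // N /= NN0; have N_gt0 : 0 < N%:R :> R by rewrite ltr0n (leq_trans N00 NN0).
have := h N NN0; rewrite /psum !big_ord_recr /= s1 mul0r addr0 big1 ?add0r => [hN|l _]; last first.
  by rewrite slow ?mul0r.
have nz : N%:R ^+ l0 != 0 :> R by rewrite expf_neq0 // gt_eqF.
have -> : f N * N%:R ^+ l0 / fcoef s l0 - 1 =
   (f N - fcoef s l0 * N%:R^-1 ^+ l0) * N%:R ^+ l0 / fcoef s l0.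
  by rewrite exprVn; field; rewrite nz s0.
rewrite !normrM normfV [`|N%:R ^+ l0|]gtr0_norm ?exprn_gt0 // [`|N%:R ^- 2|]gtr0_norm ?invr_gt0 ?exprn_gt0 //.
apply: (@le_trans _ _ (`|C| * N%:R^-1 ^+ l0.+2 * N%:R ^+ l0 / `|fcoef s l0|)).
  rewrite ler_wpM2r ?invr_ge0 // ler_wpM2r ?exprn_ge0 ?ler0n //; apply: le_trans hN _.
  by rewrite ler_wpM2r ?exprn_ge0 ?invr_ge0 ?ler0n // ler_norm.
have -> : `|C| * N%:R^-1 ^+ l0.+2 * N%:R ^+ l0 / `|fcoef s l0| =
   `|C| / `|fcoef s l0| * N%:R ^- 2.
  rewrite -addn2 exprD !exprVn; field.
  by rewrite normr_eq0 s0 nz gt_eqF.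
by rewrite ler_wpM2r ?invr_ge0 ?exprn_ge0 ?ler0n // lerDl.
Qed.

Theorem theorem4p1 (R : realType)
  (mu : forall N : nat, probability (unitary_borel R N) R)
  (mu_haar : forall N : nat, is_haar (mu N))
  (W : forall N m : nat, 'S_m -> R)
  (W_weingarten : forall N m : nat, (m <= N)%N -> is_weingarten (mu N) (W N m))
  (n D : nat) (n_gt0 : (0 < n)%N) (D_gt0 : (0 < D)%N)
  (sigma tau : 'I_D -> 'S_n)
  (p : nat -> R)
  (p_def : forall N : nat, (n <= N)%N ->
    N%:R ^- (n * D) * series (fun l => (-1) ^+ l * p l * N%:R ^- l) k
      @[k --> \oo] --> W_C (W N) sigma tau) :
  let nu := quotient_perm sigma tau in
  let Pi := joint_orbits sigma tau in
  let l0 := ell sigma tau in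
  [/\ (* (i) *)
      forall l : nat,
        (-1) ^+ l * p l =
        \sum_(pi : {ffun 'I_D -> {set {set 'I_n}}} | admissible sigma tau pi)
          \sum_(lc in weak_compositions 'I_D l)
            \prod_(c < D) block_gamma R (pi c) (nu c) (lc c),
      (* (ii) *)
      p l0 <> 0 /\ (forall l : nat, (l < l0)%N -> p l = 0),
      (* (iii) *)
      exists2 e : nat -> R,
        e =O_\oo (fun N : nat => N%:R ^- 2 : R) &
        forall N : nat, (n <= N)%N ->
          W_C (W N) sigma tau =
            N%:R ^- (n * D + l0) * ((-1) ^+ l0 * p l0) * (1 + e N),
      (* (iv) *)
      (-1) ^+ l0 * p l0 =
        \sum_(pi : {ffun 'I_D -> {set {set 'I_n}}} |
                admissible sigma tau pi
                && (merge_count sigma tau pi == #|Pi| - 1)%N)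
          \prod_(c < D) \prod_(B in pi c) gamma_lead R (block_perm B (nu c)) &
      (* (v) *)
      forall l : nat, (l0 < l)%N ->
        (-1) ^+ l * p l =
        \sum_(L < ((l - l0)./2).+1)
          \sum_(pi : {ffun 'I_D -> {set {set 'I_n}}} |
                  admissible sigma tau pi
                  && (merge_count sigma tau pi == #|Pi| + L - 1)%N)
            \sum_(g : {ffun 'I_D -> 'I_l.+1} |
                    (2 * (\sum_(c < D) g c + L) == l - l0)%N)
              \prod_(c < D) block_gamma_genus R (pi c) (nu c) (g c)].
Proof.
move=> nu Pi l0.
have aW := asym_W_C sigma tau W_weingarten.
have ap := asym_series n_gt0 p_def.
(* N^(nD) W_C has two asymptotic expansions, one from the convergent series that defines p and one
   from the orthogonality relation; they coincide by [asym_uniq]. *)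
have coefE l : (-1) ^+ l * p l = fcoef (cumulant_series R sigma tau) l.
  by rewrite -(asym_uniq ap aW).
have lead_neq0 : (-1) ^+ l0 * p l0 != 0 by rewrite coefE fcoef_cumulant_neq0.
split=> [l|||//|l ll].
- by rewrite coefE fcoef_cumulant.
- split=> [p0|l ll]; first by rewrite p0 mulr0 eqxx in lead_neq0.
  apply/eqP; have := coefE l; rewrite fcoef_cumulant_low // => /eqP.
  by rewrite mulf_eq0 signr_eq0.
(* e is the relative deviation itself, so the equation is exact for all N >= n and only the bound on
   e is asymptotic. *)
- exists (fun N => N%:R ^+ (n * D) * W_C (W N) sigma tau * N%:R ^+ l0 /
     ((-1) ^+ l0 * p l0) - 1).
    rewrite coefE; apply: asym_lead aW _ _ _.
    + by move=> l ll; rewrite fcoef_cumulant_low.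
    + by rewrite -coefE.
    + by rewrite fcoef_cumulant_odd // addSn addnn /= odd_double.
  move=> N nN; have nz : N%:R != 0 :> R by rewrite pnatr_eq0 -lt0n (leq_trans n_gt0).
  rewrite exprD; move: lead_neq0; move: ((-1) ^+ l0 * p l0) => c c0.
  have n1 : N%:R ^+ (n * D) != 0 :> R by rewrite expf_neq0.
  have n2 : N%:R ^+ l0 != 0 :> R by rewrite expf_neq0.
  move: (N%:R ^+ (n * D)) (N%:R ^+ l0) n1 n2 => x y n1 n2; field.
  by rewrite c0 n1 n2.
- by rewrite coefE fcoef_cumulant_lead.
- by rewrite coefE fcoef_cumulant_genus.
Qed.
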